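(* Let $\mathbb{G}=(W\phi,V)$ be a simply connected $\mathbb{Z}_\ell$-reflection coset, $\ell$ a very good prime for $\mathbb{G}$ not dividing the order of $\phi$, $q$ a prime power not divisible by $\ell$, and $e$ the order of $q$ modulo $\ell$. Then the orbit space $\mathcal{O}(\mathcal{T}_e(\mathbb{G}))$ is contractible. In particular, \[\mathcal{O}(\mathcal{L}_\ell(\mathbb{G}(q)))\simeq\mathcal{O}(\mathcal{T}_e(\mathbb{G})).\]
   Context: Reflection cosets. A $\mathbb{Z}_\ell$-reflection coset is a pair $\mathbb{G}=(W\phi,V)$ with $V$ a $\mathbb{Z}_\ell$-lattice of finite rank, $W\le\mathrm{GL}(V)$ a finite reflection group, and $\phi\in\mathrm{GL}(V)$ of finite order normalising $W$. A reflection subcoset of $\mathbb{G}$ is a $\mathbb{Z}_\ell$-reflection coset $\mathbb{G}'=(W'(w\phi)|_{V'},V')$ with $V'$ a pure sublattice of $V$, $W'$ a reflection subgroup of $N_W(V')|_{V'}$ (where $N_W(V')$ is the stabiliser of $V'$), and $w\phi\in W\phi$ stabilising $V'$ and normalising $W'$; one writes $\mathbb{G}'\le\mathbb{G}$. A torus is a coset with trivial reflection group. The centraliser of a torus $\mathbb{T}=((w\phi)|_{V'},V')$ of $\mathbb{G}$ is $\mathbf{C}_{\mathbb{G}}(\mathbb{T})=(C_W(V')w\phi,V)$, where $C_W(V')$ is the pointwise stabiliser of $V'$. The order polynomial of $\mathbb{G}$ is $|\mathbb{G}|(x)=x^{N(W)}\prod_{i=1}^r\epsilon_i^{-2}(x^{d_i}-\epsilon_i)$,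 where $N(W)$ is the number of reflections of $W$ and $\{(d_i,\epsilon_i)\}$ is the multiset of generalised degrees of $W\phi$ acting on $V\otimes\mathbb{Q}_\ell$ (degrees of basic $W$-invariants chosen to be $\phi$-eigenvectors, together with the eigenvalues). Fix an $e$-th root of unity $\zeta\in\mathbb{Z}_\ell^\times$ and put $\Phi=x-\zeta\in\mathbb{Z}_\ell[x]$. A $\Phi$-torus (or $e$-torus) of $\mathbb{G}$ is a torus of $\mathbb{G}$ whose order polynomial is (up to a unit constant) a power of $\Phi$ (the zeroth power being allowed). Centralisers of $\Phi$-tori are the $e$-split (or $\Phi$-split) Levi subcosets. For $w\in W$ and $\mathbb{H}=(W'\phi',V')\le\mathbb{G}$ put ${}^w\mathbb{H}=(wW'\phi'w^{-1},wV')$. The category $\mathcal{T}_e(\mathbb{G})$ has as objects the $e$-split Levi subcosets of $\mathbb{G}$, and $\mathrm{Hom}(\mathbb{L},\mathbb{K})=\{w\in W\mid {}^w\mathbb{L}\le\mathbb{K}\}$, with composition given by multiplication in $W$. Orbit space. An EI-category is a small category in which every endomorphism is an automorphism. For an EI-category $\mathcal{C}$ the subdivision category $S(\mathcal{C})$ has as objects the chains $\sigma=(X_0\to X_1\to\dots\to X_m)$ of non-isomorphisms of $\mathcal{C}$, $m\ge0$, viewed as functors $\sigma:[m]\to\mathcal{C}$ with $[m]$ the poset category $0\le1\le\dots\le m$; a morphism from $\sigma:[m]\to\mathcal{C}$ to $\tau:[n]\to\mathcal{C}$ is a pair $(\alpha,\mu)$ with $\alpha:[m]\to[n]$ a functor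 and $\mu:\sigma\to\tau\circ\alpha$ a natural isomorphism. $S(\mathcal{C})$ is again EI. The set $[S(\mathcal{C})]$ of isomorphism classes of objects is a poset via $[\sigma]\le[\tau]$ iff $\mathrm{Hom}_{S(\mathcal{C})}(\sigma,\tau)\ne\emptyset$. The orbit space is $\mathcal{O}(\mathcal{C})=|\Delta([S(\mathcal{C})])|$, the geometric realisation of the order complex (simplices are finite totally ordered chains) of this poset. The hypotheses on $\mathbb{G}$, and $\mathcal{L}_\ell(\mathbb{G}(q))$. ''Simply connected'' means that $(W,V)$ is a simply connected $\mathbb{Z}_\ell$-reflection group, i.e. the connected $\ell$-compact group $X$ with Weyl group $W$ acting on the lattice $V$ is simply connected. ''Very good'' is in the sense of Kessar--Malle--Semeraro, ''Weight conjectures for $\ell$-compact groups and spetses'', Definition 2.4 (this is the definition to which the theorem refers). Under the hypotheses on $\mathbb{G},\ell,q$ one associates to $(\mathbb{G},q)$ the space $B\mathbb{G}(q)$, namely the space of homotopy fixed points on $BX$ of the unstable Adams operation $\psi^q$ twisted by the self-equivalence of $BX$ induced by $\phi$. This space is the classifying space of an $\ell$-local finite group $(S,\mathcal{F},\mathcal{L})$, that is, $\mathcal{F}$ is a saturated fusion system on a finite $\ell$-group $S$, $\mathcal{L}$ is a centric linking system associated to $\mathcal{F}$ (an EI-category), and $|\mathcal{L}|^\wedge_\ell\simeq B\mathbb{G}(q)$. One writes $\mathcal{L}_\ell(\mathbb{G}(q))=\mathcal{L}$. *)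

(* Defs.v *)
From HB Require Import structures.
From mathcomp Require Import all_boot all_order all_algebra.
From mathcomp Require Import boolp classical_sets functions cardinality fsbigop.
From mathcomp Require Import reals topology normedtype.
From mathcomp Require Import fingroup pgroup center.
From mathcomp Require mpoly.
(* The notations of mpoly are incompatible with those of topology. *)
Import -(notations) mpoly.
Set Implicit Arguments. Unset Strict Implicit. Unset Printing Implicit Defensive.
Import Order.TTheory GRing.Theory Num.Theory.
Import numFieldNormedType.Exports.
Local Open Scope classical_set_scope.
Local Open Scope ring_scope.

(** * l-adic integers *)

Definition Zl_red (l n : nat) (x : 'Z_(l ^ n.+2)) : 'Z_(l ^ n.+1) := inZp x.

(** The inverse limit of the rings Z/(l^n), n > 0. As ['Z_m] is only correct for
[m > 1], this is meaningful for [l > 1]. *)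
Record Zl (l : nat) := MkZl {
  Zl_seq :> forall n, 'Z_(l ^ n.+1);
  Zl_compat : forall n, Zl_seq n = Zl_red (Zl_seq n.+1) }.

Section ZlRing.
Variable l : nat.

Lemma Zl_dvd n : ((Zp_trunc (l ^ n.+1)).+2 %| (Zp_trunc (l ^ n.+2)).+2)%N.
Proof.
case: (ltnP 1 l) => [l1|]; last by case: l => [|[|?]] // _; rewrite ?exp0n ?exp1n.
have l1n m : (1 < l ^ m.+1)%N by rewrite -{1}(exp1n m.+1) ltn_exp2r.
by rewrite !Zp_cast // [in X in (_ %| X)%N]expnS dvdn_mull.
Qed.

Lemma Zl_redD n : {morph (@Zl_red l n) : x y / x + y}.
Proof.
by move=> x y; apply/val_inj; rewrite /= modn_dvdm ?Zl_dvd // modnDm.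
Qed.

Lemma Zl_redM n : {morph (@Zl_red l n) : x y / x * y}.
Proof.
by move=> x y; apply/val_inj; rewrite /= modn_dvdm ?Zl_dvd // modnMm.
Qed.

Lemma Zl_red0 n : @Zl_red l n 0 = 0.
Proof. by apply/val_inj; rewrite /= mod0n. Qed.

Lemma Zl_red1 n : @Zl_red l n 1 = 1.
Proof. by apply/val_inj. Qed.

Lemma Zl_redN n : {morph (@Zl_red l n) : x / - x}.
Proof.
by move=> x; apply/(addrI (Zl_red x)); rewrite -Zl_redD !subrr Zl_red0.
Qed.

Lemma Zl_inj (x y : Zl l) : (forall n, x n = y n) -> x = y.
Proof.
case: x y => [x xP] [y yP] /= exy; have {}exy : x = y by exact: functional_extensionality_dep.
by subst y; rewrite (Prop_irrelevance xP yP).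
Qed.

Definition Zl0 : Zl l.
Proof. by exists (fun=> 0) => n; rewrite Zl_red0. Defined.
Definition Zl1 : Zl l.
Proof. by exists (fun=> 1) => n; rewrite Zl_red1. Defined.
Definition Zl_opp (x : Zl l) : Zl l.
Proof. by exists (fun n => - x n) => n; rewrite Zl_redN -Zl_compat. Defined.
Definition Zl_add (x y : Zl l) : Zl l.
Proof. by exists (fun n => x n + y n) => n; rewrite Zl_redD -!Zl_compat. Defined.
Definition Zl_mul (x y : Zl l) : Zl l.
Proof. by exists (fun n => x n * y n) => n; rewrite Zl_redM -!Zl_compat. Defined.

HB.instance Definition _ := gen_eqMixin (Zl l).
HB.instance Definition _ := gen_choiceMixin (Zl l).

Fact Zl_addA : associative Zl_add.
Proof. by move=> *; apply: Zl_inj => n /=; rewrite addrA. Qed.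
Fact Zl_addC : commutative Zl_add.
Proof. by move=> *; apply: Zl_inj => n /=; rewrite addrC. Qed.
Fact Zl_add0 : left_id Zl0 Zl_add.
Proof. by move=> *; apply: Zl_inj => n /=; rewrite add0r. Qed.
Fact Zl_addN : left_inverse Zl0 Zl_opp Zl_add.
Proof. by move=> *; apply: Zl_inj => n /=; rewrite addNr. Qed.
HB.instance Definition _ := GRing.isZmodule.Build (Zl l) Zl_addA Zl_addC Zl_add0 Zl_addN.

Fact Zl_mulA : associative Zl_mul.
Proof. by move=> *; apply: Zl_inj => n /=; rewrite mulrA. Qed.
Fact Zl_mulC : commutative Zl_mul.
Proof. by move=> *; apply: Zl_inj => n /=; rewrite mulrC. Qed.
Fact Zl_mul1 : left_id Zl1 Zl_mul.
Proof. by move=> *; apply: Zl_inj => n /=; rewrite mul1r. Qed.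
Fact Zl_mulD : left_distributive Zl_mul Zl_add.
Proof. by move=> *; apply: Zl_inj => n /=; rewrite mulrDl. Qed.
Fact Zl_1neq0 : Zl1 != 0 :> Zl l.
Proof. by apply/eqP => /(congr1 (fun x : Zl l => x 0%N)) /= /eqP; rewrite oner_eq0. Qed.
HB.instance Definition _ := GRing.Zmodule_isComNzRing.Build (Zl l)
  Zl_mulA Zl_mulC Zl_mul1 Zl_mulD Zl_1neq0.
End ZlRing.

(** * Categories, subdivision and orbit spaces *)

Record cat_on (ob : Type) := CatOn {
  hom : ob -> ob -> Type;
  cat_id : forall x, hom x x;
  cat_comp : forall x y z, hom y z -> hom x y -> hom x z;
  cat_compA : forall x y z t (h : hom z t) (g : hom y z) (f : hom x y),
    cat_comp h (cat_comp g f) = cat_comp (cat_comp h g) f;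
  cat_comp1 : forall x y (f : hom x y), cat_comp f (cat_id x) = f;
  cat_1comp : forall x y (f : hom x y), cat_comp (cat_id y) f = f }.
Arguments cat_id {ob} c x.
Arguments cat_comp {ob c x y z}.

Definition is_iso (T : Type) (C : cat_on T) (x y : T) (f : hom C x y) :=
  exists g : hom C y x, cat_comp g f = cat_id C x /\ cat_comp f g = cat_id C y.

Definition isomorphic (T : Type) (C : cat_on T) (x y : T) :=
  exists f : hom C x y, is_iso f.

(** The ordinal [n] is represented by ['I_n.+1]. *)
Record omap (m n : nat) := OMap {
  ofun :> 'I_m.+1 -> 'I_n.+1;
  omono : forall i j : 'I_m.+1, (i <= j)%N -> (ofun i <= ofun j)%N }.

Definition oid n : omap n n := @OMap n n id (fun _ _ h => h).
Definition ocomp m n p (b : omap n p) (a : omap m n) : omap m p :=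
  @OMap m p (b \o a) (fun _ _ h => omono b (omono a h)).

Record ofunctor (n : nat) (T : Type) (C : cat_on T) := OFunctor {
  fob :> 'I_n.+1 -> T;
  fmap : forall i j : 'I_n.+1, (i <= j)%N -> hom C (fob i) (fob j);
  fmap1 : forall (i : 'I_n.+1) (h : (i <= i)%N), fmap h = cat_id C (fob i);
  fmapM : forall (i j k : 'I_n.+1) (h : (i <= j)%N) (h' : (j <= k)%N) (h'' : (i <= k)%N),
    fmap h'' = cat_comp (fmap h') (fmap h) }.

Record chain (T : Type) (C : cat_on T) := Chain {
  clen : nat;
  cfun :> ofunctor clen C;
  cnoniso : forall (i j : 'I_clen.+1) (h : (i <= j)%N),
    j = i.+1 :> nat -> ~ is_iso (fmap cfun h) }.

Section Subdivision.
Variables (T : Type) (C : cat_on T).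

Record sd_hom (s t : chain C) := SdHom {
  sd_map : omap (clen s) (clen t);
  sd_nat : forall i, hom C (s i) (t (sd_map i));
  sd_nat_iso : forall i, is_iso (sd_nat i);
  sd_natural : forall (i j : 'I_(clen s).+1) (h : (i <= j)%N),
    cat_comp (sd_nat j) (fmap s h) = cat_comp (fmap t (omono sd_map h)) (sd_nat i) }.

Lemma is_iso_id x : is_iso (cat_id C x).
Proof. by exists (cat_id C x); rewrite !cat_comp1. Qed.

Lemma is_iso_comp x y z (g : hom C y z) (f : hom C x y) :
  is_iso g -> is_iso f -> is_iso (cat_comp g f).
Proof.
move=> [g' [g'g gg']] [f' [f'f ff']]; exists (cat_comp f' g'); split.
  by rewrite cat_compA -(cat_compA f') g'g cat_comp1.
by rewrite cat_compA -(cat_compA g) ff' cat_comp1.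
Qed.

Definition sd_id s : sd_hom s s.
Proof.
exists (oid _) (fun i => cat_id C (s i)) => [i|i j h]; first exact: is_iso_id.
by rewrite cat_1comp cat_comp1 (_ : omono (oid _) h = h).
Defined.

Definition sd_comp s t u (g : sd_hom t u) (f : sd_hom s t) : sd_hom s u.
Proof.
exists (ocomp (sd_map g) (sd_map f))
  (fun i => cat_comp (sd_nat g (sd_map f i)) (sd_nat f i)) => [i|i j h].
  by apply: is_iso_comp; exact: sd_nat_iso.
rewrite -cat_compA sd_natural cat_compA sd_natural -cat_compA.
by congr (cat_comp (fmap _ _) _); exact: Prop_irrelevance.
Defined.

Lemma sd_hom_eq s t (a : omap (clen s) (clen t)) mu mu' h1 h2 h1' h2' :
  mu = mu' -> @SdHom s t a mu h1 h2 = @SdHom s t a mu' h1' h2'.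
Proof.
move=> e; subst mu'.
by rewrite (Prop_irrelevance h1 h1') (Prop_irrelevance h2 h2').
Qed.

Fact sd_compA s t u v (h : sd_hom u v) (g : sd_hom t u) (f : sd_hom s t) :
  sd_comp h (sd_comp g f) = sd_comp (sd_comp h g) f.
Proof.
by apply: sd_hom_eq; apply: functional_extensionality_dep => i; exact: cat_compA.
Qed.

Fact sd_comp1 s t (f : sd_hom s t) : sd_comp f (sd_id s) = f.
Proof.
case: f => [[a am] mu hi hn]; apply: sd_hom_eq.
by apply: functional_extensionality_dep => i; exact: cat_comp1.
Qed.

Fact sd_1comp s t (f : sd_hom s t) : sd_comp (sd_id t) f = f.
Proof.
case: f => [[a am] mu hi hn]; apply: sd_hom_eq.
by apply: functional_extensionality_dep => i; exact: cat_1comp.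
Qed.

Definition subdivision : cat_on (chain C) :=
  CatOn sd_compA sd_comp1 sd_1comp.

End Subdivision.

Record iso_class (T : Type) (C : cat_on T) := IsoClass {
  iso_members :> set T;
  iso_classP : exists x, iso_members = [set y | isomorphic C x y] }.

(** A partial order when every endomorphism of [C] is an isomorphism. *)
Definition iso_class_le (T : Type) (C : cat_on T) (A B : iso_class C) :=
  exists x y, [/\ iso_members A x, iso_members B y & inhabited (hom C x y)].

Section OrderComplex.
Variables (R : realType) (P : Type) (le : P -> P -> Prop).

Definition is_chain (A : set P) :=
  finite_set A /\ forall x y, A x -> A y -> le x y \/ le y x.

(** Points of the realization are written in barycentric coordinates. *)
Record realization := Realization {
  bary :> P -> R;
  bary_ge0 : forall p, 0 <= bary p;
  bary_chain : is_chain [set p | bary p != 0];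
  bary_sum : \sum_(p \in [set p : {classic P} | bary p != 0]) bary p = 1 }.

HB.instance Definition _ := gen_eqMixin realization.
HB.instance Definition _ := gen_choiceMixin realization.

(** The weak topology: a subset is open iff its trace on each closed simplex is
open for the Euclidean topology of that simplex. *)
Definition realization_open (U : set realization) :=
  forall A : set P, is_chain A -> forall x : realization, U x ->
    [set p | x p != 0] `<=` A ->
    exists2 eps : R, 0 < eps & forall y : realization,
      [set p | y p != 0] `<=` A ->
      (forall p, A p -> `|x p - y p| < eps) -> U y.

Fact realization_openT : realization_open setT.
Proof. by move=> A _ x _ _; exists 1. Qed.

Fact realization_openI : setI_closed realization_open.
Proof.
move=> U V oU oV A cA x [Ux Vx] xA.
have [e e0 eU] := oU A cA x Ux xA; have [d d0 dV] := oV A cA x Vx xA.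
exists (Num.min e d) => [|y yA yx]; first by rewrite lt_min e0.
by split; [apply: eU|apply: dV] => // p /yx; rewrite lt_min => /andP[].
Qed.

Fact realization_open_bigU (I : Type) (f : I -> set realization) :
  (forall i, realization_open (f i)) -> realization_open (\bigcup_i f i).
Proof.
move=> of_ A cA x [i _ fx] xA; have [e e0 eU] := of_ i A cA x fx xA.
by exists e => // y yA yx; exists i => //; exact: eU.
Qed.

HB.instance Definition _ := isOpenTopological.Build realization
  realization_openT realization_openI realization_open_bigU.

End OrderComplex.

Definition orbit_space (R : realType) (T : Type) (C : cat_on T) : topologicalType :=
  realization R (@iso_class_le _ (subdivision C)).

Section Homotopy.
Variable R : realType.

Definition homotopic (X Y : topologicalType) (f g : X -> Y) :=
  exists H : (R * X)%type -> Y,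
    [/\ {within [set z | 0 <= z.1 <= 1], continuous H},
        forall x, H (0, x) = f x & forall x, H (1, x) = g x].

Definition homotopy_equivalent (X Y : topologicalType) :=
  exists (f : X -> Y) (g : Y -> X),
    [/\ continuous f, continuous g,
        homotopic (g \o f) id & homotopic (f \o g) id].

Definition contractible (X : topologicalType) :=
  exists x0 : X, homotopic id (fun _ : X => x0).

End Homotopy.

(** * Reflection cosets *)

Section Lattices.
Variables (l : nat) (V : lmodType (Zl l)).
Implicit Types (U H : set V) (f g w : V -> V).

Definition submodule U :=
  U 0 /\ forall (a : Zl l) u v, U u -> U v -> U (a *: u + v).

Definition is_basis U r (b : 'I_r -> V) :=
  (forall i, U (b i)) /\
  forall v, U v -> exists! c : {ffun 'I_r -> Zl l}, v = \sum_i c i *: b i.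

Definition lattice U := submodule U /\ exists r (b : 'I_r -> V), is_basis U b.

Definition pure_sublattice U H :=
  [/\ submodule U, U `<=` H &
      forall (c : Zl l) v, c != 0 -> H v -> U (c *: v) -> U v].

(** An endomorphism of a submodule [U] is represented by its extension by zero
to [V], so that two of them are equal iff they agree on [U]. *)
Definition restr U f : V -> V := fun v => if `[< U v >] then f v else 0.

Definition GL U : set (V -> V) := [set f |
  [/\ forall (a : Zl l) u v, U u -> U v -> f (a *: u + v) = a *: f u + f v,
      f @` U = U,
      forall u v, U u -> U v -> f u = f v -> u = v &
      forall v, ~ U v -> f v = 0]].

(** The image of [s - 1] has rank one. The order of [s] is not required to be
finite, since only elements of finite groups are considered. *)
Definition is_reflection U (s : V -> V) :=
  [/\ GL U s, exists2 v, U v & s v <> v &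
      exists2 a, U a & forall v, U v -> exists c : Zl l, s v - v = c *: a].

Definition finite_reflection_group U (W : set (V -> V)) :=
  [/\ finite_set W, W `<=` GL U, W (restr U id),
      (forall f g, W f -> W g -> W (f \o g)) &
      (forall f, W f -> exists2 g, W g & g \o f = restr U id)] /\
  (forall f, W f -> exists2 s : seq (V -> V),
      (forall i, (i < size s)%N ->
         W (nth id s i) /\ is_reflection U (nth id s i)) &
      f = foldr (fun g h => g \o h) (restr U id) s).

Definition normalises (c : V -> V) (W : set (V -> V)) :=
  [set c \o f | f in W] = [set f \o c | f in W].

(** [(W'c, U)] is recorded with its reflection group [W'] and the set [W'c]. *)
Record refcoset := Refcoset {
  rlat : set V;
  rgrp : set (V -> V);
  relts : set (V -> V) }.

Definition subcoset (H K : refcoset) :=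
  [/\ pure_sublattice (rlat H) (rlat K),
      finite_reflection_group (rlat H) (rgrp H),
      (forall f, rgrp H f -> exists w,
         [/\ rgrp K w, w @` rlat H = rlat H & f = restr (rlat H) w]) &
      exists c, [/\ relts K c, c @` rlat H = rlat H,
        normalises (restr (rlat H) c) (rgrp H) &
        relts H = [set f \o restr (rlat H) c | f in rgrp H]]].

Definition torus (T : refcoset) := rgrp T = [set restr (rlat T) id].

(** The group [w W' w^-1] and the coset [w W'c w^-1] for bijective [w]. *)
Definition conj_fun w (A : set (V -> V)) : set (V -> V) :=
  [set g : V -> V | exists2 f, A f & g \o w = w \o f].

Definition conj_coset w (H : refcoset) : refcoset :=
  Refcoset (w @` rlat H) (conj_fun w (rgrp H)) (conj_fun w (relts H)).

End Lattices.

Record reflection_coset (l : nat) := ReflectionCoset {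
  rc_lat : lmodType (Zl l);
  rc_latP : lattice [set: rc_lat];
  rc_grp : set (rc_lat -> rc_lat);
  rc_grpP : finite_reflection_group setT rc_grp;
  rc_phi : rc_lat -> rc_lat;
  rc_phi_GL : GL setT rc_phi;
  rc_phi_finite : exists2 m, (0 < m)%N & iter m rc_phi = id;
  rc_phi_norm : normalises rc_phi rc_grp }.
Arguments rc_phi {l} r _.
Arguments rc_grp {l} r _.

Definition to_coset l (G : reflection_coset l) : refcoset (rc_lat G) :=
  Refcoset setT (rc_grp G) [set w \o rc_phi G | w in rc_grp G].

Definition has_order (T : Type) (f : T -> T) (m : nat) :=
  [/\ (0 < m)%N, iter m f = id &
      forall k, (0 < k < m)%N -> iter k f <> id].

Section OrderPolynomial.
Variables (l : nat) (V : lmodType (Zl l)) (H : refcoset V).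
Variables (K : fieldType) (iota : {rmorphism Zl l -> K}).

Definition matrix_of r (b : 'I_r -> V) (g : V -> V) (A : 'M[Zl l]_r) :=
  forall i, g (b i) = \sum_j A i j *: b j.

(** The automorphism of the symmetric algebra of [rlat H] over [K], identified with
the polynomial ring on a basis of [rlat H], induced by an element of [GL]. *)
Definition sym_act r (A : 'M[Zl l]_r) : mpoly r K -> mpoly r K :=
  comp_mpoly
    [tuple \sum_j iota (A i j) *: mpolyX K (mnm1 j) | i < r].

Definition invariant r (b : 'I_r -> V) (f : mpoly r K) :=
  forall g A, rgrp H g -> matrix_of b g A -> sym_act A f = f.

Definition generalised_degrees r (d : 'I_r -> nat) (eps : 'I_r -> K) :=
  exists (b : 'I_r -> V) (f : 'I_r -> mpoly r K),
  [/\ is_basis (rlat H) b,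
      forall i, f i \is ishomog1 (d i) (@mdeg r) /\ invariant b (f i),
      forall c A i, relts H c -> matrix_of b c A -> sym_act A (f i) = eps i *: f i,
      forall p : mpoly r K,
        comp_mpoly [tuple f i | i < r] p = 0 -> p = 0 &
      forall h, invariant b h ->
        exists p : mpoly r K, h = comp_mpoly [tuple f i | i < r] p].

End OrderPolynomial.

(** The eigenvalues [eps i] live in some extension field [K] of the field of
l-adic numbers; the order polynomial itself has coefficients in [Zl l]. *)
Definition order_polynomial l (V : lmodType (Zl l)) (H : refcoset V) (P : {poly Zl l}) :=
  exists (K : fieldType) (iota : {rmorphism Zl l -> K}) (N r : nat)
         (d : 'I_r -> nat) (eps : 'I_r -> K),
  [/\ injective iota,
      ([set s : V -> V | rgrp H s /\ is_reflection (rlat H) s] #= `I_N)%card,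
      generalised_degrees H iota d eps &
      map_poly iota P =
        'X^N * \prod_i ((eps i) ^- 2 *: ('X^(d i) - (eps i)%:P))].

Section LeviSubcosets.
Variables (l : nat) (G : reflection_coset l) (zeta : Zl l).
Let V := rc_lat G.
Implicit Types (L T H K : refcoset V).

Definition Phi_torus T :=
  [/\ subcoset T (to_coset G), torus T &
      exists (P : {poly Zl l}) (u u' : Zl l) (a : nat),
        [/\ order_polynomial T P, u * u' = 1 & P = u *: ('X - zeta%:P) ^+ a]].

Definition is_centraliser T L := exists2 w, rc_grp G w &
  let wphi := w \o rc_phi G in
  let C := [set v : V -> V | rc_grp G v /\ forall x, rlat T x -> v x = x] in
  [/\ wphi @` rlat T = rlat T, relts T = [set restr (rlat T) wphi] &
      L = Refcoset setT C [set v \o wphi | v in C]].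

(** That a centraliser of a torus is a subcoset, i.e. that its group is generated
by reflections, is Steinberg's theorem on pointwise stabilisers. *)
Record split_levi := SplitLevi {
  levi :> refcoset V;
  leviP : subcoset levi (to_coset G) /\
    exists2 T, Phi_torus T & is_centraliser T levi }.

Definition te_hom (L K : split_levi) :=
  {w : V -> V | rc_grp G w /\ subcoset (conj_coset w L) K}.

Let bijw w : rc_grp G w -> bijective w /\ forall a u v, w (a *: u + v) = a *: w u + w v.
Proof.
have [[_ WGL _ _ _] _] := rc_grpP G => /WGL[lin sur inj _]; split; last by move=> *; exact: lin.
have /choice[w' w'K] : forall y, exists x, w x = y.
  by move=> y; have [x _ <-] : (w @` setT) y by [rewrite sur]; exists x.
by exists w' => // x; apply: inj => //; rewrite w'K.
Qed.

Lemma restrT (f : V -> V) : restr setT f = f.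
Proof. by apply/funext => v; rewrite /restr asboolT. Qed.

Lemma levi_lat (L : split_levi) : rlat L = setT.
Proof. by case: L => L /= [_ [T _ [w _ [_ _ ->]]]]. Qed.

Definition subT (H K : refcoset V) :=
  [/\ finite_reflection_group setT (rgrp H), rgrp H `<=` rgrp K &
      exists c, [/\ relts K c, c @` setT = setT, normalises c (rgrp H) &
        relts H = [set f \o c | f in rgrp H]]].

Lemma subTE (H K : refcoset V) : rlat H = setT -> rlat K = setT ->
  subcoset H K <-> subT H K.
Proof.
case: H K => [HL HG HC] [KL KG KC] /= -> ->; split.
  case=> /= _ rH sub [c]; rewrite restrT => cP; split=> //; last by exists c.
  by move=> f /sub[w [Kw _ ->]]; rewrite restrT.
case=> rH sub [c cP]; split=> //=; last by exists c; rewrite restrT.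
  move=> f Hf; exists f; rewrite restrT; split => //; first exact: sub.
  by have [[_ /(_ f Hf)[]]] := rH.
Qed.

Lemma conj_funE (w w' : V -> V) A : cancel w w' -> cancel w' w ->
  conj_fun w A = [set w \o (f \o w') | f in A].
Proof.
move=> wK w'K; apply/seteqP; split => g /= -[f Af].
  by move=> e; exists f => //; apply/funext => x /=; have /= <- := congr1 (@^~ (w' x)) e; rewrite w'K.
by move=> <-; exists f => //; apply/funext => x /=; rewrite wK.
Qed.

Lemma conj_coset1 H : conj_coset id H = H.
Proof.
case: H => HL HG HC; rewrite /conj_coset /= image_id.
by congr Refcoset; rewrite (@conj_funE id id) // image_id.
Qed.

Lemma conj_cosetM (v w : V -> V) H : bijective v -> bijective w ->
  conj_coset (v \o w) H = conj_coset v (conj_coset w H).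
Proof.
move=> [v' vK v'K] [w' wK w'K]; rewrite /conj_coset /= image_comp.
have vwK := can_comp vK wK; have vwK' := can_comp w'K v'K.
by congr Refcoset; rewrite !(conj_funE _ vK v'K, conj_funE _ wK w'K, conj_funE _ vwK vwK') image_comp.
Qed.

Lemma conj_subT (v : V -> V) H K : rc_grp G v -> subT H K ->
  subT (conj_coset v H) (conj_coset v K).
Proof.
move=> /bijw[[v' vK v'K] vlin] [[[fin HGL H1 HM HV] Hrefl] sub [c [Kc csur cn cE]]].
have v'lin a x y : v' (a *: x + y) = a *: v' x + v' y.
  by apply: (can_inj vK); rewrite vlin !v'K.
have vcomp f g : v \o (f \o v') \o (v \o (g \o v')) = v \o ((f \o g) \o v').
  by apply/funext => x /=; rewrite vK.
have cGL f : GL setT f -> GL setT (v \o (f \o v')).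
  move=> [flin fsur finj _]; split => //=.
  - by move=> a x y _ _; rewrite v'lin flin // vlin.
  - apply/seteqP; split => // y _.
    have : (f @` setT) (v' y) by rewrite fsur.
    by case=> x _ fx; exists (v x) => //; rewrite /= vK fx v'K.
  - by move=> x y _ _ /(can_inj vK) /(finj _ _ I I) /(can_inj v'K).
have cid1 : v \o (restr setT id \o v') = restr setT id.
  by rewrite restrT; apply/funext => x /=; rewrite v'K.
rewrite /subT /= !(conj_funE _ vK v'K); split.
- split.
    split.
    + exact: finite_image.
    + by move=> _ [f Hf <-]; apply/cGL/HGL.
    + by exists (restr setT id).
    + by move=> _ _ [f Hf <-] [g Hg <-]; rewrite vcomp; exists (f \o g) => //; exact: HM.
    + move=> _ [f /HV[g Hg gf] <-]; exists (v \o (g \o v')); first by exists g.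
      by rewrite vcomp gf cid1.
  move=> _ [f /Hrefl[s sP ->] <-].
  exists [seq v \o (g \o v') | g <- s].
    move=> i; rewrite size_map => si; rewrite (nth_map id) //.
    have [Hg [gGL [x _ gx] [a _ aP]]] := sP i si; split; first by exists (nth id s i).
    split; first exact: cGL.
      by exists (v x) => //=; rewrite vK => /(can_inj vK).
    exists (v a) => // y _; have [k kP] := aP (v' y) I; exists k => /=.
    have v0 : v 0 = 0.
      have := vlin 1 0 0; rewrite !scale1r addr0 => /(congr1 (fun x => x - v 0)).
      by rewrite subrr addrK => <-.
    have vN x1 y1 : v (x1 - y1) = v x1 - v y1.
      by rewrite -[x1 - y1]addrC -scaleN1r vlin scaleN1r addrC.
    by rewrite -{2}[y]v'K -vN kP -[k *: a]addr0 vlin v0 addr0.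
  elim: s {sP} => [|g s IHs] /=; first by rewrite cid1.
  by rewrite -IHs vcomp.
- by move=> _ [f /sub Kf <-]; exists f.
- exists (v \o (c \o v')); split; first by exists c.
  + apply/seteqP; split => // y _.
    have : (c @` setT) (v' y) by rewrite csur.
    by case=> x _ cx; exists (v x) => //; rewrite /= vK cx v'K.
  + rewrite /normalises !image_comp /=.
    transitivity ((fun f => v \o (f \o v')) @` [set c \o f | f in rgrp H]).
      by rewrite image_comp; apply: eq_imagel => f _ /=; rewrite vcomp.
    by rewrite cn image_comp; apply: eq_imagel => f _ /=; rewrite vcomp.
  + rewrite cE !image_comp; apply: eq_imagel => f _ /=.
    by rewrite -[RHS]/((v \o (f \o v')) \o (v \o (c \o v'))) vcomp.
Qed.

Lemma subT_trans H K (M : split_levi) : subT H K -> subT K M -> subT H M.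
Proof.
move=> [Hr HK [c [Kc csur cn cE]]] [_ KM [d [Md dsur dn dE]]].
split=> //; first exact: subset_trans HK KM.
exists c; split => //; move: Kc; rewrite dE => -[f /KM Mf <-].
case: M Md Mf {KM} => M /= [ML _].
have [_ _ _ [e [_ _ _ eE]]] := ML; rewrite eE => -[g Mg <-] Mf.
exists (f \o g) => //.
by have [_ [[_ _ _ MM _] _] _ _] := ML; exact: MM.
Qed.

Definition te_id (L : split_levi) : te_hom L L.
Proof.
exists id; split; first by have [[_ _ + _ _] _] := rc_grpP G; rewrite restrT.
rewrite conj_coset1; apply/subTE; rewrite ?levi_lat //.
case: (leviP L) => /subTE; rewrite levi_lat => /(_ erefl erefl)[Lr _ [c [_ cs cn cE]]] _.
split=> //; exists c; split => //; rewrite cE; exists id => //.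
by have [[_ _ + _ _] _] := Lr; rewrite restrT.
Defined.

Lemma conj_lat w H : rc_grp G w -> rlat H = setT -> rlat (conj_coset w H) = setT.
Proof.
have [[_ WGL _ _ _] _] := rc_grpP G.
by case: H => HL HG HC /WGL[_ + _ _] /= ->.
Qed.

Definition te_comp (L K M : split_levi) (v : te_hom K M) (w : te_hom L K) :
  te_hom L M.
Proof.
case: v w => [v [Wv sv]] [w [Ww sw]]; exists (v \o w); split.
  by have [[_ _ _ + _] _] := rc_grpP G; apply.
have [bv _] := bijw Wv; have [bw _] := bijw Ww.
have lwL := conj_lat Ww (levi_lat L).
rewrite conj_cosetM //; apply/subTE; rewrite ?conj_lat ?levi_lat //.
apply: (@subT_trans _ (conj_coset v K)).
  by apply: conj_subT => //; apply/subTE; rewrite ?conj_lat ?levi_lat.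
by apply/subTE; rewrite ?conj_lat ?levi_lat.
Defined.

Lemma te_hom_eq (L K : split_levi) (v w : te_hom L K) : sval v = sval w -> v = w.
Proof. by case: v w => [v vP] [w wP] /= e; exact: eq_exist. Qed.

Fact te_compA (L K M N : split_levi) (h : te_hom M N) (g : te_hom K M) (f : te_hom L K) :
  te_comp h (te_comp g f) = te_comp (te_comp h g) f.
Proof. by apply: te_hom_eq; case: h g f => [? []] ? ? [? []] ? ? [? []]. Qed.

Fact te_comp1 (L K : split_levi) (f : te_hom L K) : te_comp f (te_id L) = f.
Proof. by apply: te_hom_eq; case: f => [? []]. Qed.

Fact te_1comp (L K : split_levi) (f : te_hom L K) : te_comp (te_id K) f = f.
Proof. by apply: te_hom_eq; case: f => [? []]. Qed.

(** Composition is the multiplication of [W], i.e. composition of maps. *)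
Definition Te : cat_on split_levi := CatOn te_compA te_comp1 te_1comp.

End LeviSubcosets.

(** * Simplicial sets *)

Lemma omap_eq m n (a b : omap m n) : a =1 b -> a = b.
Proof.
case: a b => [a am] [b bm] /= /funext e; subst b.
by rewrite (Prop_irrelevance am bm).
Qed.

Record sset := SSet {
  simp :> nat -> Type;
  sact : forall m n, omap m n -> simp n -> simp m;
  sact1 : forall n (x : simp n), sact (oid n) x = x;
  sactM : forall m n p (b : omap n p) (a : omap m n) (x : simp p),
    sact (ocomp b a) x = sact a (sact b x) }.
Arguments sact {s m n}.

Record smap (X Y : sset) := SMap {
  sfun :> forall n, X n -> Y n;
  snat : forall m n (a : omap m n) (x : X n), sfun (sact a x) = sact a (sfun x) }.

Lemma smap_eq (X Y : sset) (f g : smap X Y) :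
  (forall n (x : X n), f n x = g n x) -> f = g.
Proof.
case: f g => [f fn] [g gn] /= e.
have {}e : f = g by do 2![apply: functional_extensionality_dep => ?]; exact: e.
by subst g; rewrite (Prop_irrelevance fn gn).
Qed.

Definition sidmap X : smap X X := @SMap X X (fun _ x => x) (fun _ _ _ _ => erefl).

Definition scomp X Y Z (g : smap Y Z) (f : smap X Y) : smap X Z.
Proof. by exists (fun n x => g n (f n x)) => m n a x; rewrite !snat. Defined.

Definition Delta (n : nat) : sset.
Proof.
exists (fun m => omap m n) (fun m p a b => ocomp b a) => [m b|//].
exact: omap_eq.
Defined.

Definition Delta_map m n (a : omap m n) : smap (Delta m) (Delta n) :=
  @SMap (Delta m) (Delta n) (fun _ b => ocomp a b) (fun _ _ _ _ => erefl).

Definition sprod (X Y : sset) : sset.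
Proof.
exists (fun n => (X n * Y n)%type) (fun m n a z => (sact a z.1, sact a z.2)).
  by move=> n [x y]; rewrite !sact1.
by move=> m n p b a [x y]; rewrite !sactM.
Defined.

Definition sprod_map X Y Z T (f : smap X Z) (g : smap Y T) :
  smap (sprod X Y) (sprod Z T).
Proof.
by exists (fun n (z : sprod X Y n) => (f n z.1, g n z.2)) => m n a z /=; rewrite !snat.
Defined.

Definition subsset (X : sset) (P : forall n, set (X n))
  (Pact : forall m n (a : omap m n) x, P n x -> P m (sact a x)) : sset.
Proof.
exists (fun n => {x : X n | P n x})
  (fun m n a x => exist _ (sact a (sval x)) (Pact m n a _ (svalP x))).
  by move=> n [x Px]; apply: eq_exist; rewrite sact1.
by move=> m n p b a [x Px]; apply: eq_exist; rewrite sactM.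
Defined.

Definition ssnd X Y : smap (sprod X Y) Y :=
  @SMap (sprod X Y) Y (fun _ z => z.2) (fun _ _ _ _ => erefl).

(** The map from the standard simplex corresponding to a simplex of [X]. *)
Definition classifying (X : sset) n (x : X n) : smap (Delta n) X.
Proof. by exists (fun m (a : Delta n m) => sact a x) => m p a b; rewrite -sactM. Defined.

Definition oconst m n (i : 'I_n.+1) : omap m n :=
  @OMap m n (fun=> i) (fun _ _ _ => leqnn i).

(** The [i]-th coface [[k] -> [k+1]] and codegeneracy [[k+1] -> [k]]. *)
Definition ocoface k (i : 'I_k.+2) : omap k k.+1.
Proof. by exists (lift i) => j j' /=; rewrite leq_bump2. Defined.

Definition ocodeg k (i : 'I_k.+1) : omap k.+1 k.
Proof.
exists (fun j : 'I_k.+2 => inord (unbump i j)) => j j' jj'.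
have ub (u : 'I_k.+2) : (unbump i u < k.+1)%N.
  rewrite /unbump; case: (ltnP i u) => iu /=; last by rewrite subn0 (leq_ltn_trans iu).
  by rewrite subn1; case: u iu => -[|u].
rewrite !inordK // /unbump.
case: (ltnP i j) => ij /=; first by rewrite (leq_trans ij jj') leq_sub2r.
case: (ltnP i j') => ij' /=; last by rewrite !subn0.
by rewrite subn0 subn1 -ltnS prednK ?(leq_ltn_trans _ ij') // (leq_ltn_trans ij ij').
Defined.

(** The horn and the boundary are described by the monotone maps whose image
misses some vertex. *)
Definition horn n (k : 'I_n.+1) : sset.
Proof.
apply: (@subsset (Delta n) (fun m => [set a : omap m n |
  exists2 i, i != k & forall j, a j != i])).
by move=> m p a b [i ik ib]; exists i => // j; exact: ib.
Defined.

Definition boundary (n : nat) : sset.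
Proof.
apply: (@subsset (Delta n) (fun m => [set a : omap m n |
  exists i, forall j, a j != i])).
by move=> m p a b [i ib]; exists i => j; exact: ib.
Defined.

Definition kan (Y : sset) := forall n (k : 'I_n.+2) (h : smap (horn k) Y),
  exists y : Y n.+1, forall m (a : horn k m), h m a = sact (sval a) y.

Definition fills_sphere (n : nat) (Y : sset) := forall h : smap (boundary n) Y,
  exists y : Y n, forall m (a : boundary n m), h m a = sact (sval a) y.

(** Meant for Kan complexes; for [n = 0] the boundary is empty. *)
Definition sconnected Y := fills_sphere 0%N Y /\ fills_sphere 1%N Y.
Definition simply_connected Y := sconnected Y /\ fills_sphere 2%N Y.

Definition shomotopic (X Y : sset) (f g : smap X Y) :=
  exists H : smap (sprod X (Delta 1%N)) Y, forall n (x : X n),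
    H n (x, oconst n ord0) = f n x /\ H n (x, oconst n ord_max) = g n x.

Definition hequiv (X Y : sset) (f : smap X Y) := exists g : smap Y X,
  shomotopic (scomp g f) (sidmap X) /\ shomotopic (scomp f g) (sidmap Y).

Definition shomotopy_equivalent (X Y : sset) := exists f : smap X Y, hequiv f.

(** Pairs of a point [a] of [A] and a path from [f a] to [g a] in [X]. *)
Section HomotopyEqualizer.
Variables (A X : sset) (f g : smap A X).

Record heq_simplex n := HeqSimplex {
  heq_pt : A n;
  heq_path : smap (sprod (Delta 1%N) (Delta n)) X;
  heq_src : heq_path n (oconst n ord0, oid n) = f n heq_pt;
  heq_tgt : heq_path n (oconst n ord_max, oid n) = g n heq_pt }.

Lemma heq_simplex_eq n (x y : heq_simplex n) :
  heq_pt x = heq_pt y -> heq_path x = heq_path y -> x = y.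
Proof.
case: x y => [a p h h'] [b q k k'] /= e e'; subst b q.
by rewrite (Prop_irrelevance h k) (Prop_irrelevance h' k').
Qed.

Lemma heq_endpoint m n (a : omap m n) (i : 'I_2) (p : smap (sprod (Delta 1%N) (Delta n)) X) :
  scomp p (sprod_map (sidmap _) (Delta_map a)) m (oconst m i, oid m) =
  sact a (p n (oconst n i, oid n)).
Proof. by rewrite -snat /=; congr (p m (_, _)); exact: omap_eq. Qed.

Definition heq_act m n (a : omap m n) (x : heq_simplex n) : heq_simplex m.
Proof.
exists (sact a (heq_pt x)) (scomp (heq_path x) (sprod_map (sidmap _) (Delta_map a))).
  by rewrite heq_endpoint heq_src snat.
by rewrite heq_endpoint heq_tgt snat.
Defined.

Definition hequalizer : sset.
Proof.
exists heq_simplex heq_act.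
  move=> n x; apply: heq_simplex_eq => /=; first exact: sact1.
  by apply: smap_eq => k [u v] /=; congr (heq_path x k (_, _)); exact: omap_eq.
move=> m n p b a x; apply: heq_simplex_eq => /=; first exact: sactM.
by apply: smap_eq => k [u v] /=; congr (heq_path x k (_, _)); exact: omap_eq.
Defined.

End HomotopyEqualizer.

Definition sconst (A X : sset) (x0 : X 0%N) : smap A X.
Proof.
exists (fun n _ => sact (oconst n ord0) x0) => m n a x.
by rewrite -sactM; congr sact; exact: omap_eq.
Defined.

Definition loop_space (X : sset) (x0 : X 0%N) : sset :=
  hequalizer (sconst (Delta 0%N) x0) (sconst (Delta 0%N) x0).

Definition homotopy_fiber (A X : sset) (f : smap A X) (x0 : X 0%N) : sset :=
  hequalizer f (sconst A x0).

(** The fixed points are those of the action of the integers generated by [f];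
a homotopy fixed point is a point [x] with a path from [x] to [f x]. *)
Definition homotopy_fixed_points (X : sset) (f : smap X X) : sset :=
  hequalizer (sidmap X) f.

(** ** Cohomology with coefficients in the prime field *)

Section Cohomology.
Variables (l : nat) (Y : sset).

Definition cochain k := Y k -> 'F_l.

Definition coboundary k (c : cochain k) : cochain k.+1 :=
  fun y => \sum_(i < k.+2) (-1) ^+ i * c (sact (ocoface i) y).

Definition cocycle k (c : cochain k) := forall y, coboundary c y = 0.

Definition is_coboundary k : cochain k -> Prop :=
  match k with
  | 0 => fun c => forall y, c y = 0
  | k'.+1 => fun c => exists b : cochain k', forall y, c y = coboundary b y
  end.

Definition cohomology_dim k d := exists z : 'I_d -> cochain k,
  (forall i, cocycle (z i)) /\
  forall c : cochain k, cocycle c -> exists! a : {ffun 'I_d -> 'F_l},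
    is_coboundary (fun y => c y - \sum_i a i * z i y).

Definition finite_betti (N : nat) (beta : nat -> nat) :=
  (forall k, cohomology_dim k (beta k)) /\ forall k, (N <= k)%N -> beta k = 0%N.

Definition finite_cohomology := exists N beta, finite_betti N beta.

Definition nonzero_euler_char := exists N beta, finite_betti N beta /\
  \sum_(k < N) (-1) ^+ k * (beta k)%:Z != 0 :> int.

End Cohomology.

(** ** Completion at a prime, after Bousfield and Kan *)

Section FormalSums.
Variable l : nat.

(** Finite formal sums of elements of [A] with coefficients in the prime field
of sum 1. Such a sum is recorded by the values it gives to functions on [A]
extended linearly, which determine it. *)
Definition is_formal_sum (A : Type) (mu : (A -> 'F_l) -> 'F_l) :=
  exists s : seq ('F_l * A), \sum_(p <- s) p.1 = 1 /\
    forall h, mu h = \sum_(p <- s) p.1 * h p.2.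

Definition formal_sum (A : Type) := {mu : (A -> 'F_l) -> 'F_l | is_formal_sum mu}.

Definition fs_map A B (f : A -> B) (mu : formal_sum A) : formal_sum B.
Proof.
exists (fun h => sval mu (h \o f)); case: mu => mu /= [s [s1 muE]].
exists [seq (p.1, f p.2) | p <- s]; rewrite big_map; split=> // h.
by rewrite muE big_map.
Defined.

Definition fs_unit A (a : A) : formal_sum A.
Proof.
exists (fun h => h a); exists [:: (1, a)]; rewrite big_seq1; split=> // h.
by rewrite big_seq1 mul1r.
Defined.

Definition fs_mult A (M : formal_sum (formal_sum A)) : formal_sum A.
Proof.
exists (fun h => sval M (fun mu => sval mu h)); case: M => M /= [s [s1 ME]].
have [t [t1 tE]] : exists t : seq ('F_l * A), \sum_(p <- t) p.1 = \sum_(p <- s) p.1 /\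
    forall h, \sum_(p <- t) p.1 * h p.2 = \sum_(p <- s) p.1 * sval p.2 h.
  elim: s {s1 ME} => [|[c [mu /= [u [u1 muE]]]] s [t [t1 tE]]].
    by exists [::]; split=> [|h]; rewrite !big_nil.
  exists ([seq (c * p.1, p.2) | p <- u] ++ t); split=> [|h].
    by rewrite big_cat big_map big_cons /= -mulr_sumr u1 mulr1 t1.
  rewrite big_cat big_map big_cons /= tE muE mulr_sumr; congr (_ + _).
  by apply: eq_bigr => p _; rewrite mulrA.
by exists t; rewrite t1; split=> // h; rewrite ME tE.
Defined.

Definition Rs (X : sset) : sset.
Proof.
exists (fun n => formal_sum (X n)) (fun m n a => fs_map (sact a)).
  move=> n [mu muP]; apply: eq_exist; apply/funext => h /=; congr mu.
  by apply/funext => x /=; rewrite sact1.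
move=> m n p b a [mu muP]; apply: eq_exist; apply/funext => h /=; congr mu.
by apply/funext => x /=; rewrite sactM.
Defined.

Definition Rs_map X Y (f : smap X Y) : smap (Rs X) (Rs Y).
Proof.
exists (fun n => fs_map (f n)) => m n a [mu muP]; apply: eq_exist.
by apply/funext => h /=; congr mu; apply/funext => x /=; rewrite snat.
Defined.

Definition Rs_unit X : smap X (Rs X).
Proof.
by exists (fun n x => fs_unit x : Rs X n) => m n a x; exact: eq_exist.
Defined.

Definition Rs_mult X : smap (Rs (Rs X)) (Rs X).
Proof.
by exists (fun n (x : Rs (Rs X) n) => fs_mult x : Rs X n) => m n a [mu muP]; exact: eq_exist.
Defined.

Fixpoint Rs_pow (X : sset) k : sset := if k is k'.+1 then Rs (Rs_pow X k') else X.

Fixpoint Rs_coface X k (i : nat) : smap (Rs_pow X k) (Rs_pow X k.+1) :=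
  match k with
  | 0 => Rs_unit X
  | k'.+1 => if i is i'.+1 then Rs_map (Rs_coface X k' i')
             else Rs_unit (Rs_pow X k'.+1)
  end.

Fixpoint Rs_codeg X k (i : nat) : smap (Rs_pow X k.+2) (Rs_pow X k.+1) :=
  match k with
  | 0 => Rs_mult X
  | k'.+1 => if i is i'.+1 then Rs_map (Rs_codeg X k' i')
             else Rs_mult (Rs_pow X k'.+1)
  end.

(** The [n]-simplices of the total space of the cosimplicial resolution of [X],
whose term of codegree [k] is [Rs_pow X k.+1]. *)
Record tot (X : sset) (n : nat) := Tot {
  tot_fun : forall k, smap (sprod (Delta k) (Delta n)) (Rs_pow X k.+1);
  tot_coface : forall k (i : 'I_k.+2) m (a : Delta k m) (b : Delta n m),
    tot_fun k.+1 m (ocomp (ocoface i) a, b) =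
    Rs_coface X k.+1 i m (tot_fun k m (a, b));
  tot_codeg : forall k (i : 'I_k.+1) m (a : Delta k.+1 m) (b : Delta n m),
    tot_fun k m (ocomp (ocodeg i) a, b) =
    Rs_codeg X k i m (tot_fun k.+1 m (a, b)) }.

Lemma tot_eq X n (x y : tot X n) :
  (forall k m z, tot_fun x k m z = tot_fun y k m z) -> x = y.
Proof.
case: x y => [x h h'] [y g g'] /= e.
have {}e : x = y.
  by apply: functional_extensionality_dep => k; apply: smap_eq => m z; exact: e.
by subst y; rewrite (Prop_irrelevance h g) (Prop_irrelevance h' g').
Qed.

Definition tot_act X m n (a : omap m n) (x : tot X n) : tot X m.
Proof.
exists (fun k => scomp (tot_fun x k) (sprod_map (sidmap _) (Delta_map a))).
  by move=> k i p b c; rewrite /= tot_coface.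
by move=> k i p b c; rewrite /= tot_codeg.
Defined.

Definition completion (X : sset) : sset.
Proof.
exists (tot X) (@tot_act X).
  move=> n x; apply: tot_eq => k m [u v] /=; congr (tot_fun x k m (_, _)).
  exact: omap_eq.
by move=> m n p b a x; apply: tot_eq => k q [u v].
Defined.

Fixpoint Rs_unit_pow X k : smap X (Rs_pow X k) :=
  if k is k'.+1 then scomp (Rs_unit (Rs_pow X k')) (Rs_unit_pow X k') else sidmap X.

Lemma Rs_map_unit (X Y : sset) (f : smap X Y) n (x : X n) :
  Rs_map f n (Rs_unit X n x) = Rs_unit Y n (f n x).
Proof. exact: eq_exist. Qed.

Lemma Rs_mult_unit (X : sset) n (x : Rs X n) : Rs_mult X n (Rs_unit (Rs X) n x) = x.
Proof. by case: x => mu muP; exact: eq_exist. Qed.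

Lemma Rs_coface_unit (X : sset) k i n (x : X n) :
  Rs_coface X k i n (Rs_unit_pow X k n x) = Rs_unit_pow X k.+1 n x.
Proof.
elim: k i => [|k IHk] [|i] //.
rewrite -[LHS]/(Rs_map (Rs_coface X k i) n (Rs_unit _ n (Rs_unit_pow X k n x))).
by rewrite Rs_map_unit IHk.
Qed.

Lemma Rs_codeg_unit (X : sset) k i n (x : X n) :
  Rs_codeg X k i n (Rs_unit_pow X k.+2 n x) = Rs_unit_pow X k.+1 n x.
Proof.
elim: k i => [|k IHk] [|i]; [exact: Rs_mult_unit..|].
rewrite -[LHS]/(Rs_map (Rs_codeg X k i) n (Rs_unit _ n (Rs_unit_pow X k.+2 n x))).
by rewrite Rs_map_unit IHk.
Qed.

Definition completion_unit_at (X : sset) n (x : X n) : tot X n.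
Proof.
exists (fun k => scomp (Rs_unit_pow X k.+1) (scomp (classifying x) (ssnd _ _))).
  by move=> k i m a b; exact: (esym (Rs_coface_unit k.+1 i _)).
by move=> k i m a b; exact: (esym (Rs_codeg_unit k i _)).
Defined.

Definition completion_unit (X : sset) : smap X (completion X).
Proof.
exists (fun n (x : X n) => completion_unit_at x : completion X n) => m n a x.
apply: tot_eq => k p [u v].
exact: (congr1 (Rs_unit_pow X k.+1 p) (esym (sactM a (v : omap p m) x))).
Defined.

Definition complete (X : sset) := hequiv (completion_unit X).

End FormalSums.

(** ** The Eilenberg-MacLane space [K(V, 2)] *)

Section EilenbergMacLane.
Variables (l : nat) (V : lmodType (Zl l)).

(** The [n]-simplices are the normalised 2-cocycles on the [n]-simplex. *)
Definition em_cocycle n (c : omap 2%N n -> V) :=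
  (forall a : omap 2%N n, ~ injective a -> c a = 0) /\
  forall b : omap 3%N n, \sum_(i < 4) (-1) ^+ i *: c (ocomp b (ocoface i)) = 0.

Lemma em_cocycle_act m n (a : omap m n) (c : omap 2%N n -> V) :
  em_cocycle c -> em_cocycle (fun b => c (ocomp a b)).
Proof.
move=> [c0 cc]; split=> [b nb|b]; last exact: (cc (ocomp a b)).
by apply: c0 => /= inj; apply: nb => i j e; apply: inj => /=; rewrite e.
Qed.

Definition K2 : sset.
Proof.
exists (fun n => {c : omap 2%N n -> V | em_cocycle c})
  (fun m n a c => exist _ _ (em_cocycle_act a (svalP c))).
  move=> n [c cP]; apply: eq_exist; apply/funext => b /=; congr c.
  exact: omap_eq.
by move=> m n p b a [c cP]; exact: eq_exist.
Defined.

Definition induced_by (f : V -> V) (k : smap K2 K2) :=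
  forall n (c : K2 n) a, sval (k n c) a = f (sval c a).

End EilenbergMacLane.

(** * Compact groups at a prime *)

Section CompactGroups.
Variables (l : nat) (BX : sset) (x0 : BX 0%N).

Definition compact_group := [/\ kan BX, sconnected BX, complete l BX &
  finite_cohomology l (loop_space x0)].

Definition connected_compact_group :=
  compact_group /\ sconnected (loop_space x0).

Variables (V : lmodType (Zl l)) (iota : smap (K2 V) BX).

(** The classifying space of a torus with lattice [V] is [K(V, 2)]. *)
Definition maximal_torus := nonzero_euler_char l (homotopy_fiber iota x0).

(** [f] extends, up to homotopy, the self-map of the maximal torus given by [g]. *)
Definition extends_to (g : V -> V) (f : smap BX BX) := exists k : smap (K2 V) (K2 V),
  induced_by g k /\ shomotopic (scomp f iota) (scomp iota k).

(** For a connected group, the components of the space of self-equivalences of the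
torus over [BX], which act faithfully on [V]. *)
Definition weyl_group : set (V -> V) := [set w |
  GL setT w /\ extends_to w (sidmap BX)].

Definition unstable_adams (q : nat) (psi : smap BX BX) :=
  hequiv psi /\ extends_to (fun v => v *+ q) psi.

End CompactGroups.

(** The first condition is goodness: no torsion in the quotients of the root
lattice by the root lattices of reflection subgroups. The second one, for a
simply connected group, says that [l] does not divide the index of the root
lattice in the weight lattice; for Weyl groups it only adds to goodness the
exclusion of the factors of type [A_(n-1)] with [l] dividing [n]. *)
Definition very_good l (G : reflection_coset l) :=
  let dual : set (rc_lat G -> Zl l) :=
    [set h | forall a u v, h (a *: u + v) = a * h u + h v] in
  (** The root lattice of a reflection subgroup [W'], spanned by the images of
  the maps [1 - w] on the dual lattice. *)
  let root_lattice (W' : set (rc_lat G -> rc_lat G)) : set (rc_lat G -> Zl l) :=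
    [set h | exists k (f : 'I_k -> rc_lat G -> Zl l) (w : 'I_k -> rc_lat G -> rc_lat G),
      (forall i, dual (f i) /\ W' (w i)) /\
      forall v, h v = \sum_i (f i v - f i (w i v))] in
  let torsion_free (A B : set (rc_lat G -> Zl l)) :=
    forall (c : Zl l) h, c != 0 -> A h -> B (fun v => c * h v) -> B h in
  (forall W', W' `<=` rc_grp G -> finite_reflection_group setT W' ->
     torsion_free (root_lattice (rc_grp G)) (root_lattice W')) /\
  torsion_free dual (root_lattice (rc_grp G)).

(** * Local finite groups *)

Section Nerve.
Variables (T : Type) (C : cat_on T).

Lemma ofunctor_eq n (f : 'I_n.+1 -> T) m m' h1 h2 h1' h2' :
  (forall i j ij, m i j ij = m' i j ij) ->
  @OFunctor n T C f m h1 h2 = @OFunctor n T C f m' h1' h2'.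
Proof.
move=> e; have {}e : m = m'.
  by do 3![apply: functional_extensionality_dep => ?]; exact: e.
by subst m'; rewrite (Prop_irrelevance h1 h1') (Prop_irrelevance h2 h2').
Qed.

Definition ofunctor_act m n (a : omap m n) (s : ofunctor n C) : ofunctor m C.
Proof.
exists (fun i => s (a i)) (fun i j h => fmap s (omono a h)) => [i h|i j k h h' h''].
  exact: fmap1.
exact: fmapM.
Defined.

Definition nerve : sset.
Proof.
exists (fun n => ofunctor n C) ofunctor_act.
  by move=> n [f m h1 h2]; apply: ofunctor_eq.
by move=> m n p b a [f k h1 h2]; apply: ofunctor_eq.
Defined.

End Nerve.

Section Fusion.
Local Open Scope group_scope.
Variables (l : nat) (gT : finGroupType) (S : {group gT}).
Implicit Types (P Q R : {group gT}) (f g : {ffun gT -> gT}).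

(** A homomorphism defined on a subgroup is extended by [1] outside of it. *)
Definition conj_map P (x : gT) : {ffun gT -> gT} :=
  [ffun y => if y \in P then y ^ x^-1 else 1].

Definition ffcomp g f : {ffun gT -> gT} := [ffun x => g (f x)].

Definition injective_hom P Q f :=
  [/\ {in P &, {morph f : x y / x * y}}, {in P &, injective f},
      {in P, forall x, f x \in Q} & forall x, x \notin P -> f x = 1].

Variable F : {group gT} -> {group gT} -> {set {ffun gT -> gT}}.

Definition fusion_system :=
  [/\ forall P Q f, f \in F P Q ->
        [/\ P \subset S, Q \subset S & injective_hom P Q f],
      forall P Q x, P \subset S -> Q \subset S -> x \in S ->
        P :^ x^-1 \subset Q -> conj_map P x \in F P Q,
      forall P Q R f g, f \in F P Q -> g \in F Q R -> ffcomp g f \in F P R &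
      forall P Q f, f \in F P Q -> exists R, [/\ f @: P = R :> {set gT},
        f \in F P R & exists2 g, g \in F R P & ffcomp g f = conj_map P 1]].

Definition F_conjugate P Q := exists2 f, f \in F P Q & f @: P = Q.

Definition fully_centralised P := forall Q, F_conjugate P Q ->
  (#|'C_S(Q)| <= #|'C_S(P)|)%N.

Definition fully_normalised P := forall Q, F_conjugate P Q ->
  (#|'N_S(Q)| <= #|'N_S(P)|)%N.

Definition Aut_S P : {set {ffun gT -> gT}} := [set conj_map P x | x in 'N_S(P)].

Definition saturated :=
  (forall P, P \subset S -> fully_normalised P ->
     fully_centralised P /\ #|Aut_S P| = ((#|F P P| : nat)`_l)%N) /\
  (forall P Q (N : {group gT}) f, f \in F P S -> f @: P = Q -> fully_centralised Q ->
     (forall x, x \in N <-> x \in 'N_S(P) /\ exists2 y, y \in 'N_S(Q) &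
        {in P, forall z, f (z ^ x^-1) = f z ^ y^-1}) ->
     exists2 g, g \in F N S & {in P, g =1 f}).

Definition centric P := P \subset S /\
  forall Q, F_conjugate P Q -> 'C_S(Q) \subset Q.

Record centric_subgroup := CentricSubgroup {
  csub :> {group gT};
  csubP : centric csub }.

(** Only the values of [lk_delta P] on [P] are relevant. *)
Record linking_system := LinkingSystem {
  lk_cat :> cat_on centric_subgroup;
  lk_pi : forall P Q : centric_subgroup, hom lk_cat P Q -> {ffun gT -> gT};
  lk_delta : forall P : centric_subgroup, gT -> hom lk_cat P P;
  lk_pi1 : forall P : centric_subgroup, lk_pi (cat_id lk_cat P) = conj_map P 1;
  lk_piM : forall (P Q R : centric_subgroup) (g : hom lk_cat Q R) (f : hom lk_cat P Q),
    lk_pi (cat_comp g f) = ffcomp (lk_pi g) (lk_pi f);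
  lk_pi_onto : forall P Q : centric_subgroup,
    range (@lk_pi P Q) = [set` F P Q];
  lk_delta1 : forall P : centric_subgroup, lk_delta P 1 = cat_id lk_cat P;
  lk_deltaM : forall P : centric_subgroup,
    {in P &, forall x y, lk_delta P (x * y) = cat_comp (lk_delta P x) (lk_delta P y)};
  lk_delta_inj : forall P : centric_subgroup, {in P &, injective (lk_delta P)};
  lk_free : forall (P Q : centric_subgroup) (f : hom lk_cat P Q) x,
    x \in 'Z(P) -> cat_comp f (lk_delta P x) = f -> x = 1;
  lk_orbit : forall (P Q : centric_subgroup) (f g : hom lk_cat P Q),
    lk_pi f = lk_pi g <->
    exists2 x, x \in 'Z(P) & g = cat_comp f (lk_delta P x);
  lk_pi_delta : forall P : centric_subgroup,
    {in P, forall x, lk_pi (lk_delta P x) = conj_map P x};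
  lk_delta_nat : forall (P Q : centric_subgroup) (f : hom lk_cat P Q),
    {in P, forall x, cat_comp f (lk_delta P x) =
                     cat_comp (lk_delta Q (lk_pi f x)) f} }.

Definition saturated_fusion_system :=
  [/\ l.-group S, fusion_system & saturated].

End Fusion.

(* Main.v *)
Require Import Defs.
From HB Require Import structures.
From mathcomp Require Import all_boot all_order all_algebra fraction ring lra.
From mathcomp Require Import boolp classical_sets functions cardinality fsbigop.
From mathcomp Require Import reals topology normedtype.
From mathcomp Require Import fingroup perm morphism.
From mathcomp Require Import pgroup nilpotent cyclic sylow.
From mathcomp Require mpoly.
Set Implicit Arguments. Unset Strict Implicit. Unset Printing Implicit Defensive.
Import Order.TTheory GRing.Theory Num.Theory.
Import numFieldNormedType.Exports.
Import Defs.

(** Both orbit spaces are contractible.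

In [Te G], the coset [G] itself is a split Levi, being the centraliser of the
torus of rank zero. Every object maps to [G], and the automorphisms of [G]
permute these maps transitively, so appending [G] to a chain gives a join with
the class of the chain [G] in the poset of classes of chains, which is thus
conically contractible.

For a linking system, classes of chains of noniso morphisms correspond to classes
under the fusion system of chains [Q_0 < ... < Q_m] of centric subgroups of [S],
ordered by inclusion up to conjugacy. Let [Q_0, ..., Q_k] be the longest initial
segment whose members are all normal in [Q_k], let [H = Q_(k+1)], or [H = S] if
[k = m], and let [N] be the subgroup of [H] normalising [Q_0, ..., Q_k]. For [k = m]
the chain is replaced by a conjugate for which [N] is as large as possible; by
saturation all isomorphisms onto it extend to the normalisers. If [N] is not
[Q_k], match the chain with the one obtained by inserting [N]. Since normalisers
grow in [l]-groups, this is a perfect matching except for the chain [S], and it is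
acyclic because the order of [Q_k] increases along gradient paths.

Realizations of finite posets are contracted along such a matching by pairs: the
lower element of a pair is pushed to the upper one, and the latter is then removed
since the elements below it form a cone. *)

(** * Homotopies *)

(** Two obstacles shape the proof. If [q <= c q] for all [q], the segment from a point to its image
    under [c] may leave the complex, since [q] and [c q'] need not be comparable when [q' < q]. Mass
    is therefore moved from the top of the supporting chain downwards, by a formula in unnormalised
    barycentric coordinates that stays continuous where the remaining mass vanishes. On the fusion
    side, if [k < m] then [H] is a member of the chain, and every morphism defined on the chain
    carries [N] along. If [k = m], then [H = S] can lie outside the domain of these morphisms, so
    the size of [N] depends on the representative of the class; this is where saturation enters. *)

Section RealContinuity.
Local Open Scope classical_set_scope.
Local Open Scope ring_scope.
Variables (R : realType) (T : topologicalType).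
Implicit Types f g : T -> R.

Lemma continuous_realD f g : continuous f -> continuous g ->
  continuous (fun x => f x + g x).
Proof. by move=> cf cg x; apply: cvgD; [exact: cf|exact: cg]. Qed.

Lemma continuous_realB f g : continuous f -> continuous g ->
  continuous (fun x => f x - g x).
Proof. by move=> cf cg x; apply: cvgB; [exact: cf|exact: cg]. Qed.

Lemma continuous_realM f g : continuous f -> continuous g ->
  continuous (fun x => f x * g x).
Proof. by move=> cf cg x; apply: cvgM; [exact: cf|exact: cg]. Qed.

Lemma continuous_real_min f g : continuous f -> continuous g ->
  continuous (fun x => Num.min (f x) (g x)).
Proof. by move=> cf cg x; apply: continuous_min; [exact: cf|exact: cg]. Qed.

Lemma continuous_real_sum (I : Type) (r : seq I) (P : pred I) (F : I -> T -> R) :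
  (forall i, continuous (F i)) -> continuous (fun x => \sum_(i <- r | P i) F i x).
Proof.
move=> cF; elim: r => [|i r IHr].
  under eq_fun do rewrite big_nil; exact: cst_continuous.
under eq_fun do rewrite big_cons; case: (P i) => //; exact: continuous_realD.
Qed.

Lemma continuous_real_cst (c : R) : continuous (fun _ : T => c).
Proof. exact: cst_continuous. Qed.

Lemma continuous_pair (X : topologicalType) f (g : T -> X) :
  continuous f -> continuous g -> continuous (fun x => (f x, g x)).
Proof. by move=> cf cg x; exact: (cvg_pair (cf x) (cg x)). Qed.

End RealContinuity.

(** * Composition of homotopies and domination of spaces *)

Section HomotopyCalculus.
Local Open Scope classical_set_scope.
Local Open Scope ring_scope.
Variable R : realType.

Definition clip (t : R) : R := Num.min 1 (Num.max 0 t).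

Lemma clip01 t : 0 <= clip t <= 1.
Proof. by rewrite /clip le_min ler01 le_max lexx ge_min lexx. Qed.

Lemma clip_id t : 0 <= t <= 1 -> clip t = t.
Proof. by case/andP=> t0 t1; rewrite /clip (max_r t0) (min_r t1). Qed.

Lemma continuous_clip (T : topologicalType) (f : T -> R) :
  continuous f -> continuous (fun x => clip (f x)).
Proof.
move=> cf; apply: continuous_real_min; first exact: continuous_real_cst.
by move=> x; apply: continuous_max; [exact: continuous_real_cst|exact: cf].
Qed.

Section TwoSpaces.
Variables X Y : topologicalType.

Lemma continuous_time : continuous (fst : R * X -> R).
Proof. by move=> z; exact: cvg_fst. Qed.

Lemma continuous_reparam (H : R * X -> Y) (h : R * X -> R) :
  continuous H -> continuous h -> continuous (fun z => H (h z, z.2)).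
Proof.
move=> cH ch z; apply: (@continuous_comp _ _ _ (fun z : R * X => (h z, z.2)) H).
  by apply: continuous_pair => // z'; exact: cvg_snd.
exact: cH.
Qed.

(** Precomposition with the retraction [clip] of the line onto the unit interval makes a homotopy
    continuous on the whole product, so homotopies can be given by globally continuous maps. *)
Lemma homotopicP (f g : X -> Y) :
  homotopic R f g <-> exists H : (R * X)%type -> Y,
    [/\ continuous H, forall x, H (0, x) = f x & forall x, H (1, x) = g x].
Proof.
split=> [[H [cH H0 H1]]|[H [cH H0 H1]]]; last first.
  by exists H; split=> //; exact: continuous_subspaceT.
exists (fun z => H (clip z.1, z.2)); split=> [|x|x]; last 2 first.
- by rewrite clip_id ?lexx ?ler01 // H0.
- by rewrite clip_id ?lexx ?ler01 // H1.
have cc : continuous (fun z : (R * X)%type => (clip z.1, z.2)).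
  apply: continuous_pair; last by move=> z; exact: cvg_snd.
  exact: continuous_clip continuous_time.
move=> z A nA.
have := (proj1 (subspace_continuousP _ _) cH) (clip z.1, z.2) (clip01 _) A nA.
rewrite /= /within /= => nA'; have nA2 := cc z _ nA'.
have : nbhs z [set z' | A (H (clip z'.1, z'.2))].
  by apply: (@filterS _ (nbhs z) _ _ _ _ nA2) => z'; apply; exact: clip01.
by [].
Qed.

Lemma homotopic_sym (f g : X -> Y) : homotopic R f g -> homotopic R g f.
Proof.
move=> /homotopicP[H [cH H0 H1]]; apply/homotopicP.
exists (fun z => H (1 - z.1, z.2)); split=> [|x|x]; last 2 first.
- by rewrite subr0.
- by rewrite subrr.
apply: continuous_reparam => //.
by exact: (continuous_realB (@continuous_real_cst _ _ 1) continuous_time).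
Qed.

Lemma homotopic_trans (f g h : X -> Y) :
  homotopic R f g -> homotopic R g h -> homotopic R f h.
Proof.
move=> /homotopicP[H [cH H0 H1]] /homotopicP[K [cK K0 K1]].
pose M (z : (R * X)%type) := if z.1 <= 2^-1 then H (2 * z.1, z.2) else K (2 * z.1 - 1, z.2).
have c2 : continuous (fun z : (R * X)%type => 2 * z.1).
  by exact: (continuous_realM (@continuous_real_cst _ _ 2) continuous_time).
exists M; split=> [|x|x]; last 2 first.
- by rewrite /M /= invr_ge0 ler0n mulr0.
- rewrite /M /= mulr1; case: lerP => [le12|_]; first by exfalso; lra.
  have -> : 2 - 1 = 1 :> R by lra.
  by rewrite K1.
apply: (@continuous_subspaceW _ _ _ ([set z : (R * X)%type | z.1 <= 2^-1] `|` [set z | 2^-1 <= z.1])).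
  by move=> z _ /=; case: (lerP z.1 2^-1) => [|/ltW]; [left|right].
apply: withinU_continuous.
- apply: (@preimage_closed _ _ (fst : R * X -> R) [set t | t <= 2^-1]); last exact: closed_le.
  by move=> z _; exact: continuous_time.
- apply: (@preimage_closed _ _ (fst : R * X -> R) [set t | 2^-1 <= t]); last exact: closed_ge.
  by move=> z _; exact: continuous_time.
- apply: (@subspace_eq_continuous _ [set z : (R * X)%type | z.1 <= 2^-1] Y
    (fun z => H (2 * z.1, z.2)) M).
    by move=> z /set_mem /=; rewrite /M => ->.
  by apply: continuous_subspaceT; exact: continuous_reparam.
- apply: (@subspace_eq_continuous _ [set z : (R * X)%type | 2^-1 <= z.1] Y
    (fun z => K (2 * z.1 - 1, z.2)) M).
    move=> z /set_mem /= z1; rewrite /M; case: (lerP z.1 2^-1) => // z2.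
    have -> : z.1 = 2^-1 by apply/eqP; rewrite eq_le z1 z2.
    by rewrite divff ?pnatr_eq0 // subrr H1 K0.
  apply: continuous_subspaceT; apply: continuous_reparam => //.
  exact: (continuous_realB c2 (@continuous_real_cst _ _ 1)).
Qed.

End TwoSpaces.

Lemma homotopic_compl (X Y Z : topologicalType) (f g : X -> Y) (h : Y -> Z) :
  continuous h -> homotopic R f g -> homotopic R (h \o f) (h \o g).
Proof.
move=> ch /homotopicP[H [cH H0 H1]]; apply/homotopicP; exists (h \o H).
split=> [|x|x] /=; last 2 first.
- by rewrite H0.
- by rewrite H1.
by move=> z; apply: continuous_comp; [exact: cH|exact: ch].
Qed.

Lemma homotopic_compr (X Y Z : topologicalType) (f g : Y -> Z) (h : X -> Y) :
  continuous h -> homotopic R f g -> homotopic R (f \o h) (g \o h).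
Proof.
move=> ch /homotopicP[H [cH H0 H1]]; apply/homotopicP.
exists (fun z => H (z.1, h z.2)); split=> [|x|x] /=; last 2 first.
- by rewrite H0.
- by rewrite H1.
move=> z; apply: (@continuous_comp _ _ _ (fun z : (R * X)%type => (z.1, h z.2)) H); last exact: cH.
apply: (continuous_pair (@continuous_time X)) => z'.
by apply: (@continuous_comp _ _ _ snd h); [exact: cvg_snd|exact: ch].
Qed.

(** A contraction of [Y], transported by [i] and [r], joins [i \o r] to a constant. One composite
    suffices, so an element of a poset can be deleted by a deformation that moves points of the
    smaller complex. *)
Lemma contractible_dominated (X Y : topologicalType) (i : Y -> X) (r : X -> Y) :
  continuous i -> continuous r -> homotopic R id (i \o r) ->
  contractible R Y -> contractible R X.
Proof.
move=> ci cr ir [y0 y0P]; exists (i y0); apply: homotopic_trans ir _.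
by have := homotopic_compr cr (homotopic_compl ci y0P).
Qed.

Lemma contractible_homotopy_equivalent (X Y : topologicalType) :
  contractible R X -> contractible R Y -> homotopy_equivalent R X Y.
Proof.
move=> [x0 hx] [y0 hy]; exists (fun=> y0), (fun=> x0); split.
- exact: cst_continuous.
- exact: cst_continuous.
- exact: homotopic_sym.
- exact: homotopic_sym.
Qed.

End HomotopyCalculus.

(** * Realizations of finite posets *)

Section FiniteRealization.
Local Open Scope classical_set_scope.
Local Open Scope ring_scope.
Variables (R : realType) (P : finType) (le : P -> P -> Prop).
Local Notation X := (realization R le).

Lemma fsum_support (f : P -> R) :
  \sum_(p \in [set p : {classic P} | f p != 0]) f p = \sum_p f p.
Proof.
have u : uniq ([seq p | p <- enum P] : seq {classic P}).
  by rewrite (map_inj_uniq (f := fun p : P => p : {classic P})) ?enum_uniq.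
rewrite (fsbig_widen _ [set` ([seq p | p <- enum P] : seq {classic P})]) /=.
- by rewrite -fsbig_seq // big_map enumT.
- by move=> p _ /=; apply/mapP; exists p => //; rewrite mem_enum.
- by move=> p [_] /= /negP; rewrite negbK => /eqP.
Qed.

Lemma realization_sum (x : X) : \sum_p x p = 1.
Proof. by rewrite -(bary_sum x) fsum_support. Qed.

Lemma realization_exist (f : P -> R) : (forall p, 0 <= f p) ->
  (forall p q, f p != 0 -> f q != 0 -> le p q \/ le q p) ->
  \sum_p f p = 1 -> exists x : X, bary x = f.
Proof.
move=> f0 fle f1.
have fc : is_chain le [set p | f p != 0] by split=> //; exact: finite_finset.
have fs : \sum_(p \in [set p : {classic P} | f p != 0]) f p = 1 by rewrite fsum_support.
by exists (Realization f0 fc fs).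
Qed.

Lemma realization_eq (x y : X) : bary x = bary y -> x = y.
Proof.
case: x y => [f f0 fc fs] [g g0 gc gs] /= e; subst g.
by congr Realization; exact: Prop_irrelevance.
Qed.

Lemma bary_le1 (x : X) p : x p <= 1.
Proof.
rewrite -(realization_sum x) (bigD1 p) //= lerDl.
by apply: sumr_ge0 => q _; exact: bary_ge0.
Qed.

(** For a finite poset the weak topology is that of the sup norm. The radii attached to the finitely
    many faces have a positive minimum [m1]; staying within [m2], a bound for the nonzero
    coordinates of [x], keeps the support of [x] inside that of [y], so one face carries both
    points. *)
Lemma open_realization_ball (U : set X) (x : X) : open U -> U x ->
  exists2 eps : R, 0 < eps & forall y : X, (forall p, `|x p - y p| < eps) -> U y.
Proof.
move=> oU Ux; pose A0 := [set p | x p != 0].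
have /choice[e eP] (A : {set P}) : exists e : R, 0 < e /\
    (is_chain le [set` A] -> A0 `<=` [set` A] -> forall y : X,
      [set p | y p != 0] `<=` [set` A] -> (forall p, `|x p - y p| < e) -> U y).
  case: (pselect (is_chain le [set` A] /\ A0 `<=` [set` A])) => [[cA A0A]|nA]; last first.
    by exists 1; split=> // cA A0A; case: nA.
  have [eps e0 eU] := oU _ cA x Ux A0A; exists eps; split=> // _ _ y yA yx.
  by apply: eU => // p _; exact: yx.
pose m1 := \big[Order.min/1]_(A : {set P}) e A.
pose m2 := \big[Order.min/1]_(p | x p != 0) x p.
have m10 : 0 < m1.
  by rewrite /m1; elim/big_ind: _ => // [b c b0 c0|A _]; [rewrite lt_min b0|case: (eP A)].
have m20 : 0 < m2.
  rewrite /m2; elim/big_ind: _ => // [b c b0 c0|p xp]; first by rewrite lt_min b0.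
  by rewrite lt_neqAle eq_sym xp bary_ge0.
exists (Order.min m1 m2) => [|y yx]; first by rewrite lt_min m10.
pose A := [set p : P | y p != 0]%SET.
have [_] := eP A; apply.
- have [fy cy] := bary_chain y; split; first exact: finite_finset.
  by move=> p q; rewrite /= !inE => yp yq; exact: cy.
- move=> p /= xp; rewrite inE; apply/eqP => yp.
  have := yx p; rewrite yp subr0 ger0_norm ?bary_ge0 // lt_min => /andP[_].
  by rewrite ltNge bigmin_le_cond.
- by move=> p /=; rewrite inE.
- by move=> p; apply: lt_le_trans (yx p) _; rewrite ge_min bigmin_le_cond.
Qed.

Lemma continuous_bary (p : P) : continuous (fun x : X => x p).
Proof.
apply/continuousP => U oU.
suff: realization_open ((fun x : X => x p) @^-1` U) by [].
move=> A cA x Ux xA.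
have /nbhs_ballP[e e0 eU] : nbhs (x p) U by apply: open_nbhs_nbhs; split.
exists e => // y yA xy; apply: eU.
case: (pselect (A p)) => Ap; first exact: xy.
have z (w : X) : [set p | w p != 0] `<=` A -> w p = 0.
  by move=> wA; apply/eqP; apply: contra_notT Ap; exact: wA.
by rewrite !z //; exact: ballxx.
Qed.

Lemma continuous_to_realization (T : topologicalType) (F : T -> X) :
  (forall p, continuous (fun z => F z p)) -> continuous F.
Proof.
move=> cF z U; rewrite nbhsE => -[V [oV VFz] VU].
have [e e0 eV] := open_realization_ball oV VFz.
have : \forall z' \near z, forall p, `|F z p - F z' p| < e.
  by apply: filter_forall => p; have /cvgrPdist_lt := cF p z; apply.
by apply: filterS => z' Vz'; apply/VU/eV => p; exact: Vz'.
Qed.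

End FiniteRealization.

(** Reflexivity is asked of the elements comparable to something. An element that is not related
    even to itself cannot occur in the support of a point; elements are thus deleted by shrinking
    the relation, while the type and the coordinates stay the same. *)
Record is_partial_order (P : Type) (le : P -> P -> Prop) := IsPartialOrder {
  po_trans : forall p q r, le p q -> le q r -> le p r;
  po_anti : forall p q, le p q -> le q p -> p = q;
  po_refll : forall p q, le p q -> le p p;
  po_reflr : forall p q, le p q -> le q q }.

(** * Mass distributed along a chain *)

Section Chains.
Local Open Scope classical_set_scope.
Local Open Scope ring_scope.
Variables (R : realType) (P : finType) (le : P -> P -> Prop).

Definition chain_supported (y : P -> R) :=
  forall p q, y p != 0 -> y q != 0 -> le p q \/ le q p.

Definition below (y : P -> R) p := \sum_(q | `[< le q p >] && (q != p)) y q.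

Hypothesis le_po : is_partial_order le.

Lemma chain_supported_top (y : P -> R) p1 : chain_supported y -> y p1 != 0 ->
  exists2 p0, y p0 != 0 & forall p, y p != 0 -> le p p0.
Proof.
move=> cy y1; pose A p := [set q | (y q != 0) && `[< le q p >]]%SET.
have [p0 y0 max0] := arg_maxnP (fun p => #|A p|) (y1 : [pred p | y p != 0] p1).
exists p0 => // p yp; case: (cy p p0 yp y0) => // lep0.
have pp : le p p by case: (cy p p yp yp).
have := max0 p yp; have sA : A p0 \subset A p.
  apply/fintype.subsetP => q; rewrite !inE => /andP[-> /asboolP qp0] /=.
  by apply/asboolP; exact: (po_trans le_po) qp0 lep0.
move=> /(conj sA)/andP; rewrite -eqEcard => /eqP eA.
have : p \in A p by rewrite inE yp; apply/asboolP.
by rewrite -eA inE => /andP[_ /asboolP].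
Qed.

(* Telescoping along the chain that supports [y]. *)
Lemma sum_below (g : R -> R) (y : P -> R) : chain_supported y ->
  \sum_p (g (below y p + y p) - g (below y p)) = g (\sum_p y p) - g 0.
Proof.
have [n] := ubnP #|[set p | y p != 0]%SET|.
elim: n y => // n IHn y; rewrite ltnS => sz cy.
have [/existsP[p1 y1]|/existsPn y0] := boolP [exists p, y p != 0]; last first.
  have {}y0 p : y p = 0 by apply/eqP; rewrite -[_ == _]negbK y0.
  by rewrite !big1 ?subrr // => p _; rewrite y0 addr0 subrr.
have [p0 yp0 top] := chain_supported_top cy y1.
(* Removing the mass at the largest support element [p0] leaves [below] unchanged at the other
   support elements, and [below y p0] is the whole remaining mass. *)
pose y' p := if p == p0 then 0 else y p.
have y'0 p : y' p != 0 -> (p != p0) /\ y p != 0.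
  by rewrite /y'; have [_|] := eqVneq p p0; rewrite ?eqxx.
have cy' : chain_supported y' by move=> p q /y'0[_ yp] /y'0[_ yq]; exact: cy.
have sz' : (#|[set p | y' p != 0%R]%SET| < n)%N.
  apply: leq_trans sz; apply: proper_card; apply/properP; split.
    by apply/fintype.subsetP => p; rewrite !inE => /y'0[].
  by exists p0; rewrite inE // /y' eqxx negbK.
have y'p0 : y' p0 = 0 by rewrite /y' eqxx.
have y'E p : p != p0 -> y' p = y p by rewrite /y' => /negbTE ->.
have sy : \sum_p y p = \sum_p y' p + y p0.
  rewrite (bigD1 p0) //= [in RHS](bigD1 p0) //= y'p0 add0r addrC.
  by congr (_ + _); apply: eq_bigr => p /y'E.
have b0 : below y p0 = \sum_p y' p.
  rewrite [RHS](bigD1 p0) //= y'p0 add0r /below big_mkcondl /=.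
  apply: eq_bigr => p pp0; rewrite y'E //; case: asboolP => // nle.
  by apply/esym/eqP; apply: contra_notT nle; exact: top.
rewrite sy (bigD1 p0) //= b0.
have := IHn _ sz' cy'; rewrite (bigD1 p0) //= y'p0 addr0 subrr add0r => IH.
rewrite (_ : \sum_(i | i != p0) _ = g (\sum_p y' p) - g 0); first by ring.
rewrite -IH; apply: eq_bigr => p pp0; rewrite y'E //.
have [->|yp] := eqVneq (y p) 0; first by rewrite !addr0 !subrr.
suff -> : below y p = below y' p by [].
apply: eq_bigr => q /andP[/asboolP qp _]; rewrite y'E //; apply/eqP => qp0.
by move/eqP: pp0; apply; apply: (po_anti le_po); [exact: top|rewrite -qp0].
Qed.

End Chains.

(** * Contraction of conical posets in barycentric coordinates *)

Section Spread.
Local Open Scope classical_set_scope.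
Local Open Scope ring_scope.
Variables (R : realType) (P : finType) (le : P -> P -> Prop).
Hypothesis le_po : is_partial_order le.

(* [Q] is contractible through [q <= c q >= v]. *)
Record conical (Q : P -> Prop) (c : P -> P) (v : P) := Conical {
  con_v : Q v;
  con_vv : le v v;
  con_c : forall q, Q q -> Q (c q);
  con_le : forall q, Q q -> le q (c q);
  con_ge : forall q, Q q -> le v (c q);
  con_mono : forall q r, Q q -> Q r -> le q r -> le (c q) (c r) }.

Variables (Q : P -> Prop) (c : P -> P) (v : P).
Hypothesis con : conical Q c v.

Definition low (k : R) (y : P -> R) p :=
  Num.min (below le y p + y p) k - Num.min (below le y p) k.

(* Seen as an increasing step function with values in [P], [y] has the part
[low k y] below height [k]. [spread s u y] adds mass [u] to [y], of mass
[1 - s]: as far as possible by moving the top of [y] along [c] and doubling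
it, and then by adding mass to [v]. *)
Definition spread (s u : R) (y : P -> R) p :=
  let k := Num.min u (1 - s) in
  low (1 - s - k) y p + 2 * (\sum_(q | c q == p) (y q - low (1 - s - k) y q))
    + (u - k) * (p == v)%:R.

Section Support.
Variables (s u : R) (y : P -> R).
Hypotheses (s1 : s <= 1) (u0 : 0 <= u).
Hypotheses (y0 : forall p, 0 <= y p) (cy : chain_supported le y).
Hypothesis ysum : \sum_p y p = 1 - s.
Hypothesis yQ : 0 < u -> forall p, y p != 0 -> Q p.
Let k := Num.min u (1 - s).

Lemma below_ge0 p : 0 <= below le y p.
Proof. exact: sumr_ge0. Qed.

Lemma below_le p : below le y p + y p <= 1 - s.
Proof.
rewrite -ysum [leRHS](bigD1 p) //= [leLHS]addrC lerD2l /below.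
rewrite big_mkcondl /=; apply: ler_sum => q _.
by case: ifP.
Qed.

Let ks : k <= 1 - s. Proof. by rewrite /k ge_min lexx orbT. Qed.
Let k0 : 0 <= k. Proof. by rewrite /k le_min u0 subr_ge0. Qed.
Let ku : k <= u. Proof. by rewrite /k ge_min lexx. Qed.

Lemma low_ge0 t p : 0 <= low t y p.
Proof.
rewrite /low subr_ge0 le_min ge_min ge_min lexx orbT andbT.
by rewrite lerDl y0.
Qed.

Lemma low_le t p : low t y p <= y p.
Proof.
rewrite /low lerBlDr; have := y0 p; move: (below _ _ _) (y p) => a b b0.
by rewrite /Num.min; case: ifP; case: ifP; lra.
Qed.

Lemma low_neq0 t p : low t y p != 0 -> y p != 0 /\ below le y p < t.
Proof.
rewrite /low => lp; split.
  by apply: contra_neq lp => ->; rewrite addr0 subrr.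
rewrite ltNge; apply: contra_neqN lp => tb.
by rewrite !min_r ?subrr //; apply: le_trans tb _; rewrite lerDl.
Qed.

Lemma high_neq0 t p : y p - low t y p != 0 -> y p != 0 /\ t < below le y p + y p.
Proof.
rewrite /low => lp; split.
  by apply: contra_neq lp => ->; rewrite addr0 !subrr.
rewrite ltNge; apply: contra_neqN lp => tb.
rewrite !min_l //; last by apply: le_trans tb; rewrite lerDl.
by ring.
Qed.

Lemma spread_ge0 p : 0 <= spread s u y p.
Proof.
rewrite /spread -/k; apply: addr_ge0; last by rewrite mulr_ge0 ?subr_ge0.
apply: addr_ge0; first exact: low_ge0.
by rewrite mulr_ge0 // sumr_ge0 // => q _; rewrite subr_ge0 low_le.
Qed.

(** The part left in place has mass [1 - s - k], the doubled top has mass [2 * k], and [v] receives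
    [u - k]. *)
Lemma spread_sum : \sum_p spread s u y p = 1 - s + u.
Proof.
rewrite /spread -/k 2!big_split /= -!mulr_sumr.
have push (h : P -> R) : \sum_p \sum_(q | c q == p) h q = \sum_q h q.
  by rewrite [RHS](partition_big c xpredT).
rewrite push [X in 2 * X]sumrB ysum.
have -> : \sum_(p : P) (p == v)%:R = 1 :> R.
  by rewrite (bigD1 v) //= eqxx big1 ?addr0 => [|p /negbTE->].
have -> : \sum_p low (1 - s - k) y p = 1 - s - k.
  rewrite (sum_below le_po (fun a => Num.min a (1 - s - k))) //.
  rewrite ysum /= min_r; last by rewrite lerBlDr lerDl.
  by rewrite min_l ?subr0 // subr_ge0.
by ring.
Qed.

Lemma spread_neq0 p : spread s u y p != 0 ->
  [\/ low (1 - s - k) y p != 0,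
      exists2 q, c q = p & y q - low (1 - s - k) y q != 0 |
      p = v /\ k < u].
Proof.
move=> sp; case: (eqVneq (low (1 - s - k) y p) 0) => [lp|]; last by constructor 1.
case: (pselect (exists2 q, c q = p & y q - low (1 - s - k) y q != 0)); first by constructor 2.
move=> nq; constructor 3; move: sp; rewrite /spread -/k lp add0r big1; last first.
  move=> q /eqP cq; apply/eqP; apply: contra_notT nq => h; by exists q.
rewrite mulr0 add0r mulf_eq0 negb_or => /andP[uk pv].
split; first by apply/eqP; case: (p == v) pv => //=; rewrite eqxx.
by rewrite lt_neqAle ku andbT; apply: contra uk => /eqP->; rewrite subrr.
Qed.

Lemma spread_trivial : u = 0 -> spread s u y =1 y.
Proof.
move=> u00 p; rewrite /spread (_ : Num.min u (1 - s) = 0); last first.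
  by rewrite u00 min_l // subr_ge0.
have low1 q : low (1 - s - 0) y q = y q.
  rewrite /low subr0 !min_l ?below_le //; last by apply: le_trans (below_le q); rewrite lerDl.
  by ring.
by rewrite low1 big1 ?u00 => [|q _]; rewrite ?low1 ?subrr //; ring.
Qed.

Lemma spread_support p : spread s u y p != 0 -> y p != 0 \/ 0 < u /\ Q p.
Proof.
have [u00|] := eqVneq u 0; first by rewrite spread_trivial //; left.
move=> un0; have up : 0 < u by rewrite lt_neqAle eq_sym un0.
case/spread_neq0 => [/low_neq0[]|[q <- /high_neq0[yq _]]|[-> _]]; first by left.
- by right; split=> //; apply: (con_c con); exact: yQ yq.
- by right; split=> //; exact: (con_v con).
Qed.

(** Mass left at [p] lies below the mass moved from [q], as [p <= q <= c q]; this is why the top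
    moves first. The moved mass is on a chain because [c] is monotone, and it lies above [v].
    Finally [v] gets mass only if [k < u]; then [k = 1 - s] and nothing is left in place. *)
Lemma spread_chain : chain_supported le (spread s u y).
Proof.
have [u00|un0] := eqVneq u 0.
  by move=> p q; rewrite !spread_trivial //; exact: cy.
have {un0} up : 0 < u by rewrite lt_neqAle eq_sym un0.
have lowhigh p q : low (1 - s - k) y p != 0 -> y q - low (1 - s - k) y q != 0 -> le p (c q).
  move=> /low_neq0[yp bp] /high_neq0[yq bq].
  suff pq : le p q by apply: (po_trans le_po) pq _; apply: (con_le con); exact: yQ yq.
  case: (cy yp yq) => // qp; case: (eqVneq q p) => [->|qnp].
    by case: (cy yp yp).
  (* If [q] were strictly below [p], the interval of heights of [p] would start after that of [q]
     ends; but the first starts below [1 - s - k] and the second ends above it. *)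
  have : below le y q + y q <= below le y p.
    rewrite /below [leRHS](bigD1 q) /=; last by rewrite qnp andbT; apply/asboolP.
    rewrite [leLHS]addrC lerD2l [leLHS]big_mkcond [leRHS]big_mkcond /=.
    apply: ler_sum => r _; case: ifP => [/andP[/asboolP rq rnq]|]; last by case: ifP.
    rewrite ifT // rnq andbT; apply/andP; split.
      by apply/asboolP; exact: (po_trans le_po) rq qp.
    apply: contra_neq rnq => rp; apply: (po_anti le_po) => //.
    by rewrite rp.
  by move: bp bq; lra.
have lowv p : low (1 - s - k) y p != 0 -> k < u -> False.
  move=> /low_neq0[yp bp]; rewrite /k gt_min ltxx /= => su.
  by move: bp; rewrite /k min_r ?ltW // subrr ltNge below_ge0.
have cc q r : y q - low (1 - s - k) y q != 0 -> y r - low (1 - s - k) y r != 0 ->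
    le (c q) (c r) \/ le (c r) (c q).
  move=> /high_neq0[yq _] /high_neq0[yr _].
  have [Qq Qr] := (yQ up yq, yQ up yr).
  by case: (cy yq yr) => h; [left|right]; exact: (con_mono con).
have vc q : y q - low (1 - s - k) y q != 0 -> le v (c q).
  by move=> /high_neq0[yq _]; apply: (con_ge con); exact: yQ yq.
move=> p p' /spread_neq0[lp|[q <- hq]|[-> vu]] /spread_neq0[lp'|[q' <- hq']|[-> vu']].
- by apply: cy; [case/low_neq0: lp|case/low_neq0: lp'].
- by left; exact: lowhigh.
- by case: (lowv _ lp vu').
- by right; exact: lowhigh.
- exact: cc.
- by right; exact: vc.
- by case: (lowv _ lp' vu).
- by left; exact: vc.
- by left; exact: con_vv con.
Qed.

End Support.

(** [below] sums over the fixed set of elements under [p], so the formula does not depend on an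
    ordering of the support and is continuous across faces. *)
Lemma continuous_spread (T : topologicalType) (s u : T -> R) (y : T -> P -> R) p :
  continuous s -> continuous u -> (forall q, continuous (fun z => y z q)) ->
  continuous (fun z => spread (s z) (u z) (y z) p).
Proof.
move=> cs cu cy.
have c1 : continuous (fun z => 1 - s z).
  by apply: continuous_realB => //; exact: continuous_real_cst.
have ck : continuous (fun z => Num.min (u z) (1 - s z)) by exact: continuous_real_min.
have ct : continuous (fun z => 1 - s z - Num.min (u z) (1 - s z)) by exact: continuous_realB.
have cl q : continuous (fun z => low (1 - s z - Num.min (u z) (1 - s z)) (y z) q).
  have cb : continuous (fun z => below le (y z) q) by exact: continuous_real_sum.
  apply: continuous_realB; apply: continuous_real_min => //.
  exact: continuous_realD.
apply: continuous_realD; last first.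
  by apply: continuous_realM; [exact: continuous_realB|exact: continuous_real_cst].
apply: continuous_realD => //; apply: continuous_realM; first exact: continuous_real_cst.
by apply: continuous_real_sum => q; exact: continuous_realB.
Qed.

End Spread.

(** * Deleting elements of a finite poset *)

Section Collapse.
Local Open Scope classical_set_scope.
Local Open Scope ring_scope.
Variables (R : realType) (P : finType).
Implicit Types le : P -> P -> Prop.

Definition del le (a : P) p q := [/\ p <> a, q <> a & le p q].

Lemma del_po le a : is_partial_order le -> is_partial_order (del le a).
Proof.
move=> [tr an rl rr]; split=> [p q r [pa _ pq] [_ ra qr]|p q [_ _ pq] [_ _ qp]|
  p q [pa _ /rl]|p q [_ qa /rr]] //; first by split=> //; exact: tr qr.
exact: an.
Qed.

Lemma continuous_dirac (T : topologicalType) (f : T -> R) (p q : P) :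
  continuous f -> continuous (fun z => f z * (p == q)%:R).
Proof. by move=> cf; apply: continuous_realM => //; exact: continuous_real_cst. Qed.

Lemma realization_homotopy le (H : R * realization R le -> P -> R) :
  (forall z p, 0 <= z.1 <= 1 -> 0 <= H z p) ->
  (forall z, 0 <= z.1 <= 1 -> chain_supported le (H z)) ->
  (forall z, 0 <= z.1 <= 1 -> \sum_p H z p = 1) ->
  (forall p, continuous (fun z => H z p)) ->
  exists K : R * realization R le -> realization R le,
    continuous K /\ forall z, bary (K z) = H (clip z.1, z.2).
Proof.
move=> H0 Hc H1 cH.
have /choice[K KE] : forall z : R * realization R le,
    exists y : realization R le, bary y = H (clip z.1, z.2).
  by move=> z; apply: realization_exist => [p||]; [apply: H0|apply: Hc|apply: H1];
    exact: clip01.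
exists K; split=> //; apply: continuous_to_realization => p.
under eq_fun do rewrite KE.
apply: (@continuous_reparam _ _ _ (fun z => H z p)) => //.
exact: continuous_clip (@continuous_time _ _).
Qed.

Lemma contractible_del le a (H : R * realization R le -> P -> R) :
  (forall z p, 0 <= z.1 <= 1 -> 0 <= H z p) ->
  (forall z, 0 <= z.1 <= 1 -> chain_supported le (H z)) ->
  (forall z, 0 <= z.1 <= 1 -> \sum_p H z p = 1) ->
  (forall p, continuous (fun z => H z p)) ->
  (forall x, H (0, x) =1 x) -> (forall x, H (1, x) a = 0) ->
  contractible R (realization R (del le a)) -> contractible R (realization R le).
Proof.
move=> H0 Hc H1 cH Hid Ha.
have [K [cK KE]] := realization_homotopy H0 Hc H1 cH.
have I01 : 0 <= (1 : R) <= 1 by rewrite lexx ler01.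
have /choice[r rE] : forall x : realization R le,
    exists y : realization R (del le a), bary y = K (1, x).
  move=> x; rewrite KE /= clip_id //; apply: realization_exist => [p||].
  - exact: H0.
  - have na p : H (1, x) p != 0 -> p <> a by move=> + e; rewrite e Ha eqxx.
    move=> p q hp hq; have [] := Hc (1, x) I01 p q hp hq; [left|right];
    by split=> //; exact: na.
  - exact: H1.
have /choice[i iE] : forall y : realization R (del le a),
    exists x : realization R le, bary x = y.
  move=> y; apply: realization_exist => [p||]; first exact: bary_ge0.
    by move=> p q yp yq; have [_ /(_ _ _ yp yq)[[]|[]]] := bary_chain y; [left|right].
  exact: realization_sum.
apply: (@contractible_dominated _ _ _ i r).
- apply: continuous_to_realization => p; under eq_fun do rewrite iE.
  exact: continuous_bary.
- apply: continuous_to_realization => p; under eq_fun do rewrite rE.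
  move=> x; apply: (@continuous_comp _ _ _ (fun x => K (1, x)) (fun w => bary w p));
    last exact: continuous_bary.
  apply: (@continuous_comp _ _ _ (fun x : realization R le => (1 : R, x)) K); last exact: cK.
  by apply: continuous_pair => [|w]; [exact: continuous_real_cst|exact: cvg_id].
- apply/homotopicP; exists K; split=> // x; apply: realization_eq.
    by rewrite KE /= clip_id ?lexx ?ler01 //; apply/funext => p; exact: Hid.
  by rewrite /= iE rE.
Qed.

(** The mass at [a] slides to [b] along a segment. An element comparable to [a] is below it, hence
    below [b], or strictly above it, hence above [b]. *)
Lemma contractible_del_beat le a b : is_partial_order le -> le a b -> a <> b ->
  (forall p, le a p -> p = a \/ le b p) ->
  contractible R (realization R (del le a)) -> contractible R (realization R le).
Proof.
move=> po ab nab up.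
pose H (z : R * realization R le) p :=
  z.2 p - z.1 * z.2 a * (p == a)%:R + z.1 * z.2 a * (p == b)%:R.
have ta (z : R * realization R le) : 0 <= z.1 <= 1 -> 0 <= z.1 * z.2 a <= z.2 a.
  case/andP=> z0 z1; rewrite mulr_ge0 ?bary_ge0 //=.
  by rewrite -[leRHS]mul1r ler_wpM2r ?bary_ge0.
have supp z p : H z p != 0 -> z.2 p != 0 \/ p = b /\ z.2 a != 0.
  rewrite /H; have [->|pb] := eqVneq p b.
    have [z2a|z2a] := eqVneq (z.2 a) 0; last by right.
    by rewrite z2a !mulr0 !mul0r subr0 addr0; left.
  rewrite mulr0 addr0; have [->|pa] := eqVneq p a.
    have [z2a|z2a] := eqVneq (z.2 a) 0; last by left.
    by rewrite z2a !mulr0 !mul0r subr0 eqxx.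
  by rewrite mulr0 subr0; left.
apply: (@contractible_del _ a H).
- move=> z p z01; have /andP[t0 t1] := ta z z01; rewrite /H.
  apply: addr_ge0; last by rewrite mulr_ge0.
  have [->|] := eqVneq p a; rewrite ?mulr1 ?mulr0 ?subr0 ?subr_ge0 //.
  by rewrite bary_ge0.
- move=> z _ p q; have cz := (bary_chain z.2).2.
  have cab r : z.2 r != 0 -> z.2 a != 0 -> le r b \/ le b r.
    move=> zr za; case: (cz r a zr za) => [ra|/up[->|]]; last by right.
      by left; exact: (po_trans po) ra ab.
    by left.
  case/supp=> [zp|[-> za]] /supp[zq|[-> za']].
  + exact: cz.
  + exact: cab.
  + by case: (cab q zq za); [right|left].
  + by left; exact: (po_reflr po) ab.
- move=> z _; rewrite /H big_split sumrB /= realization_sum.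
  have d (c : P) : \sum_p (z.1 * z.2 a * (p == c)%:R) = z.1 * z.2 a :> R.
    by rewrite (bigD1 c) //= eqxx mulr1 big1 ?addr0 // => p /negbTE->; rewrite mulr0.
  by rewrite !d subrK.
- move=> p.
  have cc q : continuous (fun z : R * realization R le => z.2 q).
    by move=> z; apply: (@continuous_comp _ _ _ snd (fun w : realization R le => bary w q));
      [exact: cvg_snd|exact: continuous_bary].
  have ct : continuous (fun z : R * realization R le => z.1 * z.2 a).
    by apply: continuous_realM => //; exact: continuous_time.
  apply: continuous_realD; last exact: continuous_dirac.
  by apply: continuous_realB => //; exact: continuous_dirac.
- by move=> x p; rewrite /H /= !mul0r subr0 addr0.
- move=> x; rewrite /H /= eqxx mul1r mulr1 subrr add0r.
  by case: eqP => // _; rewrite mulr0.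
Qed.

(** The mass at [b] is handed over to the cone of elements strictly below [b], which contains the
    rest of the support as soon as [b] has mass. The rest [y x] keeps its mass [1 - x b] instead of
    being normalised, so the deformation is continuous also where [x b = 1]; where [x b = 0] it is
    stationary. *)
Lemma contractible_del_weak le b c v : is_partial_order le -> le b b ->
  (forall p, le b p -> p = b) ->
  conical le (fun p => le p b /\ p <> b) c v ->
  contractible R (realization R (del le b)) -> contractible R (realization R le).
Proof.
move=> po bb top con.
pose X := realization R le.
pose y (x : X) p := x p - x b * (p == b)%:R.
have yE x p : p != b -> y x p = x p by rewrite /y => /negbTE->; rewrite mulr0 subr0.
have yb x : y x b = 0 by rewrite /y eqxx mulr1 subrr.
have y0 x p : 0 <= y x p.
  by have [->|/yE->] := eqVneq p b; [rewrite yb|exact: bary_ge0].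
have ysum x : \sum_p y x p = 1 - x b.
  rewrite /y sumrB realization_sum; congr (_ - _).
  by rewrite (bigD1 b) //= eqxx mulr1 big1 ?addr0 // => p /negbTE->; rewrite mulr0.
have yx x p : y x p != 0 -> x p != 0 /\ p <> b.
  have [->|pb] := eqVneq p b; first by rewrite yb eqxx.
  by rewrite yE // => xp; split=> //; apply/eqP.
have cy x : chain_supported le (y x).
  by move=> p q /yx[xp _] /yx[xq _]; exact: (bary_chain x).2.
have yQ (x : X) : 0 < x b -> forall p, y x p != 0 -> le p b /\ p <> b.
  move=> xb p /yx[xp pb]; split=> //.
  have xb' : x b != 0 by rewrite gt_eqF.
  by case: ((bary_chain x).2 p b xp xb') => // /top.
pose H (z : R * X) p :=
  spread le c v (z.2 b) (z.1 * z.2 b) (y z.2) p + (1 - z.1) * z.2 b * (p == b)%:R.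
have u0 (z : R * X) : 0 <= z.1 <= 1 -> 0 <= z.1 * z.2 b.
  by case/andP=> z0 _; rewrite mulr_ge0 ?bary_ge0.
have uQ (z : R * X) : 0 <= z.1 <= 1 -> 0 < z.1 * z.2 b ->
    0 < z.2 b /\ forall p, y z.2 p != 0 -> le p b /\ p <> b.
  move=> /andP[z0 _] u; suff xb : 0 < z.2 b by split=> //; exact: yQ.
  by rewrite lt_neqAle bary_ge0 andbT; apply: contraTneq u => <-; rewrite mulr0 ltxx.
have uQ' (z : R * X) z01 u := (uQ z z01 u).2.
have supp (z : R * X) p : 0 <= z.1 <= 1 -> H z p != 0 ->
    spread le c v (z.2 b) (z.1 * z.2 b) (y z.2) p != 0 \/ p = b /\ 0 < z.2 b.
  move=> z01; rewrite /H; have [->|pb] := eqVneq p b; last by rewrite mulr0 addr0; left.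
  have [->|xb] := eqVneq (z.2 b) 0; first by rewrite !mulr0 mul0r addr0; left.
  by move=> _; right; rewrite lt_neqAle eq_sym xb bary_ge0.
have sub (z : R * X) p : 0 <= z.1 <= 1 ->
    spread le c v (z.2 b) (z.1 * z.2 b) (y z.2) p != 0 ->
    (y z.2 p != 0) \/ 0 < z.1 * z.2 b /\ (le p b /\ p <> b).
  move=> z01.
  exact: (spread_support con (bary_le1 z.2 b) (u0 z z01) (y0 z.2) (ysum z.2) (uQ' z z01)).
apply: (@contractible_del _ b H).
- move=> z p z01; apply: addr_ge0.
    exact: spread_ge0.
  by case/andP: z01 => z0 z1; rewrite !mulr_ge0 ?subr_ge0 ?bary_ge0.
- move=> z z01 p q.
  have leb r : 0 < z.2 b ->
      spread le c v (z.2 b) (z.1 * z.2 b) (y z.2) r != 0 -> le r b.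
    by move=> xb /(sub z r z01)[/(yQ _ xb)[]|[_ []]].
  move=> /(supp z p z01)[sp|[-> xb]] /(supp z q z01)[sq|[-> xb']].
  + exact: (spread_chain po con (bary_le1 z.2 b) (u0 z z01) (y0 z.2) (cy z.2) (ysum z.2)
      (uQ' z z01)).
  + by left; exact: leb.
  + by right; exact: leb.
  + by left.
- move=> z z01; rewrite /H big_split /=.
  have u0z := u0 z z01; have b1 := bary_le1 z.2 b; rewrite (spread_sum po) //.
  rewrite (bigD1 b) //= eqxx big1 => [|p /negbTE->]; last by rewrite mulr0.
  by rewrite mulr1 addr0; ring.
- move=> p.
  have cc q : continuous (fun z : R * X => z.2 q).
    by move=> z; apply: (@continuous_comp _ _ _ snd (fun w : X => bary w q));
      [exact: cvg_snd|exact: continuous_bary].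
  have ct : continuous (fun z : R * X => z.1) by exact: continuous_time.
  have cst1 : continuous (fun z : R * X => 1 : R) by exact: continuous_real_cst.
  apply: continuous_realD.
    apply: continuous_spread => //; first exact: continuous_realM.
    by move=> q; apply: continuous_realB => //; exact: continuous_dirac.
  apply: continuous_dirac; apply: continuous_realM => //.
  exact: continuous_realB.
- move=> x p; rewrite /H /= mul0r subr0 mul1r spread_trivial //.
  + by rewrite /y subrK.
  + exact: bary_le1.
- move=> x; rewrite /H /= subrr !mul0r addr0.
  apply/eqP; apply: contrapT => /negP nb.
  have := sub (1, x) b; rewrite /= lexx ler01 => /(_ isT nb).
  by rewrite yb eqxx => -[|[_ []]].
Qed.

(** With [s = u = t] the total mass remains 1. At [t = 1/2] the point has become its image under
    [c], and from then on the mass flows to [v]. *)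
Lemma contractible_conical le c v : is_partial_order le ->
  conical le (fun p => le p p) c v -> contractible R (realization R le).
Proof.
move=> po con; pose X := realization R le.
pose H (z : R * X) p := spread le c v z.1 z.1 (fun q => (1 - z.1) * z.2 q) p.
have Hsum (z : R * X) : \sum_q (1 - z.1) * z.2 q = 1 - z.1.
  by rewrite -mulr_sumr realization_sum mulr1.
have H0 (z : R * X) : 0 <= z.1 <= 1 -> forall p, 0 <= (1 - z.1) * z.2 p.
  by case/andP=> _ z1 p; rewrite mulr_ge0 ?subr_ge0 ?bary_ge0.
have Hc (z : R * X) : chain_supported le (fun q => (1 - z.1) * z.2 q).
  move=> p q; rewrite !mulf_eq0 !negb_or => /andP[_ xp] /andP[_ xq].
  exact: (bary_chain z.2).2.
have HQ (z : R * X) : 0 < z.1 -> forall p, (1 - z.1) * z.2 p != 0 -> le p p.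
  by move=> _ p zp; case: (Hc z p p zp zp).
have [||||K [cK KE]] := @realization_homotopy le H.
- by move=> z p z01; case/andP: (z01) => z0 z1; apply: spread_ge0 => //; exact: H0.
- move=> z z01; case/andP: (z01) => z0 z1; apply: (spread_chain po con) => //.
  + exact: H0.
  + exact: HQ.
- by move=> z z01; case/andP: (z01) => z0 z1; rewrite (spread_sum po) // subrK.
- move=> p; have ct : continuous (fun z : R * X => z.1) by exact: continuous_time.
  apply: continuous_spread => // q; apply: continuous_realM.
    by apply: continuous_realB => //; exact: continuous_real_cst.
  by move=> z; apply: (@continuous_comp _ _ _ snd (fun w : X => bary w q));
    [exact: cvg_snd|exact: continuous_bary].
have [x0 x0E] : exists x0 : X, bary x0 = fun p => (p == v)%:R.
  apply: realization_exist => [p|p q|].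
  - exact: ler0n.
  - have pv r : (r == v)%:R != 0 :> R -> r = v.
      by have [//|_] := eqVneq r v; rewrite eqxx.
    by move=> /pv-> /pv->; left; exact: con_vv con.
  - rewrite (bigD1 v) //= eqxx big1 ?addr0 // => p pv.
    by rewrite (negbTE pv).
exists x0; apply/homotopicP; exists K; split=> // x; apply: realization_eq.
  rewrite KE /= clip_id ?lexx ?ler01 //; apply/funext => p.
  rewrite /H /= spread_trivial ?subr0 ?mul1r //.
  + by move=> q; rewrite mul1r bary_ge0.
  + by rewrite -mulr_sumr realization_sum mulr1.
rewrite KE /= clip_id ?lexx ?ler01 // x0E; apply/funext => p.
have lw t q : low le t (fun q => (1 - 1) * x q) q = 0.
  have y0 r : 0 <= (1 - 1) * x r by rewrite subrr mul0r.
  by apply/eqP; rewrite eq_le low_ge0 // andbT (le_trans (low_le _ _ _ _)) // subrr mul0r.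
rewrite /H /spread /= lw big1 => [|q _]; last by rewrite lw subrr mul0r subrr.
rewrite subrr min_r //.
by rewrite mulr0 !add0r subr0 mul1r.
Qed.

End Collapse.

(** * Acyclic matchings *)

Section Morse.
Local Open Scope classical_set_scope.
Local Open Scope ring_scope.
Variables (R : realType) (P : finType) (le : P -> P -> Prop).
Hypotheses (le_po : is_partial_order le) (le_refl : forall p, le p p).
Variables (A : {set P}) (m : P -> P) (p0 : P) (d h : P -> nat).

(* The only critical element is [p0], the potential [h] witnesses acyclicity, and
[am_conical] holds for the boundary of a simplex [m a] without its face [a]. *)
Record acyclic_matching := AcyclicMatching {
  am_cover : forall p, [\/ p = p0, p \in A | exists2 a, a \in A & p = m a];
  am_notin : forall a, a \in A -> m a \notin A;
  am_crit : forall a, a \in A -> a <> p0 /\ m a <> p0;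
  am_min : forall p, le p p0 -> p = p0;
  am_inj : {in A &, injective m};
  am_le : forall a, a \in A -> le a (m a);
  am_dim : forall a, a \in A -> d (m a) = (d a).+1;
  am_mono : forall p q, le p q -> p <> q -> (d p < d q)%N;
  am_acyclic : forall a a', a \in A -> a' \in A -> le a (m a') -> a <> a' ->
    d a = d a' -> (h a' < h a)%N;
  am_conical : forall a, a \in A -> exists c v,
    conical le (fun p => [/\ le p (m a), p <> m a & p <> a]) c v }.

Hypothesis am : acyclic_matching.

Definition restr_le (B : {set P}) p q := [/\ p \in B, q \in B & le p q].

Lemma restr_po B : is_partial_order (restr_le B).
Proof.
case: le_po => tr an rl rr; split=> [p q r [pB qB pq] [_ rB qr]|p q [_ _ pq] [_ _ qp]|p q [pB _ /rl]|p q [_ qB /rr]].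
- by split=> //; exact: tr qr.
- exact: an.
- by split.
- by split.
Qed.

Let span (A' : {set P}) := p0 |: A' :|: m @: A'.

(** The pair removed next has [d a] maximal on [A'] and then [h a] minimal. This makes [m a] the
    only element above [a]: for another [m a'] above it, maximality gives [d a' = d a], and
    acyclicity gives [h a' < h a]. As [span A'] is a lower set, all elements below [m a] are still
    present, as [am_conical] requires. *)
Lemma contractible_span (A' : {set P}) : A' \subset A ->
  (forall p q, le p q -> q \in span A' -> p \in span A') ->
  contractible R (realization R (restr_le (span A'))).
Proof.
have [n] := ubnP #|A'|; elim: n A' => // n IHn A' /ltnSE sz sA down.
have [A'0|[a1 a1A]] := set_0Vmem A'.
  have pE p : p \in span A' -> p = p0.
    by rewrite /span A'0 imset0 finset.setU0 !inE orbF => /eqP.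
  have p0B : p0 \in span A' by rewrite !inE eqxx.
  apply: (@contractible_conical _ _ _ (fun=> p0) p0); first exact: restr_po.
  by split=> // q [/pE-> _ _]; split.
have [a2 a2A max2] := arg_maxnP d a1A.
have {}max2 p : p \in A' -> (d p <= d a2)%N by exact: max2.
have a2P : (a2 \in A') && (d a2 == d a2) by rewrite eqxx andbT.
have [a /andP[aA' /eqP da] min] := arg_minnP (P := [pred x | (x \in A') && (d x == d a2)]) h a2P.
have {}min p : p \in A' -> d p = d a2 -> (h a <= h p)%N.
  by move=> pA' dp; apply: min; rewrite /= pA' dp eqxx.
have aA := fintype.subsetP sA a aA'; set b := m a.
have up p : p \in span A' -> le a p -> p = a \/ p = b.
  move=> pB ap; have [->|/eqP pa] := eqVneq p a; [by left|right].
  have dap : (d a < d p)%N by apply: (am_mono am) => // e; apply: pa.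
  move: pB; rewrite !inE -orbA => /or3P[/eqP pp0|pA'|/imsetP[a' a'A' pE]].
  - by case: (am_crit am aA) => []; rewrite -(am_min am (p := a)) // -pp0.
  - by have := max2 p pA'; rewrite leqNgt -da dap.
  - have a'A := fintype.subsetP sA a' a'A'; rewrite pE.
    have da' : d a' = d a.
      apply/eqP; rewrite eqn_leq {1}da max2 //=.
      by rewrite -ltnS -(am_dim am a'A) -pE.
    have [<-|/eqP aa'] := eqVneq a a'; [by []|exfalso].
    have am' : le a (m a') by rewrite -pE.
    have ha : (h a' < h a)%N by exact: (am_acyclic am aA a'A am' aa' (esym da')).
    by have := min a' a'A'; rewrite da' da leqNgt ha => /(_ erefl).
have ba : b <> a by move=> e; have := am_dim am aA; rewrite -/b e => /n_Sn.
have ab := am_le am aA; rewrite -/b in ab.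
have bB : b \in span A' by rewrite !inE imset_f ?orbT.
have aB : a \in span A' by rewrite !inE aA' orbT.
have top p : p \in span A' -> le b p -> p = b.
  move=> pB bp; have [pa|//] := up p pB (po_trans le_po ab bp).
  by case: ba; apply: (po_anti le_po) => //; rewrite -pa.
have spanE p : p \in span (A' :\ a) = [&& p != a, p != b & p \in span A'].
  apply/idP/and3P => [|[pa pb]].
    rewrite !inE -orbA => /or3P[/eqP->|/andP[pa pA']|/imsetP[a' /setD1P[a'a a'A'] ->]].
    + have [n1 n2] := am_crit am aA.
      by rewrite eqxx; split=> //; apply/eqP => e; [apply: n1|apply: n2].
    + rewrite pa pA' orbT; split=> //; apply: contraTneq pA' => ->.
      by apply: contra (am_notin am aA); exact: fintype.subsetP.
    + have a'A := fintype.subsetP sA a' a'A'.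
      rewrite imset_f ?orbT //; split=> //.
        by apply: contraNneq (am_notin am a'A) => ->.
      by apply: contra_neq a'a; exact: (am_inj am).
  rewrite !inE -!orbA pa => /or3P[->//|->|/imsetP[a' a'A' pE]]; first by rewrite orbT.
  apply/or3P; constructor 3; rewrite pE imset_f // !inE a'A' andbT.
  by apply: contra_neq pb => e; rewrite pE e.
have delE : restr_le (span (A' :\ a)) = del (del (restr_le (span A')) a) b.
  apply/funext => p; apply/funext => q; apply/propext.
  rewrite /del /restr_le !spanE; split.
    by move=> [/and3P[/eqP pa /eqP pb pB] /and3P[/eqP qa /eqP qb qB] pq].
  move=> [/eqP pb /eqP qb [/eqP pa /eqP qa [pB qB pq]]].
  by rewrite pa pb pB qa qb qB.
have {}IHn : contractible R (realization R (del (del (restr_le (span A')) a) b)).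
  rewrite -delE; apply: IHn.
  - by apply: leq_trans sz; rewrite [leqRHS](cardsD1 a) aA' add1n.
  - by apply: fintype.subset_trans sA; exact: subD1set.
  - move=> p q pq; rewrite !spanE => /and3P[qa qb qB]; rewrite (down p q) // andbT.
    apply/andP; split; apply/eqP => e; rewrite e in pq.
      by case: (up q qB pq) => e'; [rewrite e' eqxx in qa|rewrite e' eqxx in qb].
    by rewrite (top q qB pq) eqxx in qb.
apply: (@contractible_del_beat _ _ _ a b); first exact: restr_po.
- by split.
- by move=> e; apply: ba.
- by move=> p [_ pB ap]; case: (up p pB ap) => ->; [left|right; split].
have [c [v [[vb vnb vna] vv cQ cle cge cmono]]] := am_conical am aA.
have QE p : del (restr_le (span A')) a p b /\ p <> b <-> [/\ le p b, p <> b & p <> a].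
  split=> [[[pa _ [_ _ pb]] pnb] //|[pb pnb pa]]; split=> //; split=> //.
  by split=> //; apply: down pb bB.
have QB p : [/\ le p b, p <> b & p <> a] -> p \in span A' /\ p <> a.
  by move=> [pb pnb pa]; split=> //; exact: down pb bB.
apply: (@contractible_del_weak _ _ _ b c v).
- exact/del_po/restr_po.
- by split=> //; split.
- by move=> p [_ pa [_ pB bp]]; exact: top.
- have lift p q : [/\ le p b, p <> b & p <> a] -> [/\ le q b, q <> b & q <> a] ->
      le p q -> del (restr_le (span A')) a p q.
    by move=> /QB[pB pa] /QB[qB qa] pq; split.
  have Qv : [/\ le v b, v <> b & v <> a] by [].
  split; first exact/QE.
  + exact: lift.
  + by move=> q /QE/cQ/QE.
  + by move=> q /QE Qq; apply: lift => //; [exact: cQ|exact: cle].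
  + by move=> q /QE Qq; apply: lift => //; [exact: cQ|exact: cge].
  + move=> q r /QE Qq /QE Qr [_ _ [_ _ qr]].
    by apply: lift; [exact: cQ|exact: cQ|exact: cmono].
- exact: IHn.
Qed.

Theorem contractible_acyclic_matching : contractible R (realization R le).
Proof.
have allB p : p \in span A.
  rewrite !inE; case: (am_cover am p) => [->|->|[a aA ->]]; rewrite ?eqxx ?orbT //.
  by rewrite imset_f ?orbT.
have <- : restr_le (span A) = le.
  apply/funext => p; apply/funext => q; apply/propext; rewrite /restr_le !allB.
  by split=> [[]|].
by apply: contractible_span.
Qed.

End Morse.

(** * Orbit posets of EI-categories *)

Definition is_EI (T : Type) (C : cat_on T) := forall x (f : hom C x x), is_iso f.

Definition all_mono (T : Type) (C : cat_on T) := forall x y z (g : hom C y z) (f f' : hom C x y),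
  cat_comp g f = cat_comp g f' -> f = f'.

Lemma chainM (T : Type) (C : cat_on T) (s : chain C) (i j k : 'I_(clen s).+1)
    (ij : (i <= j)%N) (jk : (j <= k)%N) (ik : (i <= k)%N) :
  cat_comp (fmap s jk) (fmap s ij) = fmap s ik.
Proof. by rewrite -(fmapM s ij jk ik). Qed.

Definition to_top (T : Type) (C : cat_on T) (s : chain C) i : hom C (s i) (s ord_max) :=
  fmap s (leq_ord i : (i <= @ord_max (clen s))%N).
Arguments to_top {T C} s i.

Lemma to_topM (T : Type) (C : cat_on T) (s : chain C) (i j : 'I_(clen s).+1)
    (ij : (i <= j)%N) : cat_comp (to_top s j) (fmap s ij) = to_top s i.
Proof. exact: chainM. Qed.

Section EICategories.
Local Open Scope classical_set_scope.
Local Open Scope ring_scope.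
Variables (T : Type) (C : cat_on T).
Hypothesis ei : is_EI C.

(** Both composites of [f] and [g] are invertible, so [f] has a left and a right inverse. *)
Lemma EI_iso x y (f : hom C x y) (g : hom C y x) : is_iso f.
Proof.
have [u [uP _]] := ei (cat_comp g f); have [v [_ vP]] := ei (cat_comp f g).
exists (cat_comp u g).
have uf : cat_comp (cat_comp u g) f = cat_id C x by rewrite -cat_compA.
split=> //; rewrite -cat_compA in vP.
have -> : cat_comp u g = cat_comp g v.
  by rewrite -[RHS]cat_1comp -uf -cat_compA vP cat_comp1.
exact: vP.
Qed.

(** A map back from [s j] would give one from the object following [s i], and the step between these
    two would be invertible. *)
Lemma chain_no_back (s : chain C) (i j : 'I_(clen s).+1) :
  (i < j)%N -> hom C (s j) (s i) -> False.
Proof.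
move=> ij g; have ki : (i.+1 < (clen s).+1)%N by apply: leq_ltn_trans ij _; exact: ltn_ord.
pose k := Ordinal ki.
have := @cnoniso _ _ s i k (leqnSn i) erefl; apply.
by apply: EI_iso (cat_comp g (fmap s (ij : (k <= j)%N))).
Qed.

(** The components of [f] are isomorphisms, so an index moved in either direction would yield a map
    back along the chain. *)
Lemma sd_map_id (s : chain C) (f : sd_hom s s) : sd_map f = oid _.
Proof.
apply: omap_eq => i; have [g _] := sd_nat_iso f i; apply/val_inj => /=.
case: (ltngtP (sd_map f i) i) => // lt.
  by case: (chain_no_back lt (sd_nat f i)).
by case: (chain_no_back lt g).
Qed.

Lemma subdivision_EI : is_EI (subdivision C).
Proof.
move=> s f; have := sd_map_id f; case: f => a mu iso_mu nat_mu /= ea; subst a.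
pose nu i := projT1 (cid (iso_mu i)).
have nuP i : cat_comp (nu i) (mu i) = cat_id C (s i) /\
    cat_comp (mu i) (nu i) = cat_id C (s i) := projT2 (cid (iso_mu i)).
have nat_nu (i j : 'I_(clen s).+1) (h : (i <= j)%N) :
    cat_comp (nu j) (fmap s h) = cat_comp (fmap s (omono (oid _) h)) (nu i).
  have := nat_mu i j h; rewrite (_ : omono (oid _) h = h) //= => e.
  rewrite -[RHS]cat_1comp -(nuP j).1 -[in RHS]cat_compA.
  by rewrite [cat_comp (mu j) (cat_comp _ _)]cat_compA e -cat_compA (nuP i).2 cat_comp1.
have iso_nu i : is_iso (nu i) by exists (mu i); have [] := nuP i.
exists (SdHom (sd_map := oid _) iso_nu nat_nu).
split; apply: sd_hom_eq; apply: functional_extensionality_dep => i; have [] := nuP i => //.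
Qed.

Definition iso_class_of x : iso_class C := IsoClass (ex_intro _ x erefl).

Lemma isomorphic_refl x : isomorphic C x x.
Proof. by exists (cat_id C x); exact: is_iso_id. Qed.

Lemma isomorphicP x y : isomorphic C x y <-> inhabited (hom C x y) /\ inhabited (hom C y x).
Proof.
split=> [[f [g _]]|[[f] [g]]]; last by exists f; exact: EI_iso g.
by split; constructor.
Qed.

Lemma iso_class_eq (p q : iso_class C) : iso_members p = iso_members q -> p = q.
Proof.
case: p q => [A AP] [B BP] /= e; subst B.
by rewrite (Prop_irrelevance AP BP).
Qed.

Lemma iso_class_ofP (p : iso_class C) : exists x, p = iso_class_of x.
Proof. by case: (iso_classP p) => x e; exists x; exact: iso_class_eq. Qed.

Lemma iso_class_le_of x y :
  iso_class_le (iso_class_of x) (iso_class_of y) <-> inhabited (hom C x y).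
Proof.
split=> [[x' [y' [/= /isomorphicP[[f] _] /isomorphicP[_ [g]] [h]]]]|hxy].
  by constructor; exact: cat_comp g (cat_comp h f).
by exists x, y; split=> //=; exact: isomorphic_refl.
Qed.

Lemma iso_class_of_eq x y : iso_class_of x = iso_class_of y <->
  inhabited (hom C x y) /\ inhabited (hom C y x).
Proof.
rewrite -isomorphicP; split=> [e|/isomorphicP[[f] [g]]].
  have : iso_members (iso_class_of y) y by exact: isomorphic_refl.
  by rewrite -e.
apply: iso_class_eq; apply/seteqP; split=> z /isomorphicP[[h] [k]] /=;
  apply/isomorphicP; split; constructor.
- exact: cat_comp h g.
- exact: cat_comp f k.
- exact: cat_comp h f.
- exact: cat_comp g k.
Qed.

Lemma iso_class_po : is_partial_order (@iso_class_le _ C).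
Proof.
have refl (p : iso_class C) : iso_class_le p p.
  by have [x ->] := iso_class_ofP p; apply/iso_class_le_of; constructor; exact: cat_id.
split=> // [p q r|p q].
  have [[[x ->] [y ->]] [z ->]] := (iso_class_ofP p, iso_class_ofP q, iso_class_ofP r).
  move=> /iso_class_le_of[f] /iso_class_le_of[g]; apply/iso_class_le_of.
  by constructor; exact: cat_comp g f.
have [[x ->] [y ->]] := (iso_class_ofP p, iso_class_ofP q).
by move=> /iso_class_le_of f /iso_class_le_of g; exact/iso_class_of_eq.
Qed.

End EICategories.

(** * Chains as flags of subobjects of a fixed object *)

Section Subobjects.
Local Open Scope classical_set_scope.
Local Open Scope ring_scope.
Variables (T : Type) (C : cat_on T).
Hypotheses (ei : is_EI C) (mono : all_mono C).
Variable Z : T.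

Definition subobject := {x : T & hom C x Z}.

Definition mk_sub x (e : hom C x Z) : subobject := existT _ x e.

Definition sub_le (a b : subobject) := exists h, cat_comp (projT2 b) h = projT2 a.

Lemma sub_le_refl a : sub_le a a.
Proof. by exists (cat_id C _); rewrite cat_comp1. Qed.

Section FromSubobjects.
Variables (n : nat) (X : 'I_n.+1 -> subobject).
Hypothesis X_le : forall i j : 'I_n.+1, (i <= j)%N -> sub_le (X i) (X j).
Hypothesis X_lt : forall i j : 'I_n.+1, j = i.+1 :> nat -> ~ sub_le (X j) (X i).

Let fm (i j : 'I_n.+1) (h : (i <= j)%N) : hom C (projT1 (X i)) (projT1 (X j)) :=
  projT1 (cid (X_le h)).

Let fmE (i j : 'I_n.+1) (h : (i <= j)%N) :
  cat_comp (projT2 (X j)) (fm h) = projT2 (X i).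
Proof. by rewrite /fm; case: cid. Qed.

(** The connecting maps are chosen factorisations; functoriality is their uniqueness, every morphism
    being monic. *)
Definition subobject_functor : ofunctor n C.
Proof.
exists (fun i => projT1 (X i)) fm => [i h|i j k h h' h''].
  by apply: mono (projT2 (X i)) _ _ _; rewrite fmE cat_comp1.
by apply: mono (projT2 (X k)) _ _ _; rewrite fmE cat_compA !fmE.
Defined.

Definition subobject_chain : chain C.
Proof.
exists n subobject_functor => i j h ij [g [_ gP]].
apply: (X_lt ij); exists g; rewrite -(fmE h) -cat_compA.
by rewrite -[RHS]cat_comp1; congr cat_comp.
Defined.

End FromSubobjects.

Definition sub_of (s : chain C) (e : hom C (s ord_max) Z) (i : 'I_(clen s).+1) : subobject :=
  mk_sub (cat_comp e (to_top s i)).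

Lemma sub_of_le s e (i j : 'I_(clen s).+1) : (i <= j)%N -> sub_le (@sub_of s e i) (sub_of e j).
Proof. by move=> ij; exists (fmap s ij); rewrite /= -cat_compA to_topM. Qed.

Lemma sub_of_chain n X Xle Xlt (i : 'I_n.+1) :
  @sub_of (@subobject_chain n X Xle Xlt) (projT2 (X ord_max)) i = X i.
Proof.
rewrite /sub_of /to_top /=; case: cid => h /= ->.
by case: (X i).
Qed.

(** Morphisms in the subdivision come from inclusions of flags. The index map is monotone because
    chains admit no maps back, and naturality can be checked after the monomorphism into [Z]. *)
Lemma sd_hom_of_sub (s t : chain C) (e : hom C (s ord_max) Z) (e' : hom C (t ord_max) Z) :
  (forall i, exists j, sub_le (sub_of e i) (sub_of e' j) /\ sub_le (sub_of e' j) (sub_of e i)) ->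
  inhabited (sd_hom s t).
Proof.
move=> /choice[a aP].
pose mu i := projT1 (cid (aP i).1).
have muP i : cat_comp (projT2 (sub_of e' (a i))) (mu i) = projT2 (sub_of e i) :=
  projT2 (cid (aP i).1).
have bP i := (aP i).2.
have am (i j : 'I_(clen s).+1) : (i <= j)%N -> (a i <= a j)%N.
  move=> ij; rewrite leqNgt; apply/negP => ji; have [g _] := bP i.
  apply: chain_no_back ei _ _ _ ji _.
  exact: cat_comp (mu j) (cat_comp (fmap s ij) g).
constructor; exists (OMap am) mu => [i|i j h].
  by have [g _] := bP i; exact: (EI_iso ei).
apply: mono (projT2 (sub_of e' (a j))) _ _ _.
rewrite cat_compA muP /= -cat_compA to_topM.
rewrite [RHS]cat_compA -[in RHS](cat_compA e') (@to_topM _ _ t _ _ (am i j h)).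
exact: (esym (muP i)).
Qed.

(** A partial converse of [sd_hom_of_sub]: the map from [s] to [Z] cannot be prescribed, it is the
    one induced by [e']. *)
Lemma sub_of_sd_hom (s t : chain C) (f : sd_hom s t) (e' : hom C (t ord_max) Z) :
  let e := cat_comp (projT2 (sub_of e' (sd_map f ord_max))) (sd_nat f ord_max) in
  forall i, sub_le (sub_of e i) (sub_of e' (sd_map f i)) /\
            sub_le (sub_of e' (sd_map f i)) (sub_of e i).
Proof.
move=> e i.
have E : cat_comp (projT2 (sub_of e' (sd_map f i))) (sd_nat f i) = projT2 (sub_of e i).
  rewrite /e /= -[RHS]cat_compA sd_natural [RHS]cat_compA -[in RHS](cat_compA e').
  by rewrite to_topM.
split; first by exists (sd_nat f i).
have [g [gf fg]] := sd_nat_iso f i; exists g.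
by rewrite -E -cat_compA fg cat_comp1.
Qed.

End Subobjects.

Section FiniteTypeFromInjection.
Local Open Scope classical_set_scope.
Local Open Scope ring_scope.
Variables (Q : Type) (D : finType) (code : Q -> D).
Hypothesis code_inj : injective code.

Let decode d : option Q := 
  if pselect (exists q, code q = d) is left e then Some (projT1 (cid e)) else None.

Let codeK : pcancel code decode.
Proof.
move=> q; rewrite /decode; case: pselect => [e|]; last by case; exists q.
by case: cid => q' /= /code_inj ->.
Qed.

(** Realizations are contracted over finite types; classes of chains form one through an injective
    invariant with finitely many values. *)
Definition fin_of : finType :=
  HB.pack Q (Finite.on (pcan_type codeK)).

End FiniteTypeFromInjection.

(** * Categories with an object to which every object maps, uniquely up to its automorphisms *)

Section Terminal.
Local Open Scope classical_set_scope.
Local Open Scope ring_scope.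
Variables (R : realType) (T : Type) (C : cat_on T).
Hypotheses (ei : is_EI C) (mono : all_mono C).
Variables (Z : T) (D : finType) (code : subobject C Z -> D).
Hypotheses (code_inj : injective code) (toZ : forall x, hom C x Z).
Hypothesis transZ : forall x (e f : hom C x Z), exists t, cat_comp t e = f.

Let Q := iso_class (subdivision C).

Let repr (p : Q) : chain C := projT1 (cid (iso_class_ofP p)).

Let reprP (p : Q) : p = iso_class_of (subdivision C) (repr p).
Proof. by rewrite /repr; case: cid. Qed.

Let subs (p : Q) : {set D} :=
  [set code (sub_of (toZ (repr p ord_max)) i) | i : 'I_(clen (repr p)).+1]%SET.

Let subs_inj : injective subs.
Proof.
have sub p q : subs p \subset subs q -> inhabited (sd_hom (repr p) (repr q)).
  move=> pq; apply: (sd_hom_of_sub ei mono (e := toZ _) (e' := toZ _)) => i.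
  have /(fintype.subsetP pq)/imsetP[j _ /code_inj ij] :
    code (sub_of (toZ (repr p ord_max)) i) \in subs p by exact: imset_f.
  by exists j; rewrite ij; split; exact: sub_le_refl.
move=> p q e; rewrite (reprP p) (reprP q).
by apply/(iso_class_of_eq (subdivision_EI ei)); split; apply: sub; rewrite e.
Qed.

Let g0 : chain C.
Proof.
refine (@subobject_chain _ C mono Z 0%N (fun=> mk_sub (cat_id C Z)) _ _).
  by move=> *; exact: sub_le_refl.
by move=> i j ji; have := ltn_ord j; rewrite ji.
Defined.

Let g0_sub i : sub_of (s := g0) (cat_id C Z) i = mk_sub (cat_id C Z).
Proof. exact: (@sub_of_chain _ _ mono Z 0%N (fun=> mk_sub (cat_id C Z))). Qed.

Let join_exists (s : chain C) : exists t : chain C, [/\ inhabited (sd_hom s t),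
  inhabited (sd_hom g0 t) & forall u, inhabited (sd_hom s u) ->
    inhabited (sd_hom g0 u) -> inhabited (sd_hom t u)].
Proof.
pose e := toZ (s ord_max).
(* If the top of [s] is already isomorphic to [Z], then [s] is its own join with [g0]; otherwise [Z]
   is appended. *)
case: (pselect (exists g : hom C Z (s ord_max), cat_comp e g = cat_id C Z)) => [[g eg]|ng].
  exists s; split=> //; first by constructor; exact: sd_id.
  apply: (sd_hom_of_sub ei mono (s := g0) (e := cat_id C Z) (e' := e)) => i.
  exists ord_max; rewrite g0_sub; split; last first.
    by exists e; rewrite /= /to_top fmap1 cat_comp1 cat_1comp.
  by exists g; rewrite /= /to_top fmap1 cat_comp1.
have le_top : sub_le (mk_sub e) (mk_sub (cat_id C Z)).
  by exists e; rewrite /= cat_1comp.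
pose X (i : 'I_(clen s).+2) : subobject C Z :=
  if (i < (clen s).+1)%N then sub_of e (inord i) else mk_sub (cat_id C Z).
have X_le (i j : 'I_(clen s).+2) : (i <= j)%N -> sub_le (X i) (X j).
  rewrite /X; case: (ltnP j) => js ij.
    by rewrite (leq_ltn_trans ij js); apply: sub_of_le; rewrite ?inordK // (leq_ltn_trans ij js).
  case: ltnP => il; last exact: sub_le_refl.
  by exists (projT2 (sub_of e (inord i))); rewrite /= cat_1comp.
have X_lt (i j : 'I_(clen s).+2) : j = i.+1 :> nat -> ~ sub_le (X j) (X i).
  rewrite /X => ji; case: (ltnP j) => js.
    have il : (i < (clen s).+1)%N by apply: ltn_trans js; rewrite ji.
    rewrite il => -[h _]; apply: (chain_no_back ei (s := s) _ h).
    by rewrite !inordK // ji.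
  have ilt : (i < (clen s).+1)%N by rewrite -ltnS -ji.
  rewrite ilt => -[h /= hP]; apply: ng; exists (cat_comp (to_top s (inord i)) h).
  by rewrite cat_compA.
pose t := subobject_chain mono X_le X_lt.
have top i : (i < (clen s).+1)%N -> X (inord i) = sub_of e (inord i).
  by move=> il; rewrite /X inordK ?il // ltnW.
exists t; split.
- apply: (sd_hom_of_sub ei mono (t := t) (e := e) (e' := projT2 (X ord_max))) => i.
  exists (inord i); rewrite sub_of_chain top // inord_val.
  by split; exact: sub_le_refl.
- apply: (sd_hom_of_sub ei mono (s := g0) (t := t) (e := cat_id C Z) (e' := projT2 (X ord_max))) => i.
  exists ord_max; rewrite g0_sub sub_of_chain.
  by rewrite /X /= ltnn; split; exact: sub_le_refl.
move=> u [f] [k]; pose e0 := toZ (u ord_max).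
(* The map from [u] to [Z] is corrected by an automorphism of [Z] so as to restrict to [e] along
   [f]; the flag of [u] then contains that of [s]. *)
have [th thE] := transZ (cat_comp (projT2 (sub_of e0 (sd_map f ord_max))) (sd_nat f ord_max)) e.
pose e1 := cat_comp th e0.
have fE := sub_of_sd_hom f e1; rewrite /= in fE.
have fE1 : cat_comp (cat_comp e1 (to_top u (sd_map f ord_max))) (sd_nat f ord_max) = e.
  by rewrite -thE /e1 /= !cat_compA.
rewrite fE1 in fE.
apply: (sd_hom_of_sub ei mono (s := t) (e := projT2 (X ord_max)) (e' := e1)) => i.
rewrite sub_of_chain /X; case: ltnP => il; first by exists (sd_map f (inord i)); exact: fE.
exists (sd_map k ord_max); split; last first.
  by exists (projT2 (sub_of e1 (sd_map k ord_max))); rewrite /= cat_1comp.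
(* [k] compares [Z] with an object of [u]. The resulting endomorphism [x] of [Z] is invertible, so
   this object gives the whole of [Z] as a subobject. *)
pose x := cat_comp (projT2 (sub_of e1 (sd_map k ord_max))) (sd_nat k ord_max).
have [w [_ xw]] := ei x.
by exists (cat_comp (sd_nat k ord_max) w); rewrite cat_compA.
Qed.

Theorem contractible_orbit_space_terminal : contractible R (orbit_space R C).
Proof.
have po := iso_class_po (subdivision_EI ei).
have leP := iso_class_le_of (subdivision_EI ei).
have refl (p : Q) : iso_class_le p p.
  by rewrite (reprP p); apply/leP; constructor; exact: sd_id.
have /choice[c cP] (p : Q) : exists q : Q, [/\ iso_class_le p q,
    iso_class_le (iso_class_of (subdivision C) g0) q & forall r : Q, iso_class_le p r ->
      iso_class_le (iso_class_of (subdivision C) g0) r -> iso_class_le q r].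
  have [t [st gt tu]] := join_exists (repr p); exists (iso_class_of (subdivision C) t).
  rewrite (reprP p); split; [exact/leP|exact/leP|move=> r].
  by rewrite (reprP r) => /leP su /leP gu; apply/leP; exact: tu.
apply: (@contractible_conical R (fin_of subs_inj) _ c (iso_class_of (subdivision C) g0)).
  exact: po.
split=> //.
- by move=> q _; have [] := cP q.
- by move=> q _; have [] := cP q.
- move=> q r _ _ qr; have [_ _ qmin] := cP q; have [rc gc _] := cP r.
  by apply: qmin => //; exact: (po_trans po) qr rc.
Qed.

End Terminal.

(** * Split Levi subcosets *)

Section LAdicDomain.
Local Open Scope classical_set_scope.
Local Open Scope ring_scope.
Variable l : nat.
Hypothesis l_prime : prime l.

Lemma l_adic_modulus n : (Zp_trunc (l ^ n.+1)).+2 = (l ^ n.+1)%N.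
Proof.
by rewrite Zp_cast // -{1}(exp1n n.+1) ltn_exp2r // prime_gt1.
Qed.

Lemma Zl_val_mod (x : Zl l) j k : (j <= k)%N -> (x j = x k %% l ^ j.+1 :> nat)%N.
Proof.
elim: k => [|k IHk]; first by rewrite leqn0 => /eqP->; rewrite modn_small // -[X in (_ < X)%N]l_adic_modulus.
rewrite leq_eqVlt => /orP[/eqP->|]; first by rewrite modn_small // -[X in (_ < X)%N]l_adic_modulus.
rewrite ltnS => jk; rewrite IHk // (Zl_compat x k) /= (l_adic_modulus k) modn_dvdm //.
exact: dvdn_exp2l.
Qed.

Lemma Zl_neq0 (x : Zl l) : x != 0 -> exists n, forall k, (n <= k)%N ->
  ~~ (l ^ n.+1 %| x k)%N.
Proof.
move=> x0; have [n xn] : exists n, x n != 0.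
  apply/not_existsP => x0'; move/eqP: x0; apply; apply: Zl_inj => n.
  by apply/eqP; apply: contrapT => /negP; exact: x0'.
exists n => k nk; apply: contra xn => d; apply/eqP/val_inj => /=.
by rewrite (Zl_val_mod x nk); apply/eqP.
Qed.

(** From some indices [n] and [m] on, the residues of nonzero [x] and [y] have valuations at most
    [n] and [m]. At index [n + m + 1] the modulus is [l ^ (n + m + 2)], which cannot divide their
    product. *)
Lemma Zl_integral (x y : Zl l) : x * y = 0 -> x = 0 \/ y = 0.
Proof.
move=> xy; have [->|x0] := eqVneq x 0; first by left.
have [->|y0] := eqVneq y 0; first by right.
exfalso; have [n xn] := Zl_neq0 x0; have [m ym] := Zl_neq0 y0.
pose k := (n + m).+1.
have {}xn := xn k (leqW (leq_addr m n)); have {}ym := ym k (leqW (leq_addl n m)).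
have : (l ^ k.+1 %| x k * y k)%N.
  have /(congr1 (fun z : Zl l => val (z k))) /= := xy.
  by move=> h; apply/eqP; rewrite -h; congr modn; exact: esym (l_adic_modulus k).
have xk : (0 < x k)%N by rewrite lt0n; apply: contra xn => /eqP->; rewrite dvdn0.
have yk : (0 < y k)%N by rewrite lt0n; apply: contra ym => /eqP->; rewrite dvdn0.
rewrite pfactor_dvdn ?muln_gt0 ?xk // lognM // => d.
move: xn ym; rewrite !pfactor_dvdn // -!ltnNge !ltnS => xn ym.
by have := leq_trans d (leq_add xn ym); rewrite ltnNge leqnSn.
Qed.

End LAdicDomain.

Section FractionField.
Local Open Scope classical_set_scope.
Local Open Scope ring_scope.

(** The field of fractions, after choosing inverses of units classically. Order polynomials are
    factored over such an extension. *)
Lemma domain_embedding (A : comNzRingType) : (forall x y : A, x * y = 0 -> x = 0 \/ y = 0) ->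
  exists (K : fieldType) (iota : {rmorphism A -> K}), injective iota.
Proof.
move=> dom.
pose unit : pred A := fun x => `[< exists y, y * x = 1 >].
pose inv (x : A) := if pselect (exists y, y * x = 1) is left e then projT1 (cid e) else x.
have mulVx : {in unit, left_inverse 1 inv *%R}.
  move=> x /asboolP e; rewrite /inv; case: pselect => // e'.
  by case: cid.
have unitPl x y : y * x = 1 -> unit x by move=> e; apply/asboolP; exists y.
have invr_out : {in [predC unit], inv =1 id}.
  by move=> x /asboolPn ne; rewrite /inv; case: pselect.
pose UM := GRing.ComNzRing_hasMulInverse.Build A mulVx unitPl invr_out.
pose U : comUnitRingType := HB.pack A UM.
have domU : forall x y : U, x * y = 0 -> (x == 0) || (y == 0).
  by move=> x y /dom[] ->; rewrite eqxx ?orbT.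
pose DM := GRing.ComUnitRing_isIntegral.Build U domU.
pose D : idomainType := HB.pack A UM DM.
pose f : A -> {fraction D} := @tofrac D.
have fz : zmod_morphism f by exact: (@tofrac_is_zmod_morphism D).
have fm : monoid_morphism f by exact: (@tofrac_is_monoid_morphism D).
pose F : {rmorphism A -> {fraction D}} := HB.pack f
  (GRing.isZmodMorphism.Build A {fraction D} f fz)
  (GRing.isMonoidMorphism.Build A {fraction D} f fm).
by exists {fraction D}, F => x y /eqP; rewrite /= /f tofrac_eq => /eqP.
Qed.

End FractionField.

(** * The torus of rank zero *)

Section TrivialTorus.
Local Open Scope classical_set_scope.
Local Open Scope ring_scope.
Variables (l : nat) (G : reflection_coset l).
Hypothesis l_prime : prime l.
Local Notation V := (rc_lat G).
Local Notation W := (rc_grp G).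
Local Notation phi := (rc_phi G).

(** This is the purity of the zero sublattice. The coordinates of [v] multiplied by [c] are
    coordinates of [0], so they vanish by uniqueness. *)
Lemma lattice_torsion_free (c : Zl l) (v : V) : c != 0 -> c *: v = 0 -> v = 0.
Proof.
move=> c0 cv; have [_ [r [b [_ bP]]]] := rc_latP G.
have [a [va _]] := bP v I; have [a0 [_ a0P]] := bP 0 I.
have E0 : a0 = [ffun=> 0].
  by apply: a0P; rewrite big1 // => i _; rewrite ffunE scale0r.
have E1 : a0 = [ffun i => c * a i].
  apply: a0P; rewrite -{1}cv va scaler_sumr; apply: eq_bigr => i _.
  by rewrite ffunE scalerA.
rewrite va big1 // => i _; have : [ffun i => c * a i] i = [ffun=> 0] i by rewrite -E0 -E1.
rewrite !ffunE => /(Zl_integral l_prime)[|->]; last by rewrite scale0r.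
by move=> e; rewrite e eqxx in c0.
Qed.

Lemma weyl1 : W id.
Proof. by have [[_ _ + _ _] _] := rc_grpP G; rewrite restrT. Qed.

Lemma weylM f g : W f -> W g -> W (f \o g).
Proof. by have [[_ _ _ + _] _] := rc_grpP G; apply. Qed.

Lemma weylV f : W f -> exists g, [/\ W g, cancel f g & cancel g f].
Proof.
have [[_ _ _ _ WV] _] := rc_grpP G.
move=> Wf; have [g Wg] := WV f Wf; rewrite restrT => gf.
have [h Wh] := WV g Wg; rewrite restrT => hg.
have fK : cancel f g by move=> x; rewrite -[LHS]/((g \o f) x) gf.
have gK : cancel g h by move=> x; rewrite -[LHS]/((h \o g) x) hg.
by exists g; split=> // x; rewrite -[LHS]gK fK gK.
Qed.

Lemma weyl_lin f : W f -> forall a u v, f (a *: u + v) = a *: f u + f v.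
Proof. by have [[_ WGL _ _ _] _] := rc_grpP G => /WGL[lin _ _ _] a u v; exact: lin. Qed.

Lemma weyl0 f : W f -> f 0 = 0.
Proof.
move=> /weyl_lin lin; have := lin 1 0 0; rewrite !scale1r addr0.
by move=> /(congr1 (fun x => x - f 0)); rewrite subrr addrK => <-.
Qed.

Lemma phi0 : phi 0 = 0.
Proof.
have [lin _ _ _] := rc_phi_GL G; have := lin 1 0 0 I I; rewrite !scale1r addr0.
by move=> /(congr1 (fun x => x - phi 0)); rewrite subrr addrK => <-.
Qed.

Lemma phi_sur : phi @` setT = setT.
Proof. by have [_ sur _ _] := rc_phi_GL G. Qed.

Lemma restr0 (f : V -> V) : f 0 = 0 -> restr [set 0] f = fun=> 0.
Proof. by move=> f0; apply/funext => v; rewrite /restr; case: asboolP => // ->. Qed.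

Definition trivial_torus : refcoset V :=
  Refcoset [set 0] [set restr [set 0] id] [set restr [set 0] (id \o phi)].

Lemma finite_reflection_group_trivial :
  finite_reflection_group [set (0 : V)] [set restr [set 0] id].
Proof.
rewrite restr0 //; split; last first.
  move=> _ ->; exists [::] => //=; first by rewrite restr0.
split=> [||||_ ->].
- exact: finite_set1.
- move=> _ -> /=; split => [*|||] //=.
  + by rewrite scaler0 addr0.
  + by apply/seteqP; split=> [_ [_ _ <-]|_ ->] //; exists 0.
  + by move=> u v -> ->.
- by rewrite restr0.
- by move=> _ _ -> ->.
- by exists (fun=> 0) => //; rewrite restr0.
Qed.

Lemma trivial_torus_subcoset : subcoset trivial_torus (to_coset G).
Proof.
have im0 (f : V -> V) : f 0 = 0 -> f @` [set 0] = [set 0].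
  by move=> f0; rewrite image_set1 f0.
split=> /=.
- split=> //; first by split=> // a u v -> ->; rewrite scaler0 addr0.
  by move=> c v c0 _ /(lattice_torsion_free c0).
- exact: finite_reflection_group_trivial.
- by move=> _ ->; exists id; split=> //; [exact: weyl1|exact: im0].
- have r1 : restr [set 0] (id \o phi) = fun=> 0 by apply: restr0; exact: phi0.
  exists (id \o phi); rewrite r1 restr0 //; split=> //.
  + by exists id; first exact: weyl1.
  + by apply: im0; rewrite /= phi0.
  + by rewrite /normalises !image_set1.
  + by rewrite image_set1.
Qed.

(** The order polynomial is the empty product, the zeroth power of [Phi]: a lattice of rank zero has
    no reflections, which must move a vector, and polynomials in no variables are constants. *)
Lemma trivial_torus_order : order_polynomial trivial_torus 1.
Proof.
have [K [iota iota_inj]] := domain_embedding (Zl_integral l_prime).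
have no0 (i : 'I_0) : False by case: i.
exists K, iota, 0%N, 0%N, (fun=> 0%N), (fun=> 0); split=> //.
- rewrite (_ : [set s | _] = set0).
    by rewrite (_ : `I_0 = set0) //; apply/seteqP; split.
  apply/seteqP; split=> // s /= [-> [_ [v -> vP] _]].
  by apply: vP; rewrite restr0.
- have const (p : mpoly.mpoly 0 K) : p = mpoly.mpolyC 0 (mpoly.mcoeff mpoly.mnm0 p).
    apply/mpoly.mpolyP => m; rewrite mpoly.mcoeffC.
    have -> : m = mpoly.mnm0 by apply/mpoly.mnmP => i; case: (no0 i).
    by rewrite eqxx mulr1.
  exists (fun i => match no0 i with end), (fun i => match no0 i with end); split.
  + split=> [i|_ ->]; first by case: (no0 i).
    exists [ffun=> 0]; split; first by rewrite big_ord0.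
    by move=> a _; apply/ffunP => i; case: (no0 i).
  + by move=> i; case: (no0 i).
  + by move=> c A i; case: (no0 i).
  + by move=> p; rewrite (const p) mpoly.comp_mpolyC.
  + by move=> h _; exists h; rewrite {2}(const h) mpoly.comp_mpolyC -const.
- by rewrite rmorph1 expr0 mul1r big_ord0.
Qed.

End TrivialTorus.

(** * The category of split Levi subcosets *)

Section SplitLevis.
Local Open Scope classical_set_scope.
Local Open Scope ring_scope.
Variables (l : nat) (G : reflection_coset l) (zeta : Zl l).
Hypothesis l_prime : prime l.
Local Notation V := (rc_lat G).
Local Notation W := (rc_grp G).
Local Notation phi := (rc_phi G).
Local Notation levi_cat := (Te G zeta).

Lemma to_coset_subcoset : subcoset (to_coset G) (to_coset G).
Proof.
apply/subTE => //; split=> //; first exact: rc_grpP.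
exists phi; split=> //; first by exists id; first exact: weyl1.
  exact: phi_sur.
exact: rc_phi_norm.
Qed.

Lemma to_coset_levi : subcoset (to_coset G) (to_coset G) /\
  exists2 T, Phi_torus zeta T & is_centraliser T (to_coset G).
Proof.
split; first exact: to_coset_subcoset.
exists (trivial_torus G).
  split; [exact: trivial_torus_subcoset|by []|].
  exists 1, 1, 1, 0%N; rewrite mulr1 expr0 scale1r; split=> //.
  exact: trivial_torus_order.
exists id; first exact: weyl1; split=> //.
  by rewrite image_set1 /= phi0.
rewrite /to_coset; suff -> : [set v | W v /\ forall x, rlat (trivial_torus G) x -> v x = x] = W.
  by [].
by apply/seteqP; split=> [v []//|v Wv]; split=> // x ->; exact: weyl0.
Qed.

Definition whole_levi : split_levi G zeta := SplitLevi to_coset_levi.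

Lemma te_homW (L K : split_levi G zeta) (f : te_hom L K) : W (sval f).
Proof. by case: f => w []. Qed.

Lemma te_compE (L K M : split_levi G zeta) (g : te_hom K M) (f : te_hom L K) :
  sval (te_comp g f) = sval g \o sval f.
Proof. by case: g f => [v [? ?]] [w [? ?]]. Qed.

Lemma te_mono : all_mono levi_cat.
Proof.
move=> L K M g f f' /(congr1 sval); rewrite /= !te_compE => e.
apply: te_hom_eq; have [g' [_ gK _]] := weylV (te_homW g).
apply/funext => x; apply: (can_inj gK); exact: (congr1 (fun h => h x) e).
Qed.

Lemma weyl_finite_order w : W w -> exists n, iter n.+1 w = id.
Proof.
move=> Ww; have [[finW _ _ _ _] _] := rc_grpP G.
have [s sP] := (@finite_seqP {classic V -> V} W).1 finW.
have iterW n : W (iter n w).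
  by elim: n => [|n IHn]; [exact: weyl1|exact: weylM].
have [w' [_ wK _]] := weylV Ww.
pose t : seq {classic V -> V} := [seq iter i w | i <- iota 0 (size s).+1].
have : ~~ uniq t.
  have ts : {subset t <= s} by move=> _ /mapP[i _ ->]; have := iterW i; rewrite sP.
  by apply/negP => /uniq_leq_size/(_ ts); rewrite size_map size_iota ltnn.
move=> /(uniqPn (id : {classic V -> V}))[i [j [ij]]].
rewrite size_map size_iota => js; rewrite !(nth_map 0%N) ?size_iota ?(ltn_trans ij js) //.
rewrite !nth_iota ?(ltn_trans ij js) // !add0n => e.
exists (j - i).-1; rewrite prednK ?subn_gt0 //; apply/funext => x.
have inj k : injective (iter k w).
  by elim: k => // k IHk y z /= /(can_inj wK)/IHk.
by apply: (inj i); rewrite -iterD subnKC ?(ltnW ij) // -[RHS]/(iter i w x) e.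
Qed.

(** The inverse of [f] in the finite group [W] is a power of [f], hence again an endomorphism of
    [L]. *)
Lemma te_EI : is_EI levi_cat.
Proof.
move=> L f; have [n wn] := weyl_finite_order (te_homW f).
pose pw := iter n (te_comp f) (te_id L).
have pwE : sval pw = iter n (sval f).
  rewrite /pw; elim: n {wn pw} => // n IHn; rewrite !iterS te_compE IHn.
  by apply/funext.
exists pw; split; apply: te_hom_eq; rewrite /= te_compE pwE; apply/funext => x /=.
  by rewrite -iterSr wn.
by rewrite -iterS wn.
Qed.

Lemma conj_to_coset w : W w -> conj_coset w (to_coset G) = to_coset G.
Proof.
move=> Ww; have [w' [Ww' wK w'K]] := weylV Ww.
rewrite /conj_coset /to_coset /=; congr Refcoset.
- apply/seteqP; split=> // x _; exists (w' x) => //; exact: w'K.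
- rewrite (conj_funE _ wK w'K); apply/seteqP; split=> [_ [f Wf <-]|f Wf].
    by apply: weylM => //; exact: weylM.
  exists (w' \o (f \o w)); first by apply: weylM => //; exact: weylM.
  by apply/funext => x /=; rewrite w'K w'K.
have nphi u : W u -> exists2 u', W u' & u' \o phi = phi \o u.
  move=> Wu; have : [set phi \o f | f in W] (phi \o u) by exists u.
  by rewrite (rc_phi_norm G) => -[u' Wu' <-]; exists u'.
rewrite (conj_funE _ wK w'K); apply/seteqP; split=> [_ [_ [f Wf <-] <-]|_ [f Wf <-]].
  have [u Wu uE] := nphi w' Ww'; exists (w \o (f \o u)).
    by apply: weylM => //; exact: weylM.
  apply/funext => x /=; congr (w (f _)); exact: (congr1 (fun h => h x) uE).
have [u Wu uE] := nphi w Ww.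
exists ((w' \o (f \o u)) \o phi).
  by exists (w' \o (f \o u)) => //; apply: weylM => //; exact: weylM.
apply/funext => x /=; rewrite w'K; congr f.
by rewrite -[LHS]/((u \o phi) (w' x)) uE /= w'K.
Qed.

Lemma te_to_whole (L : split_levi G zeta) : te_hom L whole_levi.
Proof.
exists id; split; first exact: weyl1.
by rewrite conj_coset1; have [] := leviP L.
Qed.

(** All of [W] stabilises the whole coset, so [t] can be [f] times the inverse of [e]. *)
Lemma te_whole_transitive (L : split_levi G zeta) (e f : te_hom L whole_levi) :
  exists t : te_hom whole_levi whole_levi, te_comp t e = f.
Proof.
have [e' [We' eK e'K]] := weylV (te_homW e).
have Wt : W (sval f \o e') by apply: weylM => //; exact: te_homW.
have tP : W (sval f \o e') /\ subcoset (conj_coset (sval f \o e') whole_levi) whole_levi.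
  by split=> //; rewrite conj_to_coset //; exact: to_coset_subcoset.
exists (exist (fun w => W w /\ subcoset (conj_coset w whole_levi) whole_levi) _ tP).
apply: te_hom_eq; rewrite te_compE /=.
by apply/funext => x /=; rewrite eK.
Qed.

Lemma levi_sub (L : split_levi G zeta) :
  rgrp L `<=` W /\ relts L `<=` [set u \o phi | u in W].
Proof.
case: L => L /= [_ [T _ [w Ww [_ _ ->]]]] /=; split=> [v []//|_ [v [Wv _] <-]].
by exists (v \o w) => //; exact: weylM.
Qed.

Lemma levi_eq (L K : split_levi G zeta) : rgrp L = rgrp K -> relts L = relts K -> L = K.
Proof.
have := levi_lat L; have := levi_lat K.
case: L K => [[L1 L2 L3] LP] [[K1 K2 K3] KP] /= e e1 e2 e3; subst.
by rewrite (Prop_irrelevance LP KP).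
Qed.

Theorem contractible_orbit_space_Te (R : realType) : contractible R (orbit_space R levi_cat).
Proof.
have [[finW _ _ _ _] _] := rc_grpP G.
have [s sP] := (@finite_seqP {classic V -> V} W).1 finW.
pose nt (i : 'I_(size s)) : V -> V := nth (id : {classic V -> V}) s i.
have ntP w : W w -> exists i, nt i = w.
  rewrite sP => /= ws; have ws' : (index (w : {classic V -> V}) s < size s)%N by rewrite index_mem.
  by exists (Ordinal ws'); rewrite /nt /= nth_index.
(* Through the enumeration [nt] of [W], a subobject becomes three sets of indices: the group of [L],
   its coset with [phi] cancelled, and the element of [W] that maps it. *)
pose code (a : subobject levi_cat whole_levi) :=
  ([set i | `[< rgrp (projT1 a) (nt i) >]]%SET,
   [set i | `[< relts (projT1 a) (nt i \o phi) >]]%SET,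
   [set i | `[< nt i = sval (projT2 a) >]]%SET).
have code_inj : injective code.
  move=> [L f] [K g] [/= e1 e2 e3].
  have E1 : rgrp L = rgrp K.
    have mem i : rgrp L (nt i) <-> rgrp K (nt i).
      by apply: asbool_eq_equiv; move/finset.setP/(_ i): e1; rewrite !inE.
    by apply/seteqP; split=> h Hh; have [i ih] := ntP h ((levi_sub _).1 _ Hh);
      rewrite -ih; apply/mem; rewrite ih.
  have E2 : relts L = relts K.
    have mem i : relts L (nt i \o phi) <-> relts K (nt i \o phi).
      by apply: asbool_eq_equiv; move/finset.setP/(_ i): e2; rewrite !inE.
    by apply/seteqP; split=> h Hh; have [u /ntP[i iu] uh] := (levi_sub _).2 _ Hh;
      rewrite -uh -iu; apply/mem; rewrite iu uh.
  have LK := levi_eq E1 E2; subst K; congr existT; apply: te_hom_eq.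
  have [i iE] := ntP _ (te_homW f).
  have : i \in [set i | `[< nt i = sval f >]]%SET by rewrite inE; apply/asboolP.
  by rewrite e3 inE => /asboolP <-.
apply: (@contractible_orbit_space_terminal R _ levi_cat te_EI te_mono whole_levi _ code code_inj).
  exact: te_to_whole.
exact: te_whole_transitive.
Qed.

End SplitLevis.

(** * Chains of centric subgroups *)

Section FusionBasics.
Local Open Scope group_scope.
Import mathcomp.boot.fintype mathcomp.boot.finset.
Variables (gT : finGroupType) (S : {group gT}).
Variable F : {group gT} -> {group gT} -> {set {ffun gT -> gT}}.
Hypothesis fus : fusion_system S F.
Implicit Types (P Q R H K : {group gT}) (f g : {ffun gT -> gT}).

Lemma fusion_hom P Q f : f \in F P Q -> [/\ P \subset S, Q \subset S & injective_hom P Q f].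
Proof. by have [+ _ _ _] := fus; apply. Qed.

(** [conj_map P 1] serves as the inclusion of [P], with value 1 outside. *)
Lemma conj_map1 P x : x \in P -> conj_map P 1 x = x.
Proof. by move=> xP; rewrite ffunE xP invg1 conjg1. Qed.

Lemma fusion_incl P Q : P \subset Q -> Q \subset S -> conj_map P 1 \in F P Q.
Proof.
move=> PQ QS; have [_ + _ _] := fus; apply => //; first exact: subset_trans PQ QS.
by rewrite invg1 conjsg1.
Qed.

Lemma fusion_comp P Q R f g : f \in F P Q -> g \in F Q R -> ffcomp g f \in F P R.
Proof. by have [_ _ + _] := fus; apply. Qed.

Lemma fusion_morph P Q f : f \in F P Q -> exists fm : {morphism P >-> gT},
  [/\ 'injm fm, fm =1 f & forall A : {set gT}, A \subset P -> f @: A = fm @* A].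
Proof.
move=> /fusion_hom[_ _ [fM finj _ _]]; exists (Morphism fM); split=> //.
- by apply/injmP.
- by move=> A AP; rewrite morphimEsub.
Qed.

Lemma fusion1 P Q f : f \in F P Q -> f 1 = 1.
Proof. by move=> /fusion_morph[fm [_ <- _]]; exact: morph1. Qed.

(** Generation makes [img f] total with values in groups; by [imgE] it is the plain image on
    subgroups of the domain of a morphism. *)
Definition img f Q : {group gT} := generated_group (f @: Q).

Lemma imgE P R f Q : f \in F P R -> Q \subset P -> img f Q = f @: Q :> {set gT}.
Proof. by move=> /fusion_morph[fm [_ _ fE]] QP; rewrite /= fE // genGid. Qed.

Lemma img_sub P R f Q : f \in F P R -> Q \subset P -> img f Q \subset R.
Proof.
move=> fF QP; rewrite (imgE fF QP); apply/subsetP => _ /imsetP[x xQ ->].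
by have [_ _ [_ _ fR _]] := fusion_hom fF; apply: fR; exact: (subsetP QP).
Qed.

Lemma mem_img P R f Q x : f \in F P R -> Q \subset P -> x \in P ->
  (f x \in img f Q) = (x \in Q).
Proof.
move=> fF QP xP; rewrite (imgE fF QP); apply/imsetP/idP => [[y yQ e]|xQ]; last by exists x.
by have [_ _ [_ finj _ _]] := fusion_hom fF; rewrite (finj x y xP (subsetP QP y yQ) e).
Qed.

Lemma card_img P R f Q : f \in F P R -> Q \subset P -> #|img f Q| = #|Q|.
Proof.
move=> fF QP; rewrite (imgE fF QP) card_in_imset // => x y xQ yQ.
by have [_ _ [_ finj _ _]] := fusion_hom fF; apply: finj; exact: (subsetP QP).
Qed.

Lemma img_subset P R f Q Q' : f \in F P R -> Q \subset P -> Q' \subset P ->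
  (img f Q \subset img f Q') = (Q \subset Q').
Proof.
move=> fF QP Q'P; have [fm [inj _ fE]] := fusion_morph fF.
by rewrite !(imgE fF) // !fE // injmSK.
Qed.

Lemma img_inj P R f Q Q' : f \in F P R -> Q \subset P -> Q' \subset P ->
  img f Q = img f Q' -> Q = Q'.
Proof.
move=> fF QP Q'P e; apply/val_inj/eqP; rewrite eqEsubset.
by rewrite -(img_subset fF QP Q'P) -(img_subset fF Q'P QP) e subxx.
Qed.

Lemma img_norm P R f Q x : f \in F P R -> Q \subset P -> x \in P ->
  (f x \in 'N(img f Q)) = (x \in 'N(Q)).
Proof.
move=> fF QP xP; have [fm [inj fmE fE]] := fusion_morph fF.
rewrite (imgE fF QP) fE // -fmE.
have e := injm_subnorm inj P QP.
have -> : (fm x \in 'N(fm @* Q)) = (fm x \in 'N_(fm @* P)(fm @* Q)).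
  by rewrite in_setI (mem_morphim fm xP xP).
rewrite -e; apply/idP/idP => [/morphimP[y yP /setIP[_ yN] xy]|xN]; last first.
  by rewrite mem_morphim // in_setI xP.
by rewrite (injmP inj x y xP yP xy).
Qed.

Lemma img_normal P R f Q Q' : f \in F P R -> Q \subset P -> Q' \subset P ->
  (img f Q <| img f Q') = (Q <| Q').
Proof.
move=> fF QP Q'P; have [fm [inj _ fE]] := fusion_morph fF.
rewrite !/(_ <| _) (img_subset fF) //; congr andb.
apply/subsetP/subsetP => n x.
  move=> xQ; rewrite -(img_norm fF QP (subsetP Q'P x xQ)); apply: n.
  by rewrite (imgE fF Q'P) imset_f.
rewrite (imgE fF Q'P) => /imsetP[y yQ ->].
by rewrite (img_norm fF QP) ?(subsetP Q'P) // n.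
Qed.

Lemma img_comp f g Q P R R' : f \in F P R -> g \in F R R' -> Q \subset P ->
  img (ffcomp g f) Q = img g (img f Q).
Proof.
move=> fF gF QP; apply/val_inj; rewrite /= -/(img f Q).
rewrite (imgE fF QP) -imset_comp; congr <<_>>; apply: eq_imset => x.
by rewrite ffunE.
Qed.

Lemma img_incl P Q : Q \subset P -> img (conj_map P 1) Q = Q.
Proof.
move=> QP; apply/val_inj; rewrite /=.
have -> : conj_map P 1 @: Q = Q; last by rewrite genGid.
by apply/setP => x; apply/imsetP/idP => [[y yQ ->]|xQ];
  [|exists x]; rewrite ?conj_map1 ?(subsetP QP).
Qed.

Definition frestr P f : {ffun gT -> gT} := [ffun x => if x \in P then f x else 1].

Lemma img_frestr P Q f : Q \subset P -> img (frestr P f) Q = img f Q.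
Proof.
move=> QP; apply/val_inj; rewrite /=; congr <<_>>.
by apply: eq_in_imset => x xQ; rewrite ffunE (subsetP QP).
Qed.

(** The last axiom of fusion systems gives [f] as a morphism onto its image; an inclusion is then
    composed with it. *)
Lemma fusion_corestrict P Q R f : f \in F P Q -> img f P \subset R -> R \subset S -> f \in F P R.
Proof.
move=> fF fR RS; have [_ _ _ /(_ P Q f fF)[R' [R'E fR' _]]] := fus.
have R'R : R' \subset R by rewrite -R'E -(imgE fF (subxx P)).
have := fusion_comp fR' (fusion_incl R'R RS).
rewrite (_ : ffcomp _ f = f) //; apply/ffunP => x; rewrite ffunE.
have [_ _ [_ _ fim f1]] := fusion_hom fR'.
have [xP|xP] := boolP (x \in P); first by rewrite conj_map1 ?fim.
by rewrite f1 // conj_map1.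
Qed.

Lemma fusion_restrict P Q P' R f : f \in F P Q -> P' \subset P -> img f P' \subset R ->
  R \subset S -> frestr P' f \in F P' R.
Proof.
move=> fF P'P fR RS; have [PS _ _] := fusion_hom fF.
have h := fusion_comp (fusion_incl P'P PS) fF.
have e : ffcomp f (conj_map P' 1) = frestr P' f.
  apply/ffunP => x; rewrite !ffunE; case: ifP => _; last exact: fusion1 fF.
  by rewrite invg1 conjg1.
rewrite e in h; apply: fusion_corestrict h _ RS.
by rewrite img_frestr.
Qed.

Lemma fusion_inverse P Q f : f \in F P Q -> exists g, [/\ g \in F (img f P) P,
  {in P, cancel f g}, {in img f P, cancel g f} & forall H, H \subset P -> img g (img f H) = H].
Proof.
move=> fF; have [_ _ _ /(_ P Q f fF)[R [RE fR [g gF gf]]]] := fus.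
have RI : R = img f P by apply/val_inj; rewrite /= -/(img f P) (imgE fF) // RE.
have fK : {in P, cancel f g}.
  by move=> x xP; have /ffunP/(_ x) := gf; rewrite ffunE conj_map1.
rewrite -RI; exists g; split=> //.
- by move=> y; rewrite -RE => /imsetP[x xP ->]; rewrite fK.
- move=> H HP; rewrite -(img_comp fR gF HP) gf.
  exact: img_incl.
Qed.

Lemma F_conjugate_trans P Q R : F_conjugate F P Q -> F_conjugate F Q R -> F_conjugate F P R.
Proof.
move=> [f fF fPQ] [g gF gQR]; exists (ffcomp g f); first exact: fusion_comp gF.
rewrite -gQR -fPQ -imset_comp; apply: eq_imset => x; by rewrite ffunE.
Qed.

Lemma F_conjugate_img P R f Q : f \in F P R -> Q \subset P -> F_conjugate F Q (img f Q).
Proof.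
move=> fF QP; have [_ RS _] := fusion_hom fF.
exists (frestr Q f).
  by apply: (fusion_restrict fF QP) => //; exact: subset_trans (img_sub fF QP) RS.
rewrite (imgE fF QP); apply: eq_in_imset => x xQ; by rewrite ffunE xQ.
Qed.

Lemma centric_img P R f Q : f \in F P R -> Q \subset P -> centric S F Q -> centric S F (img f Q).
Proof.
move=> fF QP [_ cQ]; have [_ RS _] := fusion_hom fF; split.
  exact: subset_trans (img_sub fF QP) RS.
by move=> K QK; apply: cQ; apply: F_conjugate_trans (F_conjugate_img fF QP) QK.
Qed.

(** A conjugate of [Q] contains a conjugate of [P], which already contains its own centraliser. *)
Lemma centric_over P Q : centric S F P -> P \subset Q -> Q \subset S -> centric S F Q.
Proof.
move=> [PS cP] PQ QS; split=> // K [f fF fQK].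
have fP : img f P \subset K by exact: img_sub fF PQ.
apply: subset_trans (setIS _ (centS fP)) _.
by apply: subset_trans fP; apply: cP; exact: F_conjugate_img fF PQ.
Qed.

Lemma centric_whole : centric S F S.
Proof.
split=> // Q [f fF fSQ]; have [_ QS _] := fusion_hom fF.
have -> : Q = S; last exact: subsetIl.
have QE : img f S = Q by apply/val_inj; rewrite /= -/(img f S) (imgE fF).
by apply/val_inj/eqP; rewrite eqEcard QS -QE (card_img fF (subxx S)) leqnn.
Qed.

End FusionBasics.

(** * Inserting a normaliser into a chain *)

Section SubgroupChains.
Local Open Scope group_scope.
Import mathcomp.boot.fintype mathcomp.boot.finset.
Variables (l : nat) (gT : finGroupType) (S : {group gT}).
Variable F : {group gT} -> {group gT} -> {set {ffun gT -> gT}}.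
Hypothesis fus : fusion_system S F.
Hypothesis lS : l.-group S.
Implicit Types (P Q R H K T : {group gT}) (f g : {ffun gT -> gT}) (A B D : {set {group gT}}).

Definition tot A := {in A &, forall Q R, (Q \subset R) || (R \subset Q)}.

Definition subgroup_chain A :=
  [/\ A != set0, forall Q, Q \in A -> centric S F Q & tot A].

Definition top A := odflt 1%G [pick T in A | [forall Q in A, Q \subset (T : {group gT})]].
(** The default [S] is the value [ambient] must take when every member of the chain is in the normal
    part. *)
Definition bot A := odflt S [pick T in A | [forall Q in A, (T : {group gT}) \subset (Q : {group gT})]].

(** In the notation of the overview, this is [Q_0, ..., Q_k], and below [ambient A] is [H], [stab A]
    is [N] and [ntop A] is [Q_k]. The condition passes to smaller members by [normal_part_down], so
    it cuts out an initial segment. *)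
Definition normal_part A :=
  [set Q in A | [forall R in A, ((R : {group gT}) \subset Q) ==> (R <| Q)]].

Definition ambient A := bot (A :\: normal_part A).

Definition stab A : {group gT} := (ambient A :&: \bigcap_(Q in normal_part A) 'N(Q))%G.

Definition ntop A := top (normal_part A).

Definition plus A := stab A |: A.

Lemma tot_card A Q R : tot A -> Q \in A -> R \in A -> (#|Q| <= #|R|)%N -> Q \subset R.
Proof.
move=> tA QA RA QR; case/orP: (tA Q R QA RA) => // RQ.
have /eqP -> : Q :==: R; last by [].
by rewrite eq_sym eqEcard RQ.
Qed.

Lemma tot_card_inj A Q R : tot A -> Q \in A -> R \in A -> #|Q| = #|R| -> Q = R.
Proof.
move=> tA QA RA QR; apply/val_inj/eqP; rewrite eqEsubset.
by rewrite !(tot_card tA) ?QR.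
Qed.

Lemma tot_sub A B : B \subset A -> tot A -> tot B.
Proof. by move=> /subsetP BA tA Q R /BA QA /BA RA; exact: tA. Qed.

Lemma top_eq A T : T \in A -> (forall Q, Q \in A -> Q \subset T) -> top A = T.
Proof.
move=> TA maxT; rewrite /top; case: pickP => [T' /andP[T'A /forall_inP maxT']|]; last first.
  by move=> /(_ T); rewrite /= TA /= => /forall_inPn[Q /maxT ->].
by apply/val_inj/eqP; rewrite eqEsubset /= maxT // maxT'.
Qed.

Lemma topP A : tot A -> A != set0 -> top A \in A /\ forall Q, Q \in A -> Q \subset top A.
Proof.
move=> tA /set0Pn[Q0 Q0A].
have [T TA maxT] := arg_maxnP (fun Q : {group gT} => #|Q|) Q0A.
have {}maxT Q : Q \in A -> Q \subset T.
  by move=> QA; apply: (tot_card tA) => //; exact: maxT.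
by rewrite (top_eq TA maxT).
Qed.

Lemma bot_eq A T : T \in A -> (forall Q, Q \in A -> T \subset Q) -> bot A = T.
Proof.
move=> TA minT; rewrite /bot; case: pickP => [T' /andP[T'A /forall_inP minT']|]; last first.
  by move=> /(_ T); rewrite /= TA /= => /forall_inPn[Q /minT ->].
by apply/val_inj/eqP; rewrite eqEsubset /= minT // minT'.
Qed.

Lemma botP A : tot A -> A != set0 -> bot A \in A /\ forall Q, Q \in A -> bot A \subset Q.
Proof.
move=> tA /set0Pn[Q0 Q0A].
have [T TA minT] := arg_minnP (fun Q : {group gT} => #|Q|) Q0A.
have {}minT Q : Q \in A -> T \subset Q.
  by move=> QA; apply: (tot_card tA) => //; exact: minT.
by rewrite (bot_eq TA minT).
Qed.

Lemma bot_set0 : bot set0 = S.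
Proof. by rewrite /bot; case: pickP => // T; rewrite inE. Qed.

Lemma normal_partP A Q : reflect (Q \in A /\ forall R, R \in A -> R \subset Q -> R <| Q)
  (Q \in normal_part A).
Proof.
rewrite inE; apply: (iffP andP) => -[QA].
  by move=> /forall_inP n; split=> // R RA RQ; move: (n R RA); rewrite RQ.
by move=> n; split=> //; apply/forall_inP => R RA; apply/implyP; exact: n.
Qed.

Lemma normal_part_sub A : normal_part A \subset A.
Proof. by apply/subsetP => Q /normal_partP[]. Qed.

Lemma normal_part_down A Q R : Q \in normal_part A -> R \in A -> R \subset Q ->
  R \in normal_part A.
Proof.
move=> /normal_partP[QA n] RA RQ; apply/normal_partP; split=> // K KA KR.
by apply: (normalS KR RQ); apply: n => //; exact: subset_trans KR RQ.
Qed.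

Lemma normal_part_subset A B : B \subset A -> B :&: normal_part A \subset normal_part B.
Proof.
move=> /subsetP BA; apply/subsetP => Q /setIP[QB /normal_partP[_ n]].
by apply/normal_partP; split=> // R /BA; exact: n.
Qed.

Lemma normal_part_neq0 A : tot A -> A != set0 -> normal_part A != set0.
Proof.
move=> tA A0; have [bA bmin] := botP tA A0; apply/set0Pn; exists (bot A).
apply/normal_partP; split=> // R RA Rb.
have -> : R = bot A by apply/val_inj/eqP; rewrite eqEsubset Rb bmin.
exact: normal_refl.
Qed.

Lemma stabP A x : reflect (x \in ambient A /\ forall Q, Q \in normal_part A -> x \in 'N(Q))
  (x \in stab A).
Proof.
apply: (iffP setIP) => -[xa].
  by move=> /bigcapP n; split.
by move=> n; split=> //; apply/bigcapP.
Qed.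

Section OneChain.
Variable A : {set {group gT}}.
Hypothesis cA : subgroup_chain A.

Let A0 : A != set0. Proof. by case: cA. Qed.
Let tA : tot A. Proof. by case: cA. Qed.
Let cenA Q : Q \in A -> centric S F Q. Proof. by case: cA => _ + _; apply. Qed.

Lemma chain_subS Q : Q \in A -> Q \subset S.
Proof. by case/cenA. Qed.

Lemma ambient_normal : normal_part A = A -> ambient A = S.
Proof. by rewrite /ambient => ->; rewrite setDv bot_set0. Qed.

Lemma ambientP : normal_part A != A ->
  [/\ ambient A \in A, ambient A \notin normal_part A &
      forall Q, Q \in A -> Q \notin normal_part A -> ambient A \subset Q].
Proof.
move=> nn; have D0 : A :\: normal_part A != set0.
  by rewrite setD_eq0; apply: contra nn => s; rewrite eqEsubset normal_part_sub.
have [] := botP (tot_sub (subsetDl A (normal_part A)) tA) D0.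
rewrite -/(ambient A) => /setDP[aA an] amin; split=> // Q QA Qn.
by apply: amin; rewrite inE Qn.
Qed.

Lemma normal_part_ambient Q : Q \in normal_part A -> Q \subset ambient A.
Proof.
move=> Qn; have QA := subsetP (normal_part_sub A) Q Qn.
have [e|nn] := eqVneq (normal_part A) A; first by rewrite ambient_normal // chain_subS.
have [aA an _] := ambientP nn; case/orP: (tA QA aA) => // aQ.
by rewrite (normal_part_down Qn aA aQ) in an.
Qed.

Lemma ambient_S : ambient A \subset S.
Proof.
have [e|nn] := eqVneq (normal_part A) A; first by rewrite ambient_normal.
by have [aA _ _] := ambientP nn; exact: chain_subS.
Qed.

Lemma stab_ambient : stab A \subset ambient A.
Proof. exact: subsetIl. Qed.

Lemma stab_S : stab A \subset S.
Proof. exact: subset_trans stab_ambient ambient_S. Qed.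

Lemma ntopP : ntop A \in normal_part A /\ forall Q, Q \in normal_part A -> Q \subset ntop A.
Proof.
apply: topP; last exact: normal_part_neq0.
exact: tot_sub (normal_part_sub A) tA.
Qed.

Lemma ntop_in : ntop A \in A.
Proof. by have [/(subsetP (normal_part_sub A))] := ntopP. Qed.

Lemma ntop_stab : ntop A \subset stab A.
Proof.
have [tn tmax] := ntopP; apply/subsetP => x xt; apply/stabP; split.
  exact: (subsetP (normal_part_ambient tn)).
move=> Q Qn; have /normal_partP[_ n] := tn.
have /normal_norm/subsetP/(_ x xt) := n Q (subsetP (normal_part_sub A) Q Qn) (tmax Q Qn).
by [].
Qed.

Lemma normal_part_stab Q : Q \in normal_part A -> Q <| stab A.
Proof.
move=> Qn; have [_ tmax] := ntopP; apply/andP; split.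
  exact: subset_trans (tmax Q Qn) ntop_stab.
by apply/subsetP => x /stabP[_]; apply.
Qed.

(** If [ambient A] normalised the whole initial segment, it would belong to it. *)
Lemma stab_neq_ambient : normal_part A != A -> stab A <> ambient A.
Proof.
move=> nn e; have [aA an amin] := ambientP nn; case/negP: an.
apply/normal_partP; split=> // R RA Ra.
have [Rn|Rn] := boolP (R \in normal_part A); first by rewrite -e normal_part_stab.
have -> : R = ambient A by apply/val_inj/eqP; rewrite eqEsubset Ra amin.
exact: normal_refl.
Qed.

Lemma stab_upper Q : Q \in A -> Q \notin normal_part A -> stab A \proper Q.
Proof.
move=> QA Qn; have nn : normal_part A != A by apply: contra Qn => /eqP->.
have [_ _ amin] := ambientP nn; apply: proper_sub_trans (amin Q QA Qn).
rewrite properEneq stab_ambient andbT; apply/eqP => e.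
by apply: (stab_neq_ambient nn); apply/val_inj.
Qed.

(** Members outside the initial segment contain [stab A] properly, and those inside it are contained
    in [ntop A]. *)
Lemma stab_in : stab A \in A -> stab A = ntop A.
Proof.
move=> sA; have [sn|sn] := boolP (stab A \in normal_part A).
  have [_ tmax] := ntopP; apply/val_inj/eqP; rewrite eqEsubset tmax //.
  exact: ntop_stab.
by have := stab_upper sA sn; rewrite properxx.
Qed.

Lemma centric_stab : centric S F (stab A).
Proof. exact: (centric_over fus (cenA ntop_in) ntop_stab stab_S). Qed.

Lemma plus_chain : subgroup_chain (plus A).
Proof.
split.
- by apply/set0Pn; exists (stab A); rewrite setU11.
- by move=> Q /setU1P[->|/cenA//]; exact: centric_stab.
have cmp Q : Q \in A -> (Q \subset stab A) || (stab A \subset Q).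
  move=> QA; have [Qn|Qn] := boolP (Q \in normal_part A).
    by rewrite (normal_sub (normal_part_stab Qn)).
  by rewrite (proper_sub (stab_upper QA Qn)) orbT.
move=> Q R /setU1P[->|QA] /setU1P[->|RA].
- by rewrite subxx.
- by rewrite orbC cmp.
- exact: cmp.
- exact: tA.
Qed.

(** The inserted group normalises the old segment and becomes its top. Hence insertion changes
    neither [ambient] nor [stab], and afterwards [stab] and [ntop] agree, which marks the upper
    element of a pair. *)
Lemma normal_part_plus : normal_part (plus A) = stab A |: normal_part A.
Proof.
have [tn tmax] := ntopP.
apply/setP => Q; apply/normal_partP/setU1P => [[/setU1P[->|QA] n]|[->|Qn]].
- by left.
- right; apply/normal_partP; split=> // R RA; apply: n.
  by rewrite setU1r.
- split; first exact: setU11.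
  move=> R /setU1P[->|RA] Rs; first exact: normal_refl.
  have [/normal_part_stab//|Rn] := boolP (R \in normal_part A).
  by have := proper_sub_trans (stab_upper RA Rn) Rs; rewrite properxx.
- have /normal_partP[QA n] := Qn; split; first exact: setU1r.
  move=> R /setU1P[-> sQ|]; last exact: n.
  have -> : stab A = Q; last exact: normal_refl.
  apply/val_inj/eqP; rewrite eqEsubset sQ /=.
  exact: subset_trans (tmax Q Qn) ntop_stab.
Qed.

Lemma ntop_plus : ntop (plus A) = stab A.
Proof.
apply: top_eq; rewrite normal_part_plus; first exact: setU11.
by move=> Q /setU1P[->//|/normal_part_stab/normal_sub].
Qed.

Lemma plusD : plus A :\: normal_part (plus A) = A :\: normal_part A.
Proof.
rewrite normal_part_plus; apply/setP => Q; rewrite !in_setD !in_setU1.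
have [->|] //= := eqVneq Q (stab A); rewrite andbC.
have [sA|] //= := boolP (stab A \in A).
by rewrite (stab_in sA); have [-> _] := ntopP.
Qed.

Lemma stab_plus : stab (plus A) = stab A.
Proof.
have aE : ambient (plus A) = ambient A by rewrite /ambient plusD.
apply/val_inj/setP => x; apply/stabP/stabP; rewrite aE normal_part_plus => -[xa n].
  by split=> // Q Qn; apply: n; rewrite setU1r.
split=> // Q /setU1P[->|]; last exact: n.
by apply: (subsetP (normG _)); apply/stabP.
Qed.

Lemma plus_normal : (normal_part (plus A) == plus A) = (normal_part A == A).
Proof.
have nE B : (normal_part B == B) = (B :\: normal_part B == set0).
  by rewrite setD_eq0 eqEsubset normal_part_sub.
by rewrite !nE plusD.
Qed.

Lemma ntop_lt_stab : stab A <> ntop A -> ntop A \proper stab A.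
Proof.
move=> ne; rewrite properEneq ntop_stab andbT; apply/eqP => e.
by apply: ne; apply/val_inj.
Qed.

Lemma normalizer_grows H K : K \subset S -> H \proper K -> H \proper 'N_K(H).
Proof.
move=> KS HK; apply: nilpotent_proper_norm HK.
exact: pgroup_nil (pgroupS KS lS).
Qed.

(** The growth of [Q_k] along gradient paths. As [stab A] is not in [A], it differs from [Q] and
    stays in the initial segment of the remaining chain; it is strictly larger than [ntop A]. *)
Lemma ntop_plusD1 Q : stab A <> ntop A -> Q \in A ->
  plus A :\ Q != set0 -> (#|ntop A| < #|ntop (plus A :\ Q)|)%N.
Proof.
move=> ne QA D0; apply: leq_trans (proper_card (ntop_lt_stab ne)) _; apply: subset_leq_card.
have sub := subsetDl (plus A) [set Q]; have [_ _ tP] := plus_chain.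
have [_] := @topP (normal_part (plus A :\ Q))
  (tot_sub (normal_part_sub _) (tot_sub sub tP))
  (normal_part_neq0 (tot_sub sub tP) D0).
apply; apply: (subsetP (normal_part_subset sub)).
rewrite in_setI in_setD1 normal_part_plus // [X in _ && X]setU11 [stab A \in plus A]setU11 !andbT.
by apply: contraPneq QA => <- /stab_in.
Qed.

End OneChain.

Section DropTop.
Variable A : {set {group gT}}.
Hypotheses (cA : subgroup_chain A) (sA : stab A = ntop A).
Let T := ntop A.
Let D := A :\ T.

Let tA : tot A. Proof. by case: cA. Qed.
Let TA : T \in A. Proof. exact: ntop_in. Qed.

Lemma drop_chain : D != set0 -> subgroup_chain D.
Proof.
move=> D0; split=> //; last exact: tot_sub (subsetDl _ _) tA.
by move=> Q /setD1P[_]; case: cA => _ + _; apply.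
Qed.

(** Here [stab A] is the normaliser of [T] in [S], which is larger than [T] unless [T = S]. *)
Lemma stab_top_single : A = [set T] -> A = [set S].
Proof.
move=> AT; have nA : normal_part A = A.
  apply/eqP; rewrite eqEsubset normal_part_sub /= AT sub1set.
  by have [] := ntopP cA; rewrite -/T AT.
have TE : T = S; last by rewrite AT TE.
apply/val_inj/eqP; apply: contrapT => /negP TS.
have /normalizer_grows : T \proper S by rewrite properEneq TS (chain_subS cA TA).
move=> /(_ (subxx S)); suff -> : 'N_S(T) = stab A :> {set gT} by rewrite sA properxx.
apply/setP => x; apply/setIP/stabP; rewrite ambient_normal // nA => -[xS n]; split=> //.
  by move=> Q; rewrite AT => /set1P->.
exact: n.
Qed.

Lemma drop_neq0 : A <> [set S] -> D != set0.
Proof.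
move=> AS; apply/negP => /eqP D0; apply/AS/stab_top_single/eqP.
by rewrite eqEsubset sub1set TA andbT -setD_eq0 -/D D0.
Qed.

Section NonNormal.
Hypothesis nn : normal_part A != A.
Let U := ambient A.

Let TU : T \proper U.
Proof.
have [UA Un _] := ambientP cA nn; rewrite -/U in UA Un.
by rewrite /T -sA; exact: stab_upper.
Qed.

Let UT : ambient A != T.
Proof. by rewrite -/U; apply: contraTneq TU => ->; rewrite properxx. Qed.

(** Otherwise the normaliser of [T] in [U] would lie in [stab A], which is [T], against the growth
    of normalisers. This keeps [U] from joining the initial segment once [T] is removed. *)
Let no_norm : (forall Q, Q \in normal_part A -> Q != T -> U \subset 'N(Q)) -> False.
Proof.
move=> n; have := normalizer_grows (ambient_S cA) TU.
suff -> : 'N_U(T) = T by rewrite properxx.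
apply/eqP; rewrite eqEsubset subsetI (proper_sub TU) normG !andbT.
apply/subsetP => x /setIP[xU xT]; rewrite -[gval T]/(gval (ntop A)) -sA; apply/stabP; split=> // Q Qn.
have [->//|QT] := eqVneq Q T.
exact: (subsetP (n Q Qn QT)).
Qed.

Lemma ambient_not_dropped : U \notin normal_part D.
Proof.
apply/negP => /normal_partP[_ n]; apply: no_norm => Q Qn QT.
apply/normal_norm/n; last exact: normal_part_ambient.
by rewrite !inE QT (subsetP (normal_part_sub A)).
Qed.

Lemma drop_normal_part : normal_part D = normal_part A :\ T.
Proof.
have [UA Un amin] := ambientP cA nn.
apply/setP => Q; apply/idP/setD1P => [Qn|[QT Qn]]; last first.
  apply: (subsetP (normal_part_subset (subsetDl _ _))).
  by rewrite in_setI in_setD1 QT Qn (subsetP (normal_part_sub A)).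
have /setD1P[QT QA] := subsetP (normal_part_sub D) Q Qn; split=> //.
apply: contrapT => /negP Qn'; case/negP: ambient_not_dropped.
apply: normal_part_down Qn _ (amin Q QA Qn').
by rewrite in_setD1 UA UT.
Qed.

Let ambient_drop : ambient D = ambient A.
Proof.
rewrite /ambient drop_normal_part; congr bot; apply/setP => Q; rewrite !in_setD !in_set1.
have [->|//] := eqVneq Q T; rewrite andbF /=.
by have [-> _] := ntopP cA.
Qed.

Lemma drop_nonnormal : normal_part D != D.
Proof.
apply/negP => /eqP e; case/negP: ambient_not_dropped; rewrite e in_setD1.
by have [-> _ _] := ambientP cA nn; rewrite UT.
Qed.

(** Both groups are cut out in the same ambient group, so the normaliser of [T] in [stab D] is
    contained in [stab A = T]; growth of normalisers gives equality. *)
Lemma drop_stab : stab D = T.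
Proof.
have TsD : T \subset stab D.
  rewrite /T -sA; apply/subsetP => x /stabP[xa n]; apply/stabP; rewrite ambient_drop.
  by split=> // Q; rewrite drop_normal_part => /setD1P[_]; exact: n.
apply/val_inj/eqP; apply: contrapT => /negP ne.
have sDS : stab D \subset S.
  by apply: subset_trans (subsetIl _ _) _; rewrite ambient_drop; exact: ambient_S.
have /(normalizer_grows sDS) : T \proper stab D by rewrite properEneq eq_sym ne.
suff -> : 'N_(stab D)(T) = T by rewrite properxx.
apply/eqP; rewrite eqEsubset subsetI TsD normG !andbT.
apply/subsetP => x /setIP[/stabP[xU n] xT].
rewrite -[gval T]/(gval (ntop A)) -sA; apply/stabP; rewrite -ambient_drop.
split=> // Q Qn; have [->//|QT] := eqVneq Q T.
by apply: n; rewrite drop_normal_part in_setD1 QT.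
Qed.

Lemma plus_drop : plus D = A.
Proof. by rewrite /plus drop_stab setD1K. Qed.

End NonNormal.
End DropTop.

End SubgroupChains.

(** * Transport of chains along morphisms of the fusion system *)

Section ConjugateChains.
Local Open Scope group_scope.
Import mathcomp.boot.fintype mathcomp.boot.finset.
Variables (l : nat) (gT : finGroupType) (S : {group gT}).
Variable F : {group gT} -> {group gT} -> {set {ffun gT -> gT}}.
Hypothesis fus : fusion_system S F.
Hypothesis lS : l.-group S.
Implicit Types (P Q R H K T : {group gT}) (f g : {ffun gT -> gT}) (A B D : {set {group gT}}).

Notation chain A := (subgroup_chain S F A).
Notation stab := (stab S).
Notation plus := (plus S).
Notation ambient := (ambient S).

Section Image.
Variables (P R : {group gT}) (f : {ffun gT -> gT}) (A : {set {group gT}}).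
Hypotheses (fF : f \in F P R) (cA : chain A) (AP : forall Q, Q \in A -> Q \subset P).
Let fA := img f @: A.

Lemma img_chain_inj : {in A &, injective (img f)}.
Proof. by move=> Q Q' QA Q'A; apply: (img_inj fus fF); exact: AP. Qed.

Lemma card_img_chain : #|fA| = #|A|.
Proof. exact: card_in_imset img_chain_inj. Qed.

Lemma img_chain : chain fA.
Proof.
have [A0 cenA tA] := cA; split.
- by apply: contraNneq A0 => /eqP; rewrite imset_eq0.
- by move=> _ /imsetP[Q QA ->]; apply: (centric_img fus fF) => //; [exact: AP|exact: cenA].
- move=> _ _ /imsetP[Q QA ->] /imsetP[Q' Q'A ->].
  by rewrite !(img_subset fus fF) ?AP //; exact: tA.
Qed.

Lemma img_normal_part : normal_part fA = img f @: normal_part A.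
Proof.
apply/setP => Q; apply/normal_partP/imsetP => [[/imsetP[H HA ->] n]|[H /normal_partP[HA n] ->]].
  exists H => //; apply/normal_partP; split=> // K KA KH.
  rewrite -(img_normal fus fF) ?AP //; apply: n; first exact: imset_f.
  by rewrite (img_subset fus fF) ?AP.
split; first exact: imset_f.
move=> _ /imsetP[K KA ->]; rewrite (img_subset fus fF) ?AP // => KH.
by rewrite (img_normal fus fF) ?AP // n.
Qed.

Lemma img_ntop : ntop fA = img f (ntop A).
Proof.
have [tn tmax] := ntopP cA; apply: top_eq; rewrite img_normal_part; first exact: imset_f.
move=> _ /imsetP[Q Qn ->]; rewrite (img_subset fus fF) ?tmax //.
  by apply: AP; exact: (subsetP (normal_part_sub A)).
by apply: AP; exact: (ntop_in cA).
Qed.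

Lemma img_nonnormal : (normal_part fA == fA) = (normal_part A == A).
Proof.
apply/eqP/eqP => [|e]; last by rewrite img_normal_part e.
rewrite img_normal_part => e; apply/eqP; rewrite eqEcard normal_part_sub /=.
rewrite -card_img_chain -e; exact: leq_imset_card.
Qed.

Lemma img_ambient : normal_part A != A -> ambient fA = img f (ambient A).
Proof.
move=> nn; have [aA an amin] := ambientP cA nn.
have inj Q : Q \in A -> (img f Q \in normal_part fA) = (Q \in normal_part A).
  move=> QA; rewrite img_normal_part; apply/imsetP/idP => [[Q' Q'n e]|]; last by exists Q.
  by rewrite (img_chain_inj QA (subsetP (normal_part_sub A) _ Q'n) e).
apply: bot_eq; first by rewrite in_setD inj // an imset_f.
move=> _ /setDP[/imsetP[Q QA ->]]; rewrite inj // => Qn.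
by rewrite (img_subset fus fF) ?AP // amin.
Qed.

(** The ambient group is a member of the chain, hence inside the domain of [f]. For a chain equal to
    its normal part it is [S], and only the inclusion in [img_sub_stab] remains. *)
Lemma img_stab : normal_part A != A -> stab fA = img f (stab A).
Proof.
move=> nn; have [aA _ _] := ambientP cA nn; have aP := AP aA.
have sP : stab A \subset P := subset_trans (stab_ambient S A) aP.
have nP Q : Q \in normal_part A -> Q \subset P.
  by move=> Qn; apply: AP; exact: (subsetP (normal_part_sub A)).
apply/val_inj; rewrite [RHS](imgE fus fF sP); apply/setP => y.
apply/stabP/imsetP => [|[x /stabP[xa n] ->]]; rewrite img_ambient //; last first.
  split; first by rewrite (mem_img fus fF) // (subsetP aP).
  move=> Q'; rewrite img_normal_part => /imsetP[Q Qn ->].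
  by rewrite (img_norm fus fF) ?nP ?n // (subsetP aP).
rewrite (imgE fus fF aP) => -[/imsetP[x xa ->] n]; exists x => //.
have xP := subsetP aP x xa; apply/stabP; split=> // Q Qn.
by rewrite -(img_norm fus fF (nP Q Qn) xP); apply: n; rewrite img_normal_part imset_f.
Qed.

Lemma img_plus : normal_part A != A -> plus fA = img f @: plus A.
Proof. by move=> nn; rewrite /plus imsetU1 img_stab. Qed.

End Image.

Definition conj_chain A B := exists P f,
  [/\ f \in F P S, forall Q, Q \in A -> Q \subset P & img f @: A = B].

Definition subconj A B := exists P f,
  [/\ f \in F P S, forall Q, Q \in A -> Q \subset P & img f @: A \subset B].

Lemma conj_subconj A B : conj_chain A B -> subconj A B.
Proof. by move=> [P [f [fF AP <-]]]; exists P, f. Qed.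

Lemma chain_top A : chain A -> exists T, [/\ T \in A, T \subset S & forall Q, Q \in A -> Q \subset T].
Proof.
move=> cA; have [A0 cen tA] := cA; have [TA Tmax] := topP tA A0.
by exists (top A); split=> //; have [] := cen _ TA.
Qed.

Lemma subset_subconj A B : chain A -> A \subset B -> subconj A B.
Proof.
move=> cA AB; have [T [TA TS Tmax]] := chain_top cA.
exists T, (conj_map T 1); split=> //; first exact: (fusion_incl fus).
by apply/subsetP => _ /imsetP[Q QA ->]; rewrite img_incl ?Tmax // (subsetP AB).
Qed.

(** The morphism given for [A] may send its domain outside [P']; it is first restricted to the
    largest member of [A]. *)
Lemma subconj_comp A B P' g : chain A -> subconj A B -> g \in F P' S ->
  (forall Q, Q \in B -> Q \subset P') ->
  exists P f h, [/\ h \in F P S, forall Q, Q \in A -> Q \subset P,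
    img f @: A \subset B & {in A, forall Q, img h Q = img g (img f Q)}].
Proof.
move=> cA [P [f [fF AP fAB]]] gF BP; have [T [TA TS Tmax]] := chain_top cA.
have [P'S _ _] := fusion_hom fus gF.
have fTP' : img f T \subset P'.
  by apply: BP; apply: (subsetP fAB); exact: imset_f.
have f'F := fusion_restrict fus fF (AP T TA) fTP' P'S.
exists T, (frestr T f), (ffcomp g (frestr T f)); split.
- exact: (fusion_comp fus f'F gF).
- exact: Tmax.
- apply/subsetP => _ /imsetP[Q QA ->]; rewrite img_frestr ?Tmax //.
  by apply: (subsetP fAB); exact: imset_f.
- by move=> Q QA; rewrite (img_comp fus f'F gF) ?Tmax.
Qed.

Lemma subconj_trans A B D : chain A -> subconj A B -> subconj B D -> subconj A D.
Proof.
move=> cA AB [P' [g [gF BP' gBD]]].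
have [P [f [h [hF AP fAB hE]]]] := subconj_comp cA AB gF BP'.
exists P, h; split=> //; apply/subsetP => _ /imsetP[Q QA ->].
rewrite hE //; apply: (subsetP gBD); apply: imset_f; apply: (subsetP fAB); exact: imset_f.
Qed.

Lemma subconj_card A B : chain A -> subconj A B -> (#|A| <= #|B|)%N.
Proof.
move=> cA [P [f [fF AP fAB]]]; rewrite -(card_img_chain fF AP).
exact: subset_leq_card.
Qed.

Lemma subconj_conj A B : chain A -> subconj A B -> (#|B| <= #|A|)%N -> conj_chain A B.
Proof.
move=> cA [P [f [fF AP fAB]]] BA; exists P, f; split=> //.
by apply/eqP; rewrite eqEcard fAB (card_img_chain fF AP).
Qed.

Lemma conj_chain_chain A B : chain A -> conj_chain A B -> chain B.
Proof. by move=> cA [P [f [fF AP <-]]]; exact: (img_chain fF). Qed.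

Lemma conj_chain_card A B : chain A -> conj_chain A B -> #|B| = #|A|.
Proof. by move=> cA [P [f [fF AP <-]]]; exact: (card_img_chain fF). Qed.

Lemma conj_chain_sym A B : conj_chain A B -> conj_chain B A.
Proof.
move=> [P [f [fF AP <-]]]; have [PS _ _] := fusion_hom fus fF.
have [g [gF _ _ gI]] := fusion_inverse fus fF.
have gS : g \in F (img f P) S.
  by apply: (fusion_corestrict fus gF) => //; rewrite gI.
exists (img f P), g; split=> //.
  by move=> _ /imsetP[Q QA ->]; rewrite (img_subset fus fF (AP Q QA) (subxx P)) AP.
rewrite -imset_comp -[RHS]imset_id; apply: eq_in_imset => Q QA.
by rewrite /= gI ?AP.
Qed.

Lemma conj_chain_refl A : chain A -> conj_chain A A.
Proof. by move=> cA; apply: subconj_conj => //; exact: subset_subconj. Qed.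

Lemma conj_card_ntop A B : chain A -> conj_chain A B -> #|ntop B| = #|ntop A|.
Proof.
move=> cA [P [f [fF AP <-]]]; rewrite (img_ntop fF) // (card_img fus fF) //.
by apply: AP; exact: (ntop_in cA).
Qed.

Lemma conj_normal A B : chain A -> conj_chain A B ->
  (normal_part B == B) = (normal_part A == A).
Proof. by move=> cA [P [f [fF AP <-]]]; exact: (img_nonnormal fF). Qed.

(** The extension property that saturation supplies for suitable representatives, in analogy with
    fully normalised subgroups. *)
Definition full A := forall B, conj_chain B A -> exists2 f,
  f \in F (stab B) S & img f @: B = A.

(* For good chains, the class of [plus A] only depends on that of [A]. *)
Definition good A := normal_part A != A \/ full A.

Lemma normal_chain_stab A Q : chain A -> normal_part A = A -> Q \in A -> Q \subset stab A.
Proof. by move=> cA nA QA; apply: normal_sub; apply: (normal_part_stab cA); rewrite nA. Qed.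

Lemma img_sub_stab A P f H : chain A -> normal_part A = A -> f \in F P S ->
  (forall Q, Q \in A -> Q \subset P) -> H \subset P -> H \subset stab A ->
  img f H \subset stab (img f @: A).
Proof.
move=> cA nA fF AP HP HsA; have cfA := img_chain fF cA AP.
have nfA : normal_part (img f @: A) = img f @: A by rewrite (img_normal_part fF AP) nA.
apply/subsetP => y; rewrite (imgE fus fF HP) => /imsetP[x xH ->].
apply/stabP; rewrite ambient_normal // nfA; split.
  by apply: (subsetP (img_sub fus fF HP)); rewrite (imgE fus fF HP) imset_f.
move=> _ /imsetP[Q QA ->]; rewrite (img_norm fus fF) ?AP ?(subsetP HP) //.
by have /stabP[_ +] := subsetP HsA x xH; apply; rewrite nA.
Qed.

(** The extended morphism embeds [stab B] into [stab A]. *)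
Lemma full_card_stab A B : chain A -> chain B -> normal_part A = A -> full A ->
  conj_chain B A -> (#|stab B| <= #|stab A|)%N.
Proof.
move=> cA cB nA fullA BA; have [f fF fBA] := fullA B BA.
have nB : normal_part B = B by apply/eqP; rewrite -(conj_normal cB BA) nA.
rewrite -(card_img fus fF (subxx _)) -fBA; apply: subset_leq_card.
by apply: (img_sub_stab cB nB fF) => // Q QB; exact: normal_chain_stab.
Qed.

(** Without normality the inserted group is transported by any morphism. For normal chains, fullness
    of both gives stabilisers of equal order, so the extended morphism maps one onto the other. *)
Lemma conj_plus A B : chain A -> chain B -> good A -> good B -> conj_chain A B ->
  conj_chain (plus A) (plus B) /\ (stab A = ntop A <-> stab B = ntop B).
Proof.
move=> cA cB gA gB AB; have BA := conj_chain_sym AB.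
have eqN X : chain X -> stab X = ntop X <-> #|stab X| = #|ntop X|.
  move=> cX; split=> [->//|e]; apply/val_inj/eqP.
  by rewrite eq_sym eqEcard (ntop_stab cX) e leqnn.
have nAB := conj_normal cA AB.
suff [AB' e] : conj_chain (plus A) (plus B) /\ #|stab A| = #|stab B|.
  by split=> //; rewrite !eqN // e (conj_card_ntop cA AB).
have [nA|nn] := boolP (normal_part A == A); last first.
  have [P [f [fF AP fAB]]] := AB; rewrite -fAB.
  have sP : stab A \subset P.
    by apply: subset_trans (stab_ambient S A) _; apply: AP; have [] := ambientP cA nn.
  rewrite (img_stab fF) // (card_img fus fF) //; split=> //.
  exists P, f; split=> //; last by rewrite (img_plus fF).
  by move=> Q /setU1P[->|/AP].
have nB : normal_part B == B by rewrite nAB.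
have fullA : full A by case: gA => //; rewrite nA.
have fullB : full B by case: gB => //; rewrite nB.
move/eqP in nA; move/eqP in nB.
have e : #|stab A| = #|stab B|.
  by apply/eqP; rewrite eqn_leq !full_card_stab.
split=> //; have [f fF fAB] := fullB A AB.
have sub : forall Q, Q \in plus A -> Q \subset stab A.
  by move=> Q /setU1P[->//|]; exact: normal_chain_stab.
exists (stab A), f; split=> //; rewrite /plus imsetU1 fAB; congr (_ |: _).
apply/val_inj/eqP; rewrite eqEcard (card_img fus fF) // e leqnn andbT -fAB.
by apply: (img_sub_stab cA nA fF) => // Q QA; apply: sub; rewrite setU1r.
Qed.

(** For normal chains, [B] contains a conjugate of [A], whose stabiliser contains [stab B]. By
    fullness of [A] that stabiliser has order at most [#|stab A|], which is the order of
    [ntop B]. *)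
Lemma good_plus A B : chain A -> good A -> chain B -> good B -> conj_chain (plus A) B ->
  stab B = ntop B.
Proof.
move=> cA gA cB gB pAB; have cp := plus_chain fus cA.
have [nA|nn] := boolP (normal_part A == A); last first.
  have gp : good (plus A) by left; rewrite (plus_normal cA).
  have [_ <-] := conj_plus cp cB gp gB pAB.
  by rewrite (stab_plus cA) (ntop_plus cA).
have fullA : full A by case: gA => //; rewrite nA.
have nB : normal_part B == B by rewrite (conj_normal cp pAB) (plus_normal cA).
move/eqP in nA; move/eqP in nB.
apply/val_inj/eqP; rewrite eq_sym eqEcard (ntop_stab cB) /=.
rewrite (conj_card_ntop cp pAB) (ntop_plus cA).
have [P [f [fF pP fpB]]] := pAB.
have AP Q : Q \in A -> Q \subset P by move=> QA; apply: pP; rewrite setU1r.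
have cfA := img_chain fF cA AP.
have nfA : normal_part (img f @: A) = img f @: A by rewrite (img_normal_part fF AP) nA.
have fAA : conj_chain (img f @: A) A by apply: conj_chain_sym; exists P, f.
apply: leq_trans (full_card_stab cA cfA nA fullA fAA).
apply: subset_leq_card; apply/subsetP => x /stabP[]; rewrite ambient_normal // nB => xS n.
apply/stabP; rewrite ambient_normal // nfA; split=> // Q QfA; apply: n.
by rewrite -fpB (subsetP (imsetS _ (subsetUr _ _))).
Qed.

(** Removing the top of the initial segment inverts insertion on classes. Without normality this is
    [plus_drop]. For normal chains, the good representative [B] is reached by some [f] defined on
    [stab (A :\ T)]. The normaliser of [img f T] in [stab B] stabilises the conjugate [img f @: A]
    of [A], so its order is at most [#|T|] by fullness of [A]; as normalisers grow, [stab B] is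
    [img f T]. *)
Lemma drop_plus A B : chain A -> good A -> stab A = ntop A -> A <> [set S] ->
  chain B -> good B -> conj_chain (A :\ ntop A) B ->
  stab B <> ntop B /\ conj_chain (plus B) A.
Proof.
move=> cA gA sA AS cB gB DB; set T := ntop A in DB *.
have D0 := drop_neq0 lS cA sA AS; have cD := drop_chain cA D0.
have TA := ntop_in cA; rewrite -/T in TA.
have [nA|nn] := boolP (normal_part A == A); last first.
  have gD : good (A :\ T) by left; exact: (drop_nonnormal lS cA sA).
  have [pDB e] := conj_plus cD cB gD gB DB; rewrite (plus_drop lS cA sA nn) in pDB.
  split; last exact: conj_chain_sym.
  move/e; rewrite (drop_stab lS cA sA nn) => Te.
  by have := ntop_in cD; rewrite -Te setD11.
have fullA : full A by case: gA => //; rewrite nA.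
move/eqP in nA.
have sub := subsetDl A [set T].
have nD : normal_part (A :\ T) = A :\ T.
  apply/eqP; rewrite eqEsubset normal_part_sub /=.
  by have := normal_part_subset sub; rewrite nA (setIidPl sub).
have nB : normal_part B == B by rewrite (conj_normal cD DB) nD.
have fullB : full B by case: gB => //; rewrite nB.
move/eqP in nB.
have [f fF fDB] := fullB _ DB.
have DP Q : Q \in A :\ T -> Q \subset stab (A :\ T) by exact: normal_chain_stab.
have TP : T \subset stab (A :\ T).
  apply/subsetP => x xT; apply/stabP; rewrite ambient_normal // nD; split.
    by apply: (subsetP (chain_subS cA TA)).
  move=> Q /setD1P[_ QA].
  have Tn : T \in normal_part A by rewrite nA.
  have [_ Tmax] := ntopP cA; have /normal_partP[_ n] := Tn.
  have QT : Q \subset T by apply: Tmax; rewrite nA.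
  by have /normal_norm/subsetP := n Q QA QT; apply.
have AP Q : Q \in A -> Q \subset stab (A :\ T).
  by move=> QA; have [->//|QT] := eqVneq Q T; apply: DP; rewrite in_setD1 QT.
have fA : img f @: A = img f T |: B by rewrite -fDB -imsetU1 setD1K.
have cfA := img_chain fF cA AP.
have AfA : conj_chain A (img f @: A) by exists (stab (A :\ T)), f.
have nfA : normal_part (img f @: A) = img f @: A by rewrite (img_normal_part fF AP) nA.
have fTs : img f T \subset stab B by rewrite -fDB; exact: (img_sub_stab cD nD fF DP TP TP).
have sBE : stab B = img f T.
  apply/val_inj/eqP; rewrite eq_sym; apply: contrapT => /negP ne.
  have pr : img f T \proper stab B by rewrite properEneq ne.
  have := normalizer_grows lS (stab_S cB) pr.
  move/proper_card; rewrite ltnNge; case/negP.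
  rewrite (card_img fus fF TP) (_ : #|T| = #|stab A|); last by rewrite sA.
  apply: leq_trans (full_card_stab cA cfA nA fullA (conj_chain_sym AfA)).
  apply: subset_leq_card; apply/subsetP => x /setIP[/stabP[]].
  rewrite ambient_normal // nB => xS n xT; apply/stabP; rewrite ambient_normal // nfA.
  by split=> // Q; rewrite fA => /setU1P[->//|]; exact: n.
split; last by rewrite /plus sBE -fA; exact: conj_chain_sym.
move=> e; have := ntop_in cB; rewrite -e sBE -fDB => /imsetP[Q /setD1P[QT QA]].
by move/(img_inj fus fF TP (AP Q QA)) => TQ; rewrite TQ eqxx in QT.
Qed.

End ConjugateChains.

(** * Sylow representatives of normal chains *)

Section FullRepresentatives.
Local Open Scope group_scope.
Import mathcomp.boot.fintype mathcomp.boot.finset.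
Variables (l : nat) (gT : finGroupType) (S : {group gT}).
Variable F : {group gT} -> {group gT} -> {set {ffun gT -> gT}}.
Hypothesis lS : l.-group S.
Hypotheses (fus : fusion_system S F) (sat : saturated l S F).
Implicit Types (P Q R H K T : {group gT}) (f g : {ffun gT -> gT}) (A B D : {set {group gT}}).

Notation chain A := (subgroup_chain S F A).
Notation stab := (stab S).

Section Automorphisms.
Variable P : {group gT}.
Hypothesis PS : P \subset S.
Implicit Types a b : {perm gT}.

Definition perm_map a : {ffun gT -> gT} := [ffun x => if x \in P then a x else 1].

(** Automorphisms in [F] are turned into permutations that fix the complement of [P], to obtain a
    finite group to which the Sylow theorems apply. *)
Definition fusion_aut := [set a | perm_on P a & perm_map a \in F P P].

Lemma fusion_aut_mem a x : a \in fusion_aut -> (a x \in P) = (x \in P).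
Proof. by rewrite inE => /andP[/perm_closed-> _]. Qed.

Lemma perm_mapM a b : a \in fusion_aut -> b \in fusion_aut -> perm_map (a * b) = ffcomp (perm_map b) (perm_map a).
Proof.
move=> aF bF; apply/ffunP => x; rewrite !ffunE permM.
have [xP|xP] := boolP (x \in P); first by rewrite fusion_aut_mem // xP.
by move: bF; rewrite inE => /andP[_ /(fusion1 fus)]; rewrite ffunE group1.
Qed.

Lemma perm_map1 : perm_map 1 = conj_map P 1.
Proof. by apply/ffunP => x; rewrite !ffunE perm1 invg1 conjg1. Qed.

Lemma fusion_aut_group_set : group_set fusion_aut.
Proof.
apply/group_setP; split=> [|a b aF bF].
  by rewrite inE perm_on1 perm_map1 (fusion_incl fus).
move: (aF) (bF); rewrite !inE => /andP[aP aF'] /andP[bP bF'].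
by rewrite perm_onM // perm_mapM // (fusion_comp fus aF' bF').
Qed.

Canonical fusion_aut_group := Group fusion_aut_group_set.

Lemma perm_map_inj : {in fusion_aut &, injective perm_map}.
Proof.
move=> a b; rewrite !inE => /andP[aP _] /andP[bP _] /ffunP ab.
apply/permP => x; have := ab x; rewrite !ffunE; case: ifP => [//|/negbT xP _].
by rewrite (out_perm aP) // (out_perm bP).
Qed.

Lemma perm_map_onto f : f \in F P P -> exists2 a, a \in fusion_aut & perm_map a = f.
Proof.
move=> fF; have [_ _ [_ finj fim f1]] := fusion_hom fus fF.
pose g x := if x \in P then f x else x.
have ginj : injective g.
  move=> x y; rewrite /g; case: ifP => xP; case: ifP => yP // e.
  - exact: finj.
  - by rewrite -e fim in yP.
  - by rewrite e fim in xP.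
have gE : perm_map (perm ginj) = f.
  apply/ffunP => x; rewrite ffunE permE /g.
  by have [xP|/f1->] := boolP (x \in P).
exists (perm ginj) => //; rewrite inE gE fF andbT.
apply/subsetP => x; rewrite inE permE /g; case: ifP => //.
by rewrite eqxx.
Qed.

Lemma card_fusion_aut : #|fusion_aut| = #|F P P|.
Proof.
rewrite -(card_in_imset perm_map_inj); congr #|pred_of_set _|; apply/setP => f.
apply/imsetP/idP => [[a + ->]|/perm_map_onto[a aF <-]]; last by exists a.
by rewrite inE => /andP[].
Qed.

Definition sylow_aut := [set a in fusion_aut | [exists x in 'N_S(P), perm_map a == conj_map P x]].

Lemma conj_mapM x y : x \in 'N(P) -> y \in 'N(P) ->
  ffcomp (conj_map P x) (conj_map P y) = conj_map P (x * y).
Proof.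
move=> xN yN; apply/ffunP => z; rewrite !ffunE; have [zP|_] := boolP (z \in P).
  by rewrite memJ_norm ?groupV // zP -conjgM invMg.
by rewrite group1 conj1g.
Qed.

Lemma sylow_aut_group_set : group_set sylow_aut.
Proof.
apply/group_setP; split=> [|a b].
  rewrite inE group1 /=; apply/exists_inP; exists 1; first exact: group1.
  by rewrite perm_map1.
move=> /setIdP[aF /exists_inP[x /setIP[xS xN] /eqP ax]].
move=> /setIdP[bF /exists_inP[y /setIP[yS yN] /eqP by_]].
rewrite inE groupM //=; apply/exists_inP; exists (y * x).
  by rewrite inE !groupM.
by rewrite perm_mapM // ax by_ conj_mapM.
Qed.

Canonical sylow_aut_group := Group sylow_aut_group_set.

Lemma sylow_aut_sylow : #|Aut_S S P| = ((#|F P P| : nat)`_l)%N -> l.-Sylow(fusion_aut) sylow_aut.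
Proof.
move=> e; rewrite pHallE card_fusion_aut -e; apply/andP; split.
  by apply/subsetP => a /setIdP[].
have inj : {in sylow_aut &, injective perm_map}.
  by move=> a b /setIdP[aF _] /setIdP[bF _]; exact: perm_map_inj.
rewrite -(card_in_imset inj); apply/eqP; congr #|pred_of_set _|; apply/setP => f.
apply/imsetP/imsetP => [[a /setIdP[aF /exists_inP[x xN /eqP ax]] ->]|[x xN ->]].
  by exists x.
have [xS xP] := setIP xN; have [_ + _ _] := fus => /(_ P P x PS PS xS).
rewrite (normP (groupVr xP)) => /(_ (subxx _)) /perm_map_onto[a aF ax].
exists a => //; rewrite inE aF; apply/exists_inP; exists x => //.
exact/eqP.
Qed.

Definition chain_aut A := [set a in fusion_aut | [forall Q in A, a @: (Q : {group gT}) == Q :> {set gT}]].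

Lemma chain_autP A a : reflect (a \in fusion_aut /\ forall Q, Q \in A -> a @: Q = Q)
  (a \in chain_aut A).
Proof.
apply: (iffP setIdP) => -[aF].
  by move=> /forall_inP n; split=> // Q QA; apply/eqP/n.
by move=> n; split=> //; apply/forall_inP => Q QA; apply/eqP/n.
Qed.

Lemma imset_permM a b (X : {set gT}) : (a * b)%g @: X = b @: (a @: X).
Proof. by rewrite -imset_comp; apply: eq_imset => x; rewrite /= permM. Qed.

Lemma imset_perm1 (X : {set gT}) : (1 : {perm gT}) @: X = X.
Proof. by rewrite -[RHS]imset_id; apply: eq_imset => x; rewrite perm1. Qed.

Lemma imset_permK a (X Y : {set gT}) : a @: X = Y -> (a^-1)%g @: Y = X.
Proof. by move=> <-; rewrite -imset_permM mulgV imset_perm1. Qed.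

Lemma chain_aut_group_set A : group_set (chain_aut A).
Proof.
apply/group_setP; split=> [|a b /chain_autP[aF an] /chain_autP[bF bn]]; apply/chain_autP.
  by split=> [|Q _]; [exact: group1|rewrite imset_perm1].
split; first exact: groupM.
by move=> Q QA; rewrite imset_permM an // bn.
Qed.

Canonical chain_aut_group A := Group (chain_aut_group_set A).

Lemma img_perm a Q : a \in fusion_aut -> Q \subset P -> img (perm_map a) Q = a @: Q :> {set gT}.
Proof.
move=> aF QP; have aF' : perm_map a \in F P P by move: aF; rewrite inE => /andP[].
rewrite (imgE fus aF' QP); apply: eq_in_imset => x xQ.
by rewrite ffunE (subsetP QP).
Qed.

Lemma chain_autJ A a b : (forall Q, Q \in A -> Q \subset P) -> a \in fusion_aut ->
  b \in chain_aut A -> b ^ a \in chain_aut (img (perm_map a) @: A).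
Proof.
move=> AP aF /chain_autP[bF bn]; apply/chain_autP; split; first exact: groupJ.
move=> _ /imsetP[Q QA ->]; rewrite img_perm ?AP // -imset_permM -conjgC.
by rewrite imset_permM bn.
Qed.

(* Equivalently, [sylow_aut] contains a Sylow subgroup of the stabiliser. *)
Lemma sylow_conjugate_chain A : (forall Q, Q \in A -> Q \subset P) ->
  l.-Sylow(fusion_aut) sylow_aut ->
  exists2 a, a \in fusion_aut & forall E : {group {perm gT}}, l.-group E ->
    E \subset chain_aut (img (perm_map a) @: A) ->
    exists2 b, b \in chain_aut (img (perm_map a) @: A) & E :^ b \subset sylow_aut.
Proof.
move=> AP syl; have [T sylT] := Sylow_exists l (chain_aut_group A).
have TF : T \subset fusion_aut.
  by apply: subset_trans (pHall_sub sylT) _; apply/subsetP => a /chain_autP[].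
(* The chain will be moved by the automorphism that takes a Sylow subgroup of its stabiliser into
   the Sylow subgroup induced by [S]. *)
have [a aF Ta] := Sylow_Jsub syl TF (pHall_pgroup sylT).
have aP : perm_map a \in F P P by move: aF; rewrite inE => /andP[].
exists a => // E lE EA; have aVF : a^-1 \in fusion_aut by exact: groupVr.
have A'P Q : Q \in img (perm_map a) @: A -> Q \subset P.
  by move=> /imsetP[Q' Q'A ->]; apply: (img_sub fus aP); exact: AP.
have A'A : img (perm_map a^-1) @: (img (perm_map a) @: A) = A.
  rewrite -imset_comp -[RHS]imset_id; apply: eq_in_imset => Q QA.
  apply/val_inj => /=; rewrite -[LHS]/(gval (img _ (img _ _))) img_perm //; last first.
    by apply: A'P; exact: imset_f.
  by apply: imset_permK; rewrite img_perm ?AP.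
have EaA : E :^ a^-1 \subset chain_aut A.
  apply/subsetP => _ /imsetP[b bE ->]; rewrite -A'A.
  by apply: chain_autJ => //; exact: (subsetP EA).
have lEa : l.-group (E :^ a^-1) by rewrite pgroupJ.
have [k kA Ek] := Sylow_Jsub sylT EaA lEa.
exists (k ^ a); first exact: chain_autJ.
apply: subset_trans Ta; rewrite -[k ^ a]/(a^-1 * (k * a)) mulgA !conjsgM.
by rewrite conjSg.
Qed.

(** [b] is conjugation by [x], transported from [Q] to [P] along [f]. *)
Lemma stab_perm Q f A x : f \in F Q P -> img f Q = P -> (forall R, R \in A -> R \subset Q) ->
  x \in S -> x \in 'N(Q) -> (forall R, R \in A -> x \in 'N(R)) ->
  exists2 b, b \in chain_aut (img f @: A) & {in Q, forall z, b (f z) = f (z ^ x^-1)}.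
Proof.
move=> fF fQ AQ xS xQ xA; have [QS _ _] := fusion_hom fus fF.
have [g [gF fK _ _]] := fusion_inverse fus fF; rewrite fQ in gF.
have [_ + _ _] := fus => /(_ Q Q x QS QS xS); rewrite (normP (groupVr xQ)) => /(_ (subxx _)) cF.
have [b bF bE] := perm_map_onto (fusion_comp fus (fusion_comp fus gF cF) fF).
have fP z : z \in Q -> f z \in P.
  by move=> zQ; rewrite -fQ (imgE fus fF) // imset_f.
have bf : {in Q, forall z, b (f z) = f (z ^ x^-1)}.
  move=> z zQ; have /ffunP/(_ (f z)) := bE.
  by rewrite !ffunE fP // fK // zQ.
exists b => //; apply/chain_autP; split=> // _ /imsetP[R RA ->].
apply/eqP; rewrite eqEcard card_imset ?leqnn ?andbT; last exact: perm_inj.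
apply/subsetP => _ /imsetP[y yR ->]; move: yR; rewrite (imgE fus fF (AQ R RA)) => /imsetP[z zR ->].
rewrite bf ?(subsetP (AQ R RA)) //; apply: imset_f.
by rewrite memJ_norm // groupV xA.
Qed.

(** The group usually written [N_f], to which the second axiom of saturation extends [f]. *)
Definition extension_set Q f := [set x in 'N_S(Q) |
  [exists y in 'N_S(P), [forall z in Q, f (z ^ x^-1) == f z ^ y^-1]]].

Lemma extension_setP Q f x : reflect (x \in 'N_S(Q) /\ exists2 y, y \in 'N_S(P) &
  {in Q, forall z, f (z ^ x^-1) = f z ^ y^-1}) (x \in extension_set Q f).
Proof.
apply: (iffP setIdP) => -[xN].
  by move=> /exists_inP[y yN /forall_inP yE]; split=> //; exists y => // z /yE/eqP.
move=> [y yN yE]; split=> //; apply/exists_inP; exists y => //.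
by apply/forall_inP => z zQ; apply/eqP/yE.
Qed.

Lemma extension_group_set Q f : group_set (extension_set Q f).
Proof.
apply/group_setP; split=> [|x x' /extension_setP[xN [y yN yE]] /extension_setP[x'N [y' y'N y'E]]].
  apply/extension_setP; split; first exact: group1.
  by exists 1 => [|z zQ]; rewrite ?group1 // invg1 !conjg1.
apply/extension_setP; split; first exact: groupM.
exists (y * y') => [|z zQ]; first exact: groupM.
rewrite !invMg !conjgM yE ?y'E // memJ_norm // groupV.
by case/setIP: x'N.
Qed.

Canonical extension_group Q f := Group (extension_group_set Q f).

End Automorphisms.

Lemma fully_normalised_conjugate P : P \subset S ->
  exists2 Q, F_conjugate F P Q & fully_normalised S F Q.
Proof.
move=> PS; pose c Q := [exists f in F P Q, f @: P == Q :> {set gT}].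
have cP Q : reflect (F_conjugate F P Q) (c Q).
  by apply: (iffP exists_inP) => -[f fF /eqP fQ]; exists f => //; apply/eqP.
have PP : c P.
  apply/cP; exists (conj_map P 1); first exact: (fusion_incl fus).
  by rewrite -(imgE fus (fusion_incl fus (subxx P) PS)) // img_incl.
have [Q /cP PQ Qmax] := arg_maxnP (fun Q : {group gT} => #|'N_S(Q)|) PP.
exists Q => // R QR; apply: Qmax; apply/cP.
exact: (F_conjugate_trans fus PQ QR).
Qed.

(** The top of the chain is made a fully normalised [P], so that [S] induces a Sylow subgroup of its
    automorphisms; the chain is then moved inside [P] until this contains a Sylow subgroup of its
    stabiliser. For a conjugate [D], the automorphisms of [P] coming from [stab D] form an
    [l]-group, and an automorphism preserving the chain moves them into those induced by [S].
    Corrected by it, the morphism from [D] extends to [stab D]. *)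
Lemma full_exists A : chain A -> normal_part A = A ->
  exists2 B, conj_chain S F A B & full S F B.
Proof.
move=> cA nA; have [sat1 sat2] := sat.
have [T [TA TS Tmax]] := chain_top cA.
have [P TP nP] := fully_normalised_conjugate TS.
have [f0 f0F f0T] := TP; have [_ PS _] := fusion_hom fus f0F.
have f0TP : img f0 T = P by apply/val_inj; rewrite /= -/(img f0 T) (imgE fus f0F).
have [cenP sylP] := sat1 P PS nP.
have A1P Q : Q \in img f0 @: A -> Q \subset P.
  by move=> /imsetP[R RA ->]; apply: (img_sub fus f0F); exact: Tmax.
have [a aF aE] := sylow_conjugate_chain PS A1P (sylow_aut_sylow PS sylP).
have aP : perm_map P a \in F P P by move: aF; rewrite inE => /andP[].
have aPP : img (perm_map P a) P = P.
  apply/val_inj/eqP; rewrite eqEcard; apply/andP; split; first exact: (img_sub fus aP).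
  exact: eq_leq (esym (card_img fus aP (subxx P))).
set B := img (perm_map P a) @: (img f0 @: A) in aE.
have BP Q : Q \in B -> Q \subset P.
  by move=> /imsetP[R RA ->]; apply: (img_sub fus aP); exact: A1P.
have PB : P \in B by apply/imsetP; exists P => //; apply/imsetP; exists T.
have AB : conj_chain S F A B.
  exists T, (ffcomp (perm_map P a) f0); split=> //.
    by apply: (fusion_corestrict fus (fusion_comp fus f0F aP)) => //;
      exact: subset_trans (img_sub fus (fusion_comp fus f0F aP) _) PS.
  rewrite /B -imset_comp; apply: eq_in_imset => Q QA /=.
  by rewrite (img_comp fus f0F aP) ?Tmax.
exists B => // D DB.
have BD := conj_chain_sym fus DB; have cB := conj_chain_chain fus cA AB.
have cD := conj_chain_chain fus cB BD.
have nD : normal_part D = D.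
  apply/eqP; rewrite (conj_normal fus cB BD) (conj_normal fus cA AB) nA.
  by [].
have DN Q : Q \in D -> Q \subset stab D by exact: (normal_chain_stab cD nD).
have [T2 [T2D T2S T2max]] := chain_top cD.
have [P2 [f1 [f1F DP2 f1D]]] := DB.
have T2P2 := DP2 T2 T2D.
have f1T2 : img f1 T2 = P.
  have f1T2B : img f1 T2 \in B by rewrite -f1D imset_f.
  apply/val_inj/eqP; rewrite eqEsubset; apply/andP; split; first exact: BP.
  have [Q QD PQ] : exists2 Q, Q \in D & P = img f1 Q.
    by apply/imsetP; rewrite f1D.
  have : img f1 Q \subset img f1 T2 by rewrite (img_subset fus f1F) ?T2max ?DP2.
  by rewrite -PQ.
pose f := frestr T2 f1.
have fF : f \in F T2 P by apply: (fusion_restrict fus f1F) => //; rewrite f1T2.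
have fT2 : img f T2 = P by rewrite img_frestr.
have fD : img f @: D = B.
  by rewrite -f1D; apply: eq_in_imset => Q QD; rewrite img_frestr ?T2max.
have xD x : x \in stab D -> [/\ x \in S, x \in 'N(T2) & forall R, R \in D -> x \in 'N(R)].
  move=> /stabP[]; rewrite ambient_normal // nD => xS n; split=> //.
  exact: n.
(* The automorphisms of [P] that [stab D] induces through [f]. *)
pose E := [set b in chain_aut P B |
  [exists x in stab D, [forall z in T2, b (f z) == f (z ^ x^-1)]]].
have EP b : reflect (b \in chain_aut P B /\ exists2 x, x \in stab D &
    {in T2, forall z, b (f z) = f (z ^ x^-1)}) (b \in E).
  apply: (iffP setIdP) => -[bB].
    by move=> /exists_inP[x xN /forall_inP xE]; split=> //; exists x => // z /xE/eqP.
  move=> [x xN xE]; split=> //; apply/exists_inP; exists x => //.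
  by apply/forall_inP => z zT; apply/eqP/xE.
have EG : group_set E.
  apply/group_setP; split=> [|b b' /EP[bB [x xN xE]] /EP[b'B [x' x'N x'E]]].
    apply/EP; split; first exact: group1.
    by exists 1 => [|z zT]; rewrite ?group1 // perm1 invg1 conjg1.
  apply/EP; split; first exact: groupM.
  exists (x' * x) => [|z zT]; first exact: groupM.
  rewrite permM xE // x'E ?invMg ?conjgM // memJ_norm // groupV.
  by case: (xD x xN).
pose EGr := Group EG.
have lE : l.-group EGr.
  apply/pgroupP => p p_pr /Cauchy[//|b /EP[bB [x xN xE]] bp].
  have [xS xT _] := xD x xN.
  (* Powers of [b] come from powers of [x], so the order of [b] divides [#|S|]. *)
  have bx n : {in T2, forall z, (b ^+ n) (f z) = f (z ^ (x ^+ n)^-1)}.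
    elim: n => [|n IHn] z zT; first by rewrite !expg0 perm1 invg1 conjg1.
    rewrite expgSr permM IHn // xE; last by rewrite memJ_norm // groupV groupX.
    by rewrite -conjgM -invMg -expgS.
  have b1 : b ^+ #|S| = 1.
    apply/permP => y; rewrite perm1; have [yP|yP] := boolP (y \in P); last first.
      have : b ^+ #|S| \in chain_aut P B by exact: groupX.
      by move=> /chain_autP[]; rewrite inE => /andP[/out_perm-> //].
    move: yP; rewrite -fT2 (imgE fus fF) // => /imsetP[z zT ->].
    by rewrite bx // expg_cardG // invg1 conjg1.
  have d : p %| #|S| by rewrite -bp order_dvdn b1.
  by have := pnat_dvd d lS; rewrite pnatE.
have EB : EGr \subset chain_aut P B by apply/subsetP => b /EP[].
have [beta betaB Ebeta] := aE EGr lE EB.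
have /chain_autP[betaF betaQ] := betaB.
have bF : perm_map P beta \in F P P by move: betaF; rewrite inE => /andP[].
(* As [beta] preserves each member of [B], the correction leaves the images of the members of [D]
   unchanged. *)
pose f' := ffcomp (perm_map P beta) f.
have f'F : f' \in F T2 P by exact: (fusion_comp fus fF bF).
have fP z : z \in T2 -> f z \in P.
  by move=> zT; rewrite -fT2 (imgE fus fF) // imset_f.
have f'E z : z \in T2 -> f' z = beta (f z) by move=> zT; rewrite ffunE ffunE fP.
have f'D Q : Q \in D -> img f' Q = img f Q.
  move=> QD; rewrite (img_comp fus fF bF) ?T2max //; apply/val_inj.
  have fQB : img f Q \in B by rewrite -fD imset_f.
  by rewrite -[LHS]/(gval (img _ _)) img_perm ?BP // betaQ.
have f'S : f' \in F T2 S.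
  apply: (fusion_corestrict fus f'F) => //.
  by rewrite f'D // fT2.
have f'T : f' @: T2 = P by rewrite -(imgE fus f'F) // f'D // fT2.
have [|g gF gE] := sat2 T2 P (extension_group P T2 f') f' f'S f'T cenP.
  by move=> x; split=> /extension_setP.
have NE : stab D \subset extension_group P T2 f'.
  apply/subsetP => x xN; have [xS xT xA] := xD x xN.
  apply/extension_setP; split; first by rewrite inE xS.
  have [b bB bE] := stab_perm fF fT2 T2max xS xT xA; rewrite fD in bB.
  have : b ^ beta \in sylow_aut P.
    apply: (subsetP Ebeta); rewrite memJ_conjg; apply/EP; split=> //.
    by exists x.
  move=> /setIdP[bbF /exists_inP[y yN /eqP yE]]; exists y => // z zT.
  have zxT : z ^ x^-1 \in T2 by rewrite memJ_norm // groupV.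
  rewrite !f'E // -bE //.
  have bP : beta (f z) \in P by rewrite (fusion_aut_mem _ betaF) fP.
  have /ffunP/(_ (beta (f z))) := yE; rewrite [LHS]ffunE [RHS]ffunE bP.
  by move=> <-; rewrite conjgE !permM permK.
have T2N : T2 \subset stab D by exact: DN.
have gS := fusion_restrict fus gF NE.
exists (frestr (stab D) g).
  apply: gS => //; exact: (img_sub fus gF).
rewrite -fD; apply: eq_in_imset => Q QD; rewrite img_frestr ?DN // -f'D //.
apply/val_inj; rewrite /=; congr <<_>>; apply: eq_in_imset => z zQ.
by rewrite gE // (subsetP (T2max Q QD)).
Qed.

Lemma good_exists A : chain A -> exists2 B, conj_chain S F A B & good S F B.
Proof.
move=> cA; have [nA|nn] := boolP (normal_part A == A).
  by have [B AB fB] := full_exists cA (eqP nA); exists B => //; right.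
by exists A; [exact: conj_chain_refl|left].
Qed.

Lemma whole_chain : chain [set S].
Proof.
split.
- by apply/set0Pn; exists S; rewrite set11.
- by move=> Q /set1P->; exact: (centric_whole fus).
- by move=> Q R /set1P-> /set1P->; rewrite subxx.
Qed.

Lemma stab_whole : stab [set S] = ntop [set S].
Proof.
have TE : ntop [set S] = S by apply/set1P; exact: (ntop_in whole_chain).
apply/val_inj/eqP; rewrite eqEsubset; apply/andP; split.
  by rewrite TE; exact: (stab_S whole_chain).
exact: (ntop_stab whole_chain).
Qed.

Lemma conj_whole B : conj_chain S F [set S] B -> B = [set S].
Proof.
move=> [P [f [fF SP <-]]]; have SP' : S \subset P by apply: SP; rewrite set11.
rewrite imset_set1; congr [set _]; apply/val_inj/eqP; rewrite eqEcard; apply/andP; split.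
  exact: (img_sub fus fF).
exact: eq_leq (esym (card_img fus fF SP')).
Qed.

End FullRepresentatives.

(** * The matching on conjugacy classes of chains *)

Section ChainClasses.
Local Open Scope group_scope.
Import mathcomp.boot.fintype mathcomp.boot.finset.
Variables (R : realType) (l : nat) (gT : finGroupType) (S : {group gT}).
Variable F : {group gT} -> {group gT} -> {set {ffun gT -> gT}}.
Hypothesis lS : l.-group S.
Hypotheses (fus : fusion_system S F) (sat : saturated l S F).
Implicit Types (A B X : {set {group gT}}).

Notation chain A := (subgroup_chain S F A).
Notation stab := (stab S).
Notation plus := (plus S).

Lemma subset_chain A B : chain B -> A \subset B -> A != set0 -> chain A.
Proof.
move=> [_ cen tB] AB A0; split=> //; last exact: tot_sub tB.
by move=> Q QA; apply: cen; exact: (subsetP AB).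
Qed.

Lemma stab_notin A : chain A -> stab A <> ntop A -> stab A \notin A.
Proof. by move=> cA ne; apply/negP => /(stab_in cA). Qed.

Lemma card_plus A : chain A -> stab A <> ntop A -> #|plus A| = #|A|.+1.
Proof. by move=> cA ne; rewrite cardsU1 stab_notin. Qed.

Lemma plus_stabD A : chain A -> stab A <> ntop A -> plus A :\ stab A = A.
Proof. by move=> cA ne; rewrite setU1K // stab_notin. Qed.

(** The inserted group is recovered from [plus A] as its [ntop], which morphisms respect. *)
Lemma conj_plus_inj A B : chain A -> chain B -> stab A <> ntop A -> stab B <> ntop B ->
  conj_chain S F (plus A) (plus B) -> conj_chain S F A B.
Proof.
move=> cA cB nA nB [P [f [fF pP fpB]]]; have cp := plus_chain fus cA.
have sE : stab B = img f (stab A).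
  by rewrite -(ntop_plus cB) -fpB (img_ntop fus fF cp pP) (ntop_plus cA).
exists P, f; split=> //; first by move=> Q QA; apply: pP; rewrite setU1r.
rewrite -(plus_stabD cB nB) sE -fpB -{1}(plus_stabD cA nA); apply/setP => Q.
have sp : stab A \in plus A by exact: setU11.
apply/imsetP/setD1P => [[H /setD1P[Hs Hp] ->]|[Qs /imsetP[H Hp QH]]].
  split; last exact: imset_f.
  by apply: contra_neq Hs => /(img_inj fus fF (pP H Hp) (pP _ sp)).
exists H => //; rewrite in_setD1 Hp andbT.
by apply: contra_neq Qs => e; rewrite QH e.
Qed.

Variables (C : finType) (le : C -> C -> Prop) (cl : {set {group gT}} -> C).
Hypothesis le_po : is_partial_order le.
Hypothesis cl_onto : forall p, exists2 A, chain A & cl A = p.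
Hypothesis leP : forall A B, chain A -> chain B -> le (cl A) (cl B) <-> subconj S F A B.

Lemma cl_eq A B : chain A -> chain B -> cl A = cl B <-> conj_chain S F A B.
Proof.
move=> cA cB; split=> [e|AB].
  have AB : subconj S F A B.
    by apply/leP => //; rewrite e; apply/leP => //; exact: subset_subconj.
  have BA : subconj S F B A.
    by apply/leP => //; rewrite e; apply/leP => //; exact: subset_subconj.
  apply: (subconj_conj fus cA AB); exact: (subconj_card fus cB BA).
apply: (po_anti le_po); apply/leP => //; apply: conj_subconj => //.
exact: conj_chain_sym.
Qed.

Lemma cl_good p : exists A, [/\ chain A, good S F A & cl A = p].
Proof.
have [A cA <-] := cl_onto p; have [B AB gB] := good_exists lS fus sat cA.
have cB := conj_chain_chain fus cA AB.
by exists B; split=> //; apply/cl_eq => //; exact: conj_chain_sym.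
Qed.

Let rep p := projT1 (cid (cl_good p)).
Let rep_chain p : chain (rep p). Proof. by rewrite /rep; case: cid => A []. Qed.
Let rep_good p : good S F (rep p). Proof. by rewrite /rep; case: cid => A []. Qed.
Let repK p : cl (rep p) = p. Proof. by rewrite /rep; case: cid => A []. Qed.

Let rep_conj A : chain A -> conj_chain S F A (rep (cl A)).
Proof. by move=> cA; apply/cl_eq => //; rewrite repK. Qed.

Let rep_le p q : le p q <-> subconj S F (rep p) (rep q).
Proof. by rewrite -{1}(repK p) -{1}(repK q); apply: leP. Qed.

Let lower : {set C} := [set p | stab (rep p) != ntop (rep p)].
Let up p := cl (plus (rep p)).
Let whole := cl [set S].

Let lowerP p : p \in lower -> stab (rep p) <> ntop (rep p).
Proof. by rewrite inE => /eqP. Qed.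

Let up_chain p : chain (plus (rep p)). Proof. exact: plus_chain. Qed.

Let rep_whole : rep whole = [set S].
Proof. by apply: (conj_whole fus); apply: rep_conj; exact: whole_chain. Qed.

(** The members of a chain have distinct orders, preserved by conjugation, so a class below that of
    [B] comes from exactly one subset of [B]: the classes below form the face poset of a simplex. *)
Let shadow B p := [set Q in B | [exists H in rep p, #|(H : {group gT})| == #|(Q : {group gT})|]].

Let shadow_conj B p : chain B -> le p (cl B) -> conj_chain S F (rep p) (shadow B p).
Proof.
move=> cB; rewrite -{1}(repK p) => /leP -/(_ (rep_chain p) cB)[P [f [fF pP fB]]].
exists P, f; split=> //; apply/setP => Q; apply/imsetP/setIdP => [[H Hp ->]|[QB]].
  split; first by apply: (subsetP fB); exact: imset_f.
  by apply/exists_inP; exists H => //; rewrite (card_img fus fF (pP H Hp)).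
move=> /exists_inP[H Hp /eqP e]; exists H => //.
have [_ _ tB] := cB; apply: (tot_card_inj tB) => //.
  by apply: (subsetP fB); exact: imset_f.
by rewrite (card_img fus fF (pP H Hp)).
Qed.

Let shadow_cl B p : chain B -> le p (cl B) -> chain (shadow B p) /\ cl (shadow B p) = p.
Proof.
move=> cB pB; have := shadow_conj cB pB => ps.
have cs := conj_chain_chain fus (rep_chain p) ps; split=> //.
by rewrite -[RHS](repK p); apply/cl_eq => //; exact: conj_chain_sym.
Qed.

Let shadow_mono B p q : chain B -> le p q -> le q (cl B) -> shadow B p \subset shadow B q.
Proof.
move=> cB /rep_le[P [f [fF pP fq]]] qB; apply/subsetP => Q /setIdP[QB /exists_inP[H Hp e]].
apply/setIdP; split=> //; apply/exists_inP; exists (img f H).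
  by apply: (subsetP fq); exact: imset_f.
by rewrite (card_img fus fF (pP H Hp)).
Qed.

Let shadow_sub B p : shadow B p \subset B.
Proof. by apply/subsetP => Q /setIdP[]. Qed.

(** Faces of the simplex [B] other than [B] and its facet [A] form a cone with apex [N]: each lies
    in its union with [[set N]]. The union is not in the class [a], since no member of [A] has the
    order of [N], and it is [B] only for the two excluded faces. *)
Let conical_face a : a \in lower -> exists c v,
  conical le (fun p => [/\ le p (up a), p <> up a & p <> a]) c v.
Proof.
move=> /lowerP al; set A := rep a in al; set B := plus A; set N := stab A.
have cA : chain A := rep_chain a; have cB : chain B := up_chain a.
have NB : N \in B by exact: setU11.
have NA : N \notin A := stab_notin cA al.
have [_ _ tB] := cB.
have le_refl p : le p p by rewrite -(repK p); apply/leP => //; exact: subset_subconj.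
have subN X : X \subset B -> N |: X \subset B.
  by move=> XB; rewrite subUset sub1set NB.
have chN X : X \subset B -> chain (N |: X).
  move=> XB; apply: subset_chain cB (subN X XB) _.
  by apply/set0Pn; exists N; rewrite setU11.
have cN1 : chain [set N] by rewrite -(setU0 [set N]); apply: chN; exact: sub0set.
have le_cl X Y : chain X -> chain Y -> X \subset Y -> le (cl X) (cl Y).
  by move=> cX cY XY; apply/leP => //; exact: subset_subconj.
have cl_neq_a X : X \subset B -> cl (N |: X) <> a.
  move=> XB; rewrite -(repK a) => /(cl_eq (chN X XB) cA)[P [f [fF pP fA]]].
  have fN : img f N \in A by rewrite -fA; apply: imset_f; rewrite setU11.
  case/negP: NA; suff <- : img f N = N by [].
  apply: (tot_card_inj tB) => //; first by rewrite setU1r.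
  by apply: (card_img fus fF); apply: pP; rewrite setU11.
have cl_up X : X \subset B -> chain X -> cl X = up a -> X = B.
  move=> XB cX e; apply/eqP; rewrite eqEcard XB.
  have /(cl_eq cX cB)/(conj_chain_card fus cX) -> : cl X = cl B := e.
  exact: leqnn.
pose c p := cl (N |: shadow B p).
have Qc p : [/\ le p (up a), p <> up a & p <> a] -> [/\ le (c p) (up a), c p <> up a & c p <> a].
  move=> [pb pnb pna]; split.
  - by apply: le_cl => //; [apply: chN|apply: subN]; exact: shadow_sub.
  - move=> /(cl_up _ (subN _ (shadow_sub B p)) (chN _ (shadow_sub B p))) e.
    have [cs sE] := shadow_cl cB pb.
    have As : A \subset shadow B p.
      apply/subsetP => Q QA; have : Q \in N |: shadow B p by rewrite e setU1r.
      by case/setU1P => // QN; rewrite -QN QA in NA.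
    have [Ns|Ns] := boolP (N \in shadow B p).
      apply: pnb; rewrite -sE; congr cl; apply/eqP.
      by rewrite eqEsubset shadow_sub subUset sub1set Ns.
    apply: pna; rewrite -sE -(repK a); congr cl; apply/eqP; rewrite eqEsubset As andbT.
    apply/subsetP => Q Qs; have := subsetP (shadow_sub B p) Q Qs.
    by case/setU1P => // QN; rewrite QN (negbTE Ns) in Qs.
  - exact/cl_neq_a/shadow_sub.
exists c, (cl [set N]); split=> //.
- split.
  + by apply: le_cl => //; rewrite sub1set.
  + have /set0Pn[Q QA] : A != set0 by case: cA.
    move=> /(cl_up [set N]); rewrite sub1set => /(_ NB cN1) e.
    have : Q \in B by rewrite setU1r.
    by rewrite -e => /set1P QN; rewrite -QN QA in NA.
  + by have := cl_neq_a set0 (sub0set B); rewrite setU0.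
- move=> p [pb _ _]; have [cs sE] := shadow_cl cB pb.
  rewrite -{1}sE; apply: le_cl => //; first by apply: chN; exact: shadow_sub.
  exact: subsetUr.
- move=> p _; apply: le_cl => //; first by apply: chN; exact: shadow_sub.
  exact: subsetUl.
- move=> p q [pb _ _] [qb _ _] pq; apply: le_cl; [by apply: chN; exact: shadow_sub..|].
  by apply: setUS; exact: shadow_mono.
Qed.

Theorem contractible_chain_classes : contractible R (realization R le).
Proof.
have le_refl p : le p p by rewrite -(repK p); apply/leP => //; exact: subset_subconj.
pose d p := #|rep p|; pose h p := #|ntop (rep p)|.
have dE A : chain A -> d (cl A) = #|A|.
  by move=> cA; rewrite /d (conj_chain_card fus cA (rep_conj cA)).
have S0 := whole_chain fus.
apply: (@contractible_acyclic_matching R C le le_po le_refl lower up whole d h); split.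
- move=> p; have [e|ne] := eqVneq (stab (rep p)) (ntop (rep p)); last first.
    by constructor 2; rewrite inE.
  have [eS|/eqP nS] := eqVneq (rep p) [set S].
    by constructor 1; rewrite -(repK p) eS.
  have cD := drop_chain (rep_chain p) (drop_neq0 lS (rep_chain p) e nS).
  have [ne pB] := drop_plus fus lS (rep_chain p) (rep_good p) e nS (rep_chain _) (rep_good _) (rep_conj cD).
  constructor 3; exists (cl (rep p :\ ntop (rep p))); first by rewrite inE; apply/eqP.
  rewrite -[LHS](repK p); apply/cl_eq => //; exact: conj_chain_sym.
- move=> a /lowerP al; rewrite inE negbK; apply/eqP.
  exact: (good_plus fus (rep_chain a) (rep_good a) (rep_chain _) (rep_good _) (rep_conj (up_chain a))).
- move=> a /lowerP al; split=> e.
    by apply: al; rewrite e rep_whole; exact: (stab_whole fus).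
  (* Insertion produces at least two members, so the result is not the chain [S]. *)
  have := dE _ (up_chain a); rewrite -/(up a) e (dE _ S0) cards1 card_plus // => -[] /esym/eqP.
  by rewrite cards_eq0; case: (rep_chain a) => /negbTE->.
- move=> p /rep_le pw; rewrite -(repK p); apply/cl_eq => //.
  rewrite rep_whole in pw; apply: (subconj_conj fus) => //.
  by rewrite cards1 card_gt0; case: (rep_chain p).
- move=> a b /lowerP al /lowerP bl /cl_eq -/(_ (up_chain a) (up_chain b)) ab.
  by rewrite -(repK a) -(repK b); apply/cl_eq => //; exact: conj_plus_inj.
- move=> a _; rewrite -{1}(repK a); apply/leP => //.
  by apply: subset_subconj => //; exact: subsetUr.
- by move=> a /lowerP al; rewrite dE // card_plus.
- move=> p q /rep_le pq ne; rewrite ltnNge; apply/negP => qp; apply: ne.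
  by rewrite -(repK p) -(repK q); apply/cl_eq => //; exact: (subconj_conj fus).
- move=> a a' /lowerP al /lowerP al'; rewrite -{1}(repK a) => /leP -/(_ (rep_chain a) (up_chain a')).
  move=> [P [f [fF aP fX]]] ne da; set X := img f @: rep a in fX.
  have aX : conj_chain S F (rep a) X by exists P, f.
  have cX := conj_chain_chain fus (rep_chain a) aX.
  have cardX : #|X| = #|rep a'| by rewrite (conj_chain_card fus (rep_chain a) aX); exact: da.
  (* [X] is a facet of [plus (rep a')]; the missing vertex is not the inserted group because [a] and
     [a'] differ. *)
  have [Q Qp XQ] : exists2 Q, Q \in plus (rep a') & X = plus (rep a') :\ Q.
    have : 0 < #|plus (rep a') :\: X|.
      by rewrite cardsD (setIidPr fX) cardX card_plus // subSnn.
    move=> /card_gt0P[Q /setDP[Qp QX]]; exists Q => //.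
    apply/eqP; rewrite eqEcard; apply/andP; split.
      by rewrite subsetD1 fX.
    by rewrite cardX -ltnS -(card_plus (rep_chain a') al') [leqRHS](cardsD1 Q) Qp.
  have QA : Q \in rep a'.
    case/setU1P: Qp => // Qs; case: ne; rewrite -(repK a) -(repK a'); apply/cl_eq => //.
    by rewrite -(plus_stabD (rep_chain a') al') -Qs -XQ.
  rewrite /h -(conj_card_ntop fus (rep_chain a) aX) XQ.
  apply: (ntop_plusD1 fus) => //; rewrite -XQ; by case: cX.
- exact: conical_face.
Qed.

End ChainClasses.

(** * Linking systems *)

Section LinkingSystems.
Local Open Scope group_scope.
Import mathcomp.boot.fintype mathcomp.boot.finset.
Variables (R : realType) (l : nat) (gT : finGroupType) (S : {group gT}).
Variable F : {group gT} -> {group gT} -> {set {ffun gT -> gT}}.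
Hypothesis satF : saturated_fusion_system l S F.
Variable L : linking_system S F.
Implicit Types X Y Z : centric_subgroup S F.

Let lS : l.-group S. Proof. by case: satF. Qed.
Let fus : fusion_system S F. Proof. by case: satF. Qed.
Let sat : saturated l S F. Proof. by case: satF. Qed.

Notation pi := (@lk_pi _ _ _ L _ _).
Notation delta := (@lk_delta _ _ _ L _).

Lemma lk_pi_in X Y (f : hom L X Y) : pi f \in F X Y.
Proof.
have : range (@lk_pi _ _ _ L X Y) (pi f) by exists f.
by rewrite lk_pi_onto.
Qed.

Lemma lk_lift X Y f : f \in F X Y -> exists h : hom L X Y, pi h = f.
Proof.
move=> fF; have : [set` F X Y]%classic f by [].
by rewrite -(lk_pi_onto L) => -[h _ <-]; exists h.
Qed.

(** Underlying homomorphisms are injective, so [f] and [f'] differ by an element of the centre of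
    [X]; this element fixes the composite with [g], and the action is free. *)
Lemma lk_mono : all_mono L.
Proof.
move=> X Y Z g f f' e; have [_ _ [_ ginj _ _]] := fusion_hom fus (lk_pi_in g).
have [_ _ [_ _ fY f1]] := fusion_hom fus (lk_pi_in f).
have [_ _ [_ _ f'Y f'1]] := fusion_hom fus (lk_pi_in f').
have ff' : pi f = pi f'.
  apply/ffunP => x; have [xX|xX] := boolP (x \in X); last by rewrite f1 // f'1.
  apply: ginj; [exact: fY|exact: f'Y|].
  by have /(congr1 pi)/ffunP/(_ x) := e; rewrite !lk_piM !ffunE.
have /lk_orbit[x xZ f'E] := ff'.
suff x1 : x = 1 by rewrite f'E x1 lk_delta1 cat_comp1.
by apply: (lk_free xZ (f := cat_comp g f)); rewrite -cat_compA -f'E.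
Qed.

(** A factorisation in [F] lifts to [L] up to an element of the centre of [X], which is absorbed
    into [h]. *)
Lemma lk_factor X Y Z (a : hom L X Z) (b : hom L Y Z) :
  img (pi a) X \subset img (pi b) Y -> exists h, cat_comp b h = a.
Proof.
move=> ab; have [g [gF gK Kg _]] := fusion_inverse fus (lk_pi_in b).
have [_ ZS _] := fusion_hom fus (lk_pi_in b).
have bS : img (pi b) Y \subset S := subset_trans (img_sub fus (lk_pi_in b) (subxx _)) ZS.
have aF := fusion_corestrict fus (lk_pi_in a) ab bS.
have [h hE] := lk_lift (fusion_comp fus aF gF).
have /lk_orbit[x xZ aE] : pi (cat_comp b h) = pi a.
  rewrite lk_piM hE; apply/ffunP => x; rewrite !ffunE.
  have [_ _ [_ _ fim f1]] := fusion_hom fus aF.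
  have [xX|xX] := boolP (x \in X); first by rewrite Kg // fim.
  by rewrite f1 // (fusion1 fus gF) (fusion1 fus (lk_pi_in b)).
by exists (cat_comp h (delta x)); rewrite cat_compA.
Qed.

Lemma lk_EI : is_EI L.
Proof.
move=> X f; have im : img (pi f) X = X.
  apply/val_inj/eqP; rewrite eqEcard; apply/andP; split.
    exact: (img_sub fus (lk_pi_in f)).
  exact: eq_leq (esym (card_img fus (lk_pi_in f) (subxx X))).
have [h hP] : exists h, cat_comp f h = cat_id L X.
  by apply: lk_factor; rewrite im; apply: (img_sub fus (lk_pi_in _)).
exists h; split=> //; apply: (lk_mono (g := f)); rewrite cat_compA hP.
by rewrite cat_comp1 cat_1comp.
Qed.

Definition whole_centric : centric_subgroup S F := CentricSubgroup (centric_whole fus).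

Lemma lk_incl X : {h : hom L X whole_centric | pi h = conj_map X 1}.
Proof.
apply: cid; apply: lk_lift; apply: (fusion_incl fus) => //.
by case: X => X [].
Qed.

Notation sub := (subobject L whole_centric).

(** Through this image, factorisation between subobjects of [S] in [L] becomes inclusion of
    subgroups. *)
Definition sub_img (a : sub) : {group gT} := img (pi (projT2 a)) (projT1 a).

Lemma sub_img_le (a b : sub) : sub_le a b <-> sub_img a \subset sub_img b.
Proof.
split=> [[h ha]|]; last exact: lk_factor.
rewrite /sub_img -ha lk_piM (img_comp fus (lk_pi_in _) (lk_pi_in _)) //.
by rewrite (img_subset fus (lk_pi_in _)) // (img_sub fus (lk_pi_in h)).
Qed.

Lemma sub_img_centric (a : sub) : centric S F (sub_img a).
Proof. by apply: (centric_img fus (lk_pi_in _)) => //; exact: csubP. Qed.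

Definition image_chain (s : Defs.chain L) (e : hom L (s ord_max) whole_centric) :
  {set {group gT}} := [set sub_img (sub_of e i) | i : 'I_(clen s).+1].

(** The members are taken inside the top object, already a subgroup of [S], which avoids choosing a
    map to [S]. By [image_incl] this is the image chain of a lift of the inclusion. *)
Definition base_chain (s : Defs.chain L) : {set {group gT}} :=
  [set img (pi (to_top s i)) (s i) | i : 'I_(clen s).+1].

Lemma image_chain_chain s e : subgroup_chain S F (@image_chain s e).
Proof.
split.
- by apply/set0Pn; exists (sub_img (sub_of e ord0)); exact: imset_f.
- by move=> _ /imsetP[i _ ->]; exact: sub_img_centric.
- move=> _ _ /imsetP[i _ ->] /imsetP[j _ ->].
  by case/orP: (leq_total i j) => /(sub_of_le e)/sub_img_le->; rewrite ?orbT.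
Qed.

Lemma base_sub_top (s : Defs.chain L) Q : Q \in base_chain s -> Q \subset s ord_max.
Proof. by move=> /imsetP[i _ ->]; exact: (img_sub fus (lk_pi_in _)). Qed.

Lemma image_chainE s e : @image_chain s e = img (pi e) @: base_chain s.
Proof.
rewrite /base_chain -imset_comp; apply: eq_imset => i /=.
by rewrite /sub_img /= lk_piM (img_comp fus (lk_pi_in _) (lk_pi_in _)).
Qed.

Lemma base_image_conj (s : Defs.chain L) e : conj_chain S F (base_chain s) (@image_chain s e).
Proof.
exists (s ord_max), (pi e); split; first exact: lk_pi_in.
  exact: base_sub_top.
by rewrite image_chainE.
Qed.

Lemma image_incl (s : Defs.chain L) : image_chain (projT1 (lk_incl (s ord_max))) = base_chain s.
Proof.
rewrite image_chainE -[RHS]imset_id; apply: eq_in_imset => Q Qs.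
have -> : pi (projT1 (lk_incl (s ord_max))) = conj_map (s ord_max) 1.
  exact: (projT2 (lk_incl (s ord_max))).
by rewrite img_incl // base_sub_top.
Qed.

Lemma base_chain_chain (s : Defs.chain L) : subgroup_chain S F (base_chain s).
Proof. by rewrite -image_incl; exact: image_chain_chain. Qed.

Lemma base_top (s : Defs.chain L) : gval (s ord_max) \in [set gval Q | Q in base_chain s].
Proof.
apply/imsetP; exists (img (pi (to_top s ord_max)) (s ord_max)); first exact: imset_f.
rewrite /to_top fmap1 lk_pi1 img_incl //.
Qed.

(** A morphism of chains embeds an image chain of [s], conjugate to its base chain, into the base
    chain of [t]. Conversely, a morphism of [F] restricted to the top of [s] lifts to [L], and the
    flag it defines is contained in that of [t]. *)
Lemma sd_hom_subconj (s t : Defs.chain L) : inhabited (sd_hom s t) <-> subconj S F (base_chain s) (base_chain t).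
Proof.
split=> [[f]|[P [f [fF sP fst]]]].
  have fE := sub_of_sd_hom f (projT1 (lk_incl (t ord_max))); rewrite /= in fE.
  set e := cat_comp _ _ in fE.
  apply: (subconj_trans fus (base_chain_chain s) (conj_subconj (base_image_conj e))).
  apply: (subset_subconj fus); first exact: image_chain_chain.
  rewrite -image_incl; apply/subsetP => _ /imsetP[i _ ->].
  apply/imsetP; exists (sd_map f i) => //; have [st ts] := fE i.
  by apply/val_inj/eqP; rewrite eqEsubset; apply/andP; split; apply/sub_img_le.
have sP' : s ord_max \subset P.
  by have /imsetP[Q Qs ->] := base_top s; exact: sP.
have [_ SS _] := fusion_hom fus fF.
have fS : img f (s ord_max) \subset S by exact: (img_sub fus fF sP').
have [e eE] := @lk_lift (s ord_max) whole_centric _ (fusion_restrict fus fF sP' fS SS).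
apply: (sd_hom_of_sub lk_EI lk_mono (e := e) (e' := projT1 (lk_incl (t ord_max)))) => i.
have : sub_img (sub_of e i) \in image_chain (projT1 (lk_incl (t ord_max))).
  rewrite image_incl; apply: (subsetP fst).
  have -> : img f @: base_chain s = image_chain e.
    rewrite image_chainE eE; apply: eq_in_imset => Q Qs.
    by rewrite img_frestr // base_sub_top.
  exact: imset_f.
by move=> /imsetP[j _ ij]; exists j; split; apply/sub_img_le; rewrite ij.
Qed.

Lemma base_chain_onto A : subgroup_chain S F A -> exists s, conj_chain S F (base_chain s) A.
Proof.
move=> cA; have [A0 cenA tA] := cA.
(* For a totally ordered set of subgroups, sorting by order sorts by inclusion. *)
pose r : seq {group gT} := sort (fun Q H : {group gT} => (#|Q| <= #|H|)%N) (enum A).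
have rA Q : (Q \in r) = (Q \in A) by rewrite mem_sort mem_enum.
have ur : uniq r by rewrite sort_uniq enum_uniq.
have [n rn] : exists n, size r = n.+1.
  exists (size r).-1; rewrite prednK // size_sort -cardE card_gt0.
  exact: A0.
pose Q (i : 'I_n.+1) := nth 1%G r i.
have Qr i : Q i \in r by rewrite mem_nth // rn.
have QA i : Q i \in A by rewrite -rA.
have card_tot : total (fun Q H : {group gT} => (#|Q| <= #|H|)%N) by move=> ? ?; exact: leq_total.
have card_trans : transitive (fun Q H : {group gT} => (#|Q| <= #|H|)%N).
  by move=> ? ? ? /leq_trans; apply.
have Qle (i j : 'I_n.+1) : (i <= j)%N -> Q i \subset Q j.
  move=> ij; apply: (tot_card tA) => //.
  apply: (sorted_leq_nth card_trans) => //; first exact: sort_sorted.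
  - by rewrite inE rn.
  - by rewrite inE rn.
pose X (i : 'I_n.+1) : sub :=
  mk_sub (projT1 (lk_incl (CentricSubgroup (cenA _ (QA i))))).
have XE i : sub_img (X i) = Q i.
  rewrite /sub_img /= (_ : pi _ = conj_map (Q i) 1).
    by rewrite img_incl.
  exact: (projT2 (lk_incl (CentricSubgroup (cenA _ (QA i))))).
have X_le (i j : 'I_n.+1) : (i <= j)%N -> sub_le (X i) (X j).
  by move=> ij; apply/sub_img_le; rewrite !XE Qle.
have X_lt (i j : 'I_n.+1) : j = i.+1 :> nat -> ~ sub_le (X j) (X i).
  move=> ij /sub_img_le; rewrite !XE => ji.
  have /eqP : Q i = Q j.
    by apply/val_inj/eqP; rewrite eqEsubset; apply/andP; split; [apply: Qle; rewrite ij|].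
  by rewrite nth_uniq ?rn // ij ltn_eqF.
exists (subobject_chain lk_mono X_le X_lt).
have -> : A = image_chain (projT2 (X ord_max) : hom L (subobject_chain lk_mono X_le X_lt ord_max) _).
  apply/setP => H; rewrite -rA; apply/idP/imsetP => [Hr|[i _ ->]]; last first.
    by rewrite sub_of_chain XE.
  have Hn : (index H r < n.+1)%N by rewrite -rn index_mem.
  by exists (Ordinal Hn) => //; rewrite sub_of_chain XE /Q nth_index.
exact: base_image_conj.
Qed.

Let Q := iso_class (subdivision L).
Let sdEI := subdivision_EI lk_EI.

Let repr (p : Q) : Defs.chain L := projT1 (cid (iso_class_ofP p)).
Let reprP (p : Q) : p = iso_class_of (subdivision L) (repr p).
Proof. by rewrite /repr; case: cid. Qed.

Let code (p : Q) := base_chain (repr p).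

Let code_inj : injective code.
Proof.
move=> p q e; rewrite (reprP p) (reprP q); apply/(iso_class_of_eq sdEI).
have r A : subgroup_chain S F A -> subconj S F A A.
  by move=> cA; exact: (subset_subconj fus).
by split; apply/sd_hom_subconj; rewrite -/(code p) -/(code q) e; apply: r; exact: base_chain_chain.
Qed.

Theorem contractible_orbit_space_linking : contractible R (orbit_space R L).
Proof.
have [s0 _] := base_chain_onto (whole_chain fus).
(* [s0] is the default value for sets that are not chains. *)
have /choice[s sP] A : exists s, subgroup_chain S F A -> conj_chain S F (base_chain s) A.
  case: (pselect (subgroup_chain S F A)) => [/base_chain_onto[s sA]|nA]; first by exists s.
  by exists s0 => /nA.
pose cl A : fin_of code_inj := iso_class_of (subdivision L) (s A).
have leP A B : subgroup_chain S F A -> subgroup_chain S F B ->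
    iso_class_le (cl A) (cl B) <-> subconj S F A B.
  move=> cA cB; have cb := base_chain_chain; have [As Bs] := (sP A cA, sP B cB).
  rewrite (iso_class_le_of sdEI) /= sd_hom_subconj; split=> AB.
    apply: (subconj_trans fus cA (conj_subconj (conj_chain_sym fus As))).
    exact: (subconj_trans fus (cb _) AB (conj_subconj Bs)).
  apply: (subconj_trans fus (cb _) (conj_subconj As)).
  exact: (subconj_trans fus cA AB (conj_subconj (conj_chain_sym fus Bs))).
apply: (@contractible_chain_classes R l gT S F lS fus sat (fin_of code_inj) _ cl) => //.
  exact: iso_class_po sdEI.
move=> p; exists (base_chain (repr p)); first exact: base_chain_chain.
have ps := sP _ (base_chain_chain (repr p)).
rewrite [RHS](reprP p); apply/(iso_class_of_eq sdEI); split; apply/sd_hom_subconj.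
  exact: conj_subconj.
exact/conj_subconj/conj_chain_sym.
Qed.

End LinkingSystems.

(** * Contractibility and comparison of the two orbit spaces *)

Local Open Scope classical_set_scope.
Local Open Scope ring_scope.

Theorem theoremC (R : realType) (l q e : nat) (G : reflection_coset l) (zeta : Zl l)
    (BX : sset) (x0 : BX 0%N) (iota : smap (K2 (rc_lat G)) BX)
    (l_prime : prime l)
    (BX_compact : connected_compact_group l x0)
    (iota_torus : maximal_torus x0 iota)
    (BX_weyl : weyl_group iota = rc_grp G)
    (G_simply_connected : simply_connected (loop_space x0))
    (l_very_good : very_good G)
    (phi_order : exists2 m, has_order (rc_phi G) m & ~~ (l %| m)%N)
    (q_prime_power : exists p k, [/\ prime p, (0 < k)%N & q = (p ^ k)%N])
    (q_coprime : ~~ (l %| q)%N)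
    (q_order : e.-primitive_root (q%:R : 'F_l))
    (zeta_root : zeta ^+ e = 1) :
  contractible R (orbit_space R (Te G zeta)) /\
  forall (psi tau : smap BX BX),
    unstable_adams iota q psi ->
    hequiv tau -> extends_to iota (rc_phi G) tau ->
  forall (gT : finGroupType) (S : {group gT})
      (F : {group gT} -> {group gT} -> {set {ffun gT -> gT}})
      (L : linking_system S F),
    saturated_fusion_system l S F ->
    shomotopy_equivalent (completion l (nerve L))
      (homotopy_fixed_points (scomp psi tau)) ->
    homotopy_equivalent R (orbit_space R L) (orbit_space R (Te G zeta)).
Proof.
split=> [|psi tau _ _ _ gT S F L satF _]; first exact: contractible_orbit_space_Te.
apply: contractible_homotopy_equivalent; first exact: (contractible_orbit_space_linking _ satF).
exact: contractible_orbit_space_Te.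
Qed.
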